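(* Let $C_0<\infty$ and $\rho_0\in(0,1)$. Suppose that $\mathsf X$ is a standard Borel space and that $P$ is a Markov transition kernel on $\mathsf X$ with stationary distribution $\pi$ satisfying $\sup_{x\in\mathsf X}\|P^m(x,\cdot)-\pi\|_{\mathrm{TV}}\le C_0\rho_0^m$ for all $m\ge0$. Let $(X_k)_{k\in\mathbb Z}$ be a two-sided stationary Markov chain with kernel $P$ and stationary law $\pi$, and put $\mathcal X:=\sigma(X_k:k\in\mathbb Z)$, $\mathcal P_j:=\sigma(X_k:k\le j)$ for $j\in\mathbb Z$. Let $n\ge1$. Then there exist an integer $L\ge2$ and constants $C_{\mathrm c}<\infty$, $\rho_{\mathrm c}\in(0,1)$, depending only on $(C_0,\rho_0)$, such that for each $i\in\{1,\dots,n\}$, on an extension of the original probability space one can construct two suffixes $$\omega^{i,r}:=(X^{i,r}_{i-1+k})_{k\ge0},\qquad r\in\{0,1\},$$ with the following properties. (i) (Anchoring, conditional exchangeability, refreshment.) $X^{i,0}_j=X_j$ for all $j\ge i-1$. Conditionally on $\mathcal P_{i-1}$, the pair $(\omega^{i,0},\omega^{i,1})$ is exchangeable and each $\omega^{i,r}$ is a Markov chain with kernel $P$ started from $X_{i-1}$. Moreover, for every bounded measurable $f:\mathsf X\to\mathbb R$, $$\mathbb E[f(X_i^{i,1})\mid\mathcal X]=Pf(X_{i-1})\quad\text{a.s.}$$ (ii) (Blockwise maximal coupling.) Let $\mathcal J^i_m:=\sigma(X^{i,r}_{i-1+k}:0\le k\le m,\ r\in\{0,1\})$. There exists an $(\mathcal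 J^i_m)_{m\ge0}$-stopping time $\kappa_i$ such that $X^{i,0}_{i-1+k}=X^{i,1}_{i-1+k}$ for all $k\ge\kappa_i$, and $$\mathbb P(\kappa_i>m\mid\mathcal P_{i-1})\le C_{\mathrm c}\rho_{\mathrm c}^m,\qquad m\ge0,\quad\text{a.s.}$$ (iii) (Preservation of prefix measurability.) Define $\mathfrak b(0):=0$ and $\mathfrak b(m):=1+L\lceil (m-1)/L\rceil$ for $m\ge1$, so that $m\le\mathfrak b(m)\le m+L-1$ for $m\geq 1$. Let $H_i=H_i(\omega^{i,0},\omega^{i,1})$ be an integrable measurable function of the two suffixes taking values in a finite-dimensional Hilbert space. Then $\mathbb E[H_i\mid\mathcal X]$ is measurable with respect to $\sigma(X_r:r\ge i-1)$. If, in addition, $H_i$ is $\mathcal J^i_{\mathfrak b(m)}$-measurable for some $m\ge0$, then $\mathbb E[H_i\mid\mathcal X]$ is measurable with respect to $\sigma(X_{i-1},\dots,X_{i-1+\mathfrak b(m)})$.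
   Context: $\|\mu-\nu\|_{\mathrm{TV}}:=\sup_A|\mu(A)-\nu(A)|$; $Pf(x)=\int f(y)P(x,dy)$. Exchangeable, conditionally on $\mathcal P_{i-1}$, means that the conditional laws of $(\omega^{i,0},\omega^{i,1})$ and $(\omega^{i,1},\omega^{i,0})$ given $\mathcal P_{i-1}$ agree a.s. Measurability of a conditional expectation means that it has a version with the stated measurability. *)

(* Defs.v *)
From HB Require Import structures.
From mathcomp Require Import all_boot all_order all_algebra.
From mathcomp Require Import all_classical all_reals all_analysis.

Set Implicit Arguments.
Unset Strict Implicit.
Unset Printing Implicit Defensive.

Import Order.TTheory GRing.Theory Num.Theory.
Import numFieldNormedType.Exports.

Local Open Scope classical_set_scope.
Local Open Scope ring_scope.

(* A measurable space is standard Borel when it is isomorphic to a complete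
   separable metric space endowed with its Borel sigma-algebra. *)
Definition polish (R : realType) (Y : metricType R) : Prop :=
  (forall F : set_system Y, ProperFilter F -> cauchy F ->
     exists y : Y, F --> y) /\
  (exists2 D : set Y, countable D & dense D).

Definition borel (T : topologicalType) : set (set T) := <<s @open T >>.

Definition standard_borel (R : realType) d (X : measurableType d) : Prop :=
  exists (Y : metricType R) (phi : X -> Y),
    [/\ polish Y, bijective phi &
        forall A : set X, measurable A <-> borel (phi @` A)].

(* sigma(f_k : k in K) *)
Definition sigma_gen d (X : measurableType d) (I T : Type) (K : set I)
    (f : I -> T -> X) : set (set T) :=
  <<s \bigcup_(k in K) preimage_set_system setT (f k) measurable >>.

(* Measurability with respect to sigma-algebras given as families of sets. *)
Definition submeas (T U : Type) (G : set (set T)) (B : set (set U))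
    (f : T -> U) : Prop :=
  forall A, B A -> G (f @^-1` A).

(* g is a version of E[f | G]; G is meant to be a sub-sigma-algebra. *)
Definition is_cexp (R : realType) d (T : measurableType d)
    (mu : probability T R) (G : set (set T)) (f g : T -> R) : Prop :=
  [/\ mu.-integrable setT (EFin \o f),
      mu.-integrable setT (EFin \o g),
      submeas G measurable g &
      forall A, G A ->
        (\int[mu]_(w in A) (g w)%:E = \int[mu]_(w in A) (f w)%:E)%E].

(* Real finite-dimensional Hilbert space: the norm (hence the topology) of V
   comes from the inner product ip, and V has a finite spanning family.
   Completeness is then automatic. *)
Definition findim_hilbert (R : realType) (V : normedModType R)
    (ip : V -> V -> R) : Prop :=
  [/\ forall u v, ip u v = ip v u,
      forall a u v w, ip (a *: u + v) w = a * ip u w + ip v w,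
      forall v, `|v| ^+ 2 = ip v v &
      exists (q : nat) (e : 'I_q -> V), forall v,
        exists c : 'I_q -> R, v = \sum_(j < q) c j *: e j].

(* Conditional expectation of a V-valued H, taken coordinate by coordinate:
   <u, g> is a version of E[<u, H> | G] for every u. *)
Definition is_cexp_vec (R : realType) d (T : measurableType d)
    (mu : probability T R) (G : set (set T)) (V : normedModType R)
    (ip : V -> V -> R) (H g : T -> V) : Prop :=
  submeas G (@borel V) g /\
  forall u, is_cexp mu G (fun w => ip u (H w)) (fun w => ip u (g w)).

Definition bounded_measurable (R : realType) d (X : measurableType d)
    (f : X -> R) : Prop :=
  measurable_fun setT f /\ exists M : R, forall x, `|f x| <= M.

Section kernels.
Context (R : realType) d (X : measurableType d) (P : R.-pker X ~> X).

(* P^m(x, A) *)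
Fixpoint kpow (m : nat) (x : X) (A : set X) : \bar R :=
  if m is m'.+1 then (\int[P x]_y kpow m' y A)%E else \d_x A.

Definition kerf (f : X -> R) (x : X) : R := \int[P x]_y f y.

Definition stationary_distribution (pi : probability X R) : Prop :=
  forall A, measurable A -> (\int[pi]_x P x A = pi A)%E.

End kernels.

Definition tv_dist (R : realType) d (X : measurableType d)
    (mu nu : set X -> \bar R) : \bar R :=
  ereal_sup [set `|mu A - nu A|%E | A in (measurable : set (set X))].

(* Two-sided chain. Constant marginals and the time-homogeneous Markov
   property make the law of the whole process shift-invariant. *)
Definition stationary_markov_chain (R : realType) dO (O : measurableType dO)
    (Pr : probability O R) d (X : measurableType d) (P : R.-pker X ~> X)
    (pi : probability X R) (Z : int -> O -> X) : Prop :=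
  [/\ forall k, measurable_fun setT (Z k),
      forall k A, measurable A -> Pr (Z k @^-1` A) = pi A &
      forall k (f : X -> R), bounded_measurable f ->
        is_cexp Pr (sigma_gen [set j : int | j <= k] Z)
          (f \o Z (k + 1)) (kerf P f \o Z k)].

(* Conditionally on G, the one-sided process Z is a Markov chain with kernel P
   started from x0: G is adjoined to the natural filtration of Z. *)
Definition cond_markov_from (R : realType) dO (O : measurableType dO)
    (Pr : probability O R) (G : set (set O)) d (X : measurableType d)
    (P : R.-pker X ~> X) (x0 : O -> X) (Z : nat -> O -> X) : Prop :=
  (forall w, Z 0%N w = x0 w) /\
  forall k (f : X -> R), bounded_measurable f ->
    is_cexp Pr <<s G `|` sigma_gen [set j : nat | (j <= k)%N] Z >>
      (f \o Z k.+1) (kerf P f \o Z k).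

(* (O', Pr') extends (O, Pr) through p; a random variable Z on O is
   identified with Z \o p. *)
Definition extension (R : realType) dO (O : measurableType dO)
    (Pr : probability O R) dO' (O' : measurableType dO')
    (Pr' : probability O' R) (p : O' -> O) : Prop :=
  [/\ measurable_fun setT p,
      forall w, exists w', p w' = w &
      forall A, measurable A -> Pr' (p @^-1` A) = Pr A].

(* A pair of trajectories is a map bool -> nat -> X, the index r = 0 being
   false and r = 1 being true. *)
Definition coord (X : Type) (rk : bool * nat) (y : bool -> nat -> X) : X :=
  y rk.1 rk.2.

Definition cyl d (X : measurableType d) : set (set (bool -> nat -> X)) :=
  sigma_gen setT (@coord X).

Definition pair_path (X O : Type) (Y : bool -> nat -> O -> X) (w : O) :
    bool -> nat -> X :=
  fun r k => Y r k w.

Definition swap_path (X O : Type) (Y : bool -> nat -> O -> X) (w : O) :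
    bool -> nat -> X :=
  fun r k => Y (~~ r) k w.

(* The conditional laws of (Y 0, Y 1) and (Y 1, Y 0) given G agree. *)
Definition cond_exchangeable (R : realType) dO (O : measurableType dO)
    (Pr : probability O R) (G : set (set O)) d (X : measurableType d)
    (Y : bool -> nat -> O -> X) : Prop :=
  forall B, @cyl _ X B -> exists g : O -> R,
    is_cexp Pr G \1_(pair_path Y @^-1` B) g /\
    is_cexp Pr G \1_(swap_path Y @^-1` B) g.

Definition prefix_sigma d (X : measurableType d) (O : Type)
    (Y : bool -> nat -> O -> X) (m : nat) : set (set O) :=
  sigma_gen [set rk : bool * nat | (rk.2 <= m)%N] (fun rk => Y rk.1 rk.2).

(* Random times have values in option nat, None standing for infinity. *)
Definition time_le (t : option nat) (m : nat) : bool :=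
  if t is Some k then (k <= m)%N else false.

Definition stopping_time (O : Type) (J : nat -> set (set O))
    (kappa : O -> option nat) : Prop :=
  forall m, J m [set w | time_le (kappa w) m].

(* b(0) = 0 and b(m) = 1 + L * ceil((m - 1) / L) for m >= 1; the ceiling is the
   quotient, plus one when L does not divide m - 1. *)
Definition bblock (L m : nat) : nat :=
  if m is m'.+1 then (1 + L * (m' %/ L + ~~ (L %| m')))%N else 0%N.

(* Main.v *)
Require Import Defs.
From HB Require Import structures.
From mathcomp Require Import all_boot all_order all_algebra.
From mathcomp Require Import all_classical all_reals all_analysis.
From mathcomp Require Import measurable_realfun.
From mathcomp Require Import zify ring lra.

Set Implicit Arguments.
Unset Strict Implicit.
Unset Printing Implicit Defensive.

Import Order.TTheory GRing.Theory Num.Theory.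
Import numFieldNormedType.Exports.

Local Open Scope classical_set_scope.
Local Open Scope ring_scope.

(* Everything is driven by one uniform noise variable, which can be split into
   independent uniform variables, so that every conditional law is realised by a
   measurable function of the past and of the noise. The first step of the second
   path is resampled; afterwards it proceeds by blocks of length L = 2m, where
   P^m is within 1/16 of pi. Then P^L dominates pi restricted to a set G, up to a
   factor 1/8 (Doeblin), on average over the initial point: thinning the first
   path by the density h of this minorant with respect to the law of its two
   endpoints rings a bell, with probability at least 1/16 per block, such that the
   pair (bell, endpoint at a ring) is independent of the initial point. The second
   path reuses this pair and resamples the rest of its block: both paths then end
   at the same point whenever the bell rings, after which they stay together.
   Given the two starting points and the bell, the two block paths are
   conditionally independent with the same sampler, hence the one-block transition
   is symmetric and exchangeability follows by induction. Up to the end of each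
   block the second path is a function of the first one up to that time and of
   independent noise, which gives prefix measurability through Fubini's theorem. *)

(** Closeness of [P^m] to [pi] in total variation bounds densities from below only for most pairs of
    endpoints. Passing through a midpoint, whence [L = 2m], repairs this: for every endpoint in a
    fixed set [G] and almost every starting point, most midpoints are good for both half-blocks.
    Everything is phrased for joint laws, so that no density of [P^m(x, .)] has to be chosen
    measurably in [x]. Three constraints shape the coupling. The first path is the given chain, so
    it can only be thinned. Prefix measurability forbids looking beyond the end of a block, so the
    bell depends on the endpoints of the block and on noise. Exchangeability requires the partner to
    receive only what it could have produced itself: the law of the bell pair must not depend on the
    start, and the endpoint is forgotten when the bell is silent. The first step is kept apart
    because refreshment makes it independent of the whole chain; hence blocks end at times
    [1 + L j], the values of [b(m)] for [m >= 1]. *)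

Definition seq_cylinders d (X : measurableType d) : set (set (nat -> X)) :=
  \bigcup_k preimage_set_system setT (fun s : nat -> X => s k) measurable.

Notation seqspace X := (g_sigma_algebraType (@seq_cylinders _ X)).

Lemma measurable_preim d d' (T : measurableType d) (U : measurableType d')
    (f : T -> U) (A : set U) :
  measurable_fun setT f -> measurable A -> measurable (f @^-1` A).
Proof. by move=> mf mA; rewrite -[X in measurable X]setTI; exact: mf. Qed.

Section sequence_space.
Context d (X : measurableType d).

Lemma measurable_coord (k : nat) :
  measurable_fun setT (fun s : seqspace X => s k).
Proof.
move=> _ A mA; apply: sub_sigma_algebra.
by exists k => //; exists A.
Qed.

Lemma measurable_seq d' (T : measurableType d') (f : T -> seqspace X) :
  (forall k, measurable_fun setT (fun t => f t k)) -> measurable_fun setT f.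
Proof.
move=> mf; apply: (@measurability _ _ T (seqspace X) setT f (@seq_cylinders _ X) erefl).
move=> _ [_ [k _ [A mA <-]] <-].
rewrite setTI /= setTI -[X in measurable X]setTI.
exact: mf.
Qed.

Lemma measurable_comp_coord d' (T : measurableType d') (f : T -> seqspace X) k :
  measurable_fun setT f -> measurable_fun setT (fun t => f t k).
Proof. by move=> mf; exact: (measurableT_comp (measurable_coord k) mf). Qed.

Lemma measurable_reindex (s : nat -> nat) :
  measurable_fun setT ((fun e => fun k => e (s k)) : seqspace X -> seqspace X).
Proof. by apply: measurable_seq => k; exact: measurable_coord. Qed.

End sequence_space.

(** * Equality of laws tested on generating events *)

Section laws.
Context (R : realType).

Lemma law_integral dA dB d (A : measurableType dA) (B : measurableType dB)
    (T : measurableType d) (mu : probability A R) (nu : probability B R)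
    (f : A -> T) (g : B -> T) :
  measurable_fun setT f -> measurable_fun setT g ->
  (forall S, measurable S -> mu (f @^-1` S) = nu (g @^-1` S)) ->
  forall F : T -> \bar R, measurable_fun setT F -> (forall t, 0 <= F t)%E ->
  (\int[mu]_a F (f a) = \int[nu]_b F (g b))%E.
Proof.
move=> mf mg fg F mF F0.
have -> : (\int[mu]_a F (f a) = \int[pushforward mu f]_t F t)%E.
  by rewrite ge0_integral_pushforward.
have -> : (\int[nu]_b F (g b) = \int[pushforward nu g]_t F t)%E.
  by rewrite ge0_integral_pushforward.
by apply: eq_measure_integral => S mS _; exact: fg.
Qed.

Lemma law_ext dA dB d (A : measurableType dA) (B : measurableType dB)
    (T : measurableType d) (G : set (set T)) (mu : probability A R)
    (nu : probability B R) (f : A -> T) (g : B -> T) :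
  measurable = <<s G >> -> setI_closed G -> G setT ->
  measurable_fun setT f -> measurable_fun setT g ->
  (forall S, G S -> mu (f @^-1` S) = nu (g @^-1` S)) ->
  forall S, measurable S -> mu (f @^-1` S) = nu (g @^-1` S).
Proof.
move=> mG IG GT mf mg fg.
apply: (@measure_unique _ R T G (fun=> setT) mG IG _ _
  (measure_function_pushforward__canonical__measure_function_Measure mu mf)
  (measure_function_pushforward__canonical__measure_function_Measure nu mg)) => //.
  by rewrite bigcup_const.
by move=> _; apply: le_lt_trans (probability_le1 mu _) (ltry 1); rewrite preimage_setT.
Qed.

End laws.

(** * Densities and uniform noise *)

Section conditional_probability.
Context (R : realType).

Definition image_law dA d (A : measurableType dA) (T : measurableType d)
    (mu : probability A R) (f : A -> T) (mf : measurable_fun setT f) :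
    probability T R :=
  distribution mu (mfun_Sub (mem_set mf)).

Lemma image_lawE dA d (A : measurableType dA) (T : measurableType d)
    (mu : probability A R) (f : A -> T) (mf : measurable_fun setT f) S :
  image_law mu mf S = mu (f @^-1` S).
Proof. by []. Qed.

Lemma integral_image_law dA d (A : measurableType dA) (T : measurableType d)
    (mu : probability A R) (f : A -> T) (mf : measurable_fun setT f) S F :
  measurable S -> measurable_fun setT F -> (forall t, 0 <= F t)%E ->
  (\int[image_law mu mf]_(t in S) F t = \int[mu]_(a in f @^-1` S) F (f a))%E.
Proof.
move=> mS mF F0; rewrite (@eq_measure_integral _ _ _ _ (pushforward mu f))//.
rewrite ge0_integral_pushforward//.
exact: measurable_funTS.
Qed.

Lemma probability_lty d (T : measurableType d) (mu : probability T R) A :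
  measurable A -> (mu A < +oo)%E.
Proof. by move=> mA; exact: le_lt_trans (probability_le1 mu mA) (ltry 1). Qed.

Lemma integral_probability_cst d (T : measurableType d) (mu : probability T R)
    (c : \bar R) :
  (\int[mu]_t c = c)%E.
Proof.
rewrite integral_cst//.
by transitivity (c * 1)%E; [congr (_ * _)%E; exact: probability_setT|rewrite mule1].
Qed.

(** On the set [D] where [g < f], [g] is finite and the nonnegative function [f - g] has integral
    zero, so [D] is null. This turns inequalities between joint laws into almost sure ones. *)
Lemma ae_le_integral d (T : measurableType d) (mu : measure T R)
    (f g : T -> \bar R) :
  measurable_fun setT f -> measurable_fun setT g ->
  (forall t, 0 <= f t)%E -> (forall t, 0 <= g t)%E ->
  (\int[mu]_t g t < +oo)%E ->
  (forall A, measurable A -> (\int[mu]_(t in A) f t <= \int[mu]_(t in A) g t)%E) ->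
  {ae mu, forall t, (f t <= g t)%E}.
Proof.
move=> mf mg f0 g0 goo fg.
pose D := [set t | g t < f t]%E.
have mD : measurable D.
  by rewrite -[D]setTI; exact: emeasurable_fun_lt.
have gfin t : D t -> g t \is a fin_num.
  by move=> Dt; rewrite ge0_fin_numE// (lt_le_trans Dt (leey _)).
pose h t := (f t - g t)%E.
have h0 t : D t -> (0 <= h t)%E.
  by move=> Dt; rewrite /h sube_ge0 ?gfin ?orbT// ltW.
have mh : measurable_fun D h.
  by apply: emeasurable_funB; exact: measurable_funTS.
have gD : (\int[mu]_(t in D) g t)%E \is a fin_num.
  rewrite ge0_fin_numE; last by apply: integral_ge0.
  apply: le_lt_trans goo; apply: ge0_subset_integral => //.
have fD : (\int[mu]_(t in D) f t = \int[mu]_(t in D) g t + \int[mu]_(t in D) h t)%E.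
  rewrite -ge0_integralD//; last exact: measurable_funTS.
  by apply: eq_integral => t; rewrite inE => Dt; rewrite /h addeC subeK// gfin.
have hD : (\int[mu]_(t in D) `|h t| = 0)%E.
  under eq_integral do [rewrite gee0_abs; last by apply: h0; rewrite -inE].
  apply/eqP; rewrite eq_le integral_ge0 ?andbT//.
  have := fg _ mD; rewrite fD.
  by rewrite -{2}(adde0 (\int[mu]_(t in D) g t)%E) leeD2lE.
have [N [mN N0 sN]] := (ae_eq_integral_abs mu mD mh).1 hD.
exists N; split => // t /= /negP; rewrite -ltNge => Dt; apply: sN => /=.
move=> /(_ Dt) /(congr1 (fun x => x + g t)%E).
rewrite /h subeK ?gfin// add0e => fgt.
by move: Dt; rewrite /D /= fgt ltxx.
Qed.

(** Domination by [mu] gives finiteness, absolute continuity and a Radon-Nikodym density at most 1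
    almost everywhere. *)
Lemma bounded_density d (T : measurableType d) (mu : probability T R)
    (nu : measure T R) :
  (forall A, measurable A -> nu A <= mu A)%E ->
  exists q : T -> R, [/\ measurable_fun setT q, (forall t, 0 <= q t <= 1) &
    forall A, measurable A -> nu A = (\int[mu]_(t in A) (q t)%:E)%E].
Proof.
move=> numu.
have finnu : fin_num_fun nu.
  move=> A mA; rewrite ge0_fin_numE//.
  exact: le_lt_trans (numu _ mA) (probability_lty mu mA).
(* The Radon-Nikodym theorem is applied to [nu] as a finite measure, a structure assembled here on
   the same underlying function. *)
pose H1 := isFinite.Build _ _ _ _ finnu.
have sf : sigma_finite setT nu.
  by apply: fin_num_fun_sigma_finite => //; rewrite measure0.
pose H2 := isSFinite.Build _ _ _ _ (sfinite_measure_sigma_finite sf).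
pose H3 := isSigmaFinite.Build _ _ _ _ sf.
pose nuf := HB.pack_for (FiniteMeasure.type T R) (Measure.sort nu) H1 H2 H3.
have nuE : nuf = nu :> (set T -> \bar R) by [].
have dom : nuf `<< mu.
  apply/null_content_dominatesP => A mA A0; apply/eqP.
  by rewrite eq_le measure_ge0 andbT nuE -A0 numu.
have [f [f0 ffin fint fE]] := radon_nikodym_sigma_finite dom.
have mf : measurable_fun setT f := measurable_int _ fint.
(* Truncation makes the bound hold everywhere while changing the density on a null set only. *)
pose g t := Order.min (f t) 1%E.
have mg : measurable_fun setT g.
  by apply: measurable_mine => //; exact: measurable_cst.
have fg : ae_eq mu setT f g.
  have : {ae mu, forall t, (f t <= 1)%E}.
    apply: ae_le_integral => //; first by rewrite integral_probability_cst ltry.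
    move=> A mA; rewrite -fE// nuE integral_cst// mul1e; exact: numu.
  by apply: filterS => t ft1 _; rewrite /g min_l.
have gfin t : g t \is a fin_num.
  by rewrite /g; case: leP.
exists (fine \o g); split.
- exact: measurableT_comp.
- move=> t; rewrite -!lee_fin /= fineK// /g le_min f0 lee01 /=.
  by rewrite ge_min lexx orbT.
- move=> A mA; rewrite -nuE fE//.
  under [RHS]eq_integral do rewrite /= fineK//.
  apply: ge0_ae_eq_integral => //.
  + exact: measurable_funTS.
  + exact: measurable_funTS.
  + by move=> t _; rewrite /g le_min f0 lee01.
  + by apply: filterS fg => t fgt _; apply: fgt.
Qed.

(** [q \o f] is a version of the conditional probability of [B] given [f], in factorised form. *)
Lemma conditional_density dA d (A : measurableType dA) (T : measurableType d)
    (mu : probability A R) (f : A -> T) (mf : measurable_fun setT f) B :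
  measurable B ->
  exists q : T -> R, [/\ measurable_fun setT q, (forall t, 0 <= q t <= 1) &
    forall S, measurable S ->
      (mu (f @^-1` S `&` B) = \int[image_law mu mf]_(t in S) (q t)%:E)%E].
Proof.
move=> mB.
pose nu := measure_function_pushforward__canonical__measure_function_Measure
  (mrestr mu mB) mf.
have [|q [mq q01 qE]] := @bounded_density _ T (image_law mu mf) nu.
  move=> S mS; have mfS := measurable_preim mf mS.
  by rewrite image_lawE; apply: le_measure; rewrite ?inE//; exact: measurableI.
by exists q.
Qed.

End conditional_probability.

Section uniform_noise.
Context (R : realType).

Definition unoise : probability (measurableTypeR R) R := uniform_prob (@ltr01 R).

Lemma unoiseE (A : set (measurableTypeR R)) : measurable A ->
  unoise A = lebesgue_measure (A `&` `[0, 1]).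
Proof.
move=> mA.
rewrite -[unoise A]/(\int[lebesgue_measure]_(x in A) (uniform_pdf 0 1 x)%:E)%E.
rewrite integral_uniform_pdf (eq_integral (cst 1%E)); last first.
  move=> x; rewrite inE => -[_]; rewrite /= in_itv /= => x01.
  by rewrite /uniform_pdf x01 subr0 invr1.
by rewrite integral_cst ?mul1e//; exact: measurableI.
Qed.

Lemma unoise_itv (a b : R) : 0 <= a -> a <= b -> b <= 1 ->
  unoise [set u | a <= u < b] = (b - a)%:E.
Proof.
move=> a0 ab b1.
have -> : [set u | a <= u < b] = [set` `[a, b[%R] :> set R.
  by apply/seteqP; split => u /=; rewrite in_itv.
rewrite unoiseE; last exact: measurable_itv.
rewrite setIidl.
  rewrite lebesgue_measure_itv /= lte_fin; case: ltgtP ab => // -> _.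
  by rewrite subrr.
move=> u /=; rewrite !in_itv /= => /andP[au ub].
by rewrite (le_trans a0 au) (ltW (lt_le_trans ub b1)).
Qed.

(** The point 1 carries no mass. It is removed because it lies in none of the half-open intervals
    used for coding. *)
Lemma unoise_unit (A : set (measurableTypeR R)) : measurable A ->
  unoise A = unoise (A `&` [set u | 0 <= u < 1]).
Proof.
move=> mA; pose I := [set u : measurableTypeR R | (0 : R) <= u < 1].
have mI : measurable I.
  have -> : I = [set` `[0, 1[%R] :> set R.
    by apply/seteqP; split => u /=; rewrite in_itv.
  exact: measurable_itv.
have I1 : unoise I = 1%E by rewrite unoise_itv// subr0.
apply/eqP; rewrite eq_le; apply/andP; split; last first.
  by apply: le_measure; rewrite ?inE//; exact: measurableI.
have -> : unoise A = (unoise (A `&` I) + unoise (A `\` I))%E.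
  by rewrite addeC; exact: measureDI.
rewrite -[leRHS]adde0 leeD2l//.
have -> : 0%E = unoise (~` I) by rewrite probability_setC// I1 subee.
apply: le_measure; rewrite ?inE//; first exact: measurableD.
  exact: measurableC.
Qed.

End uniform_noise.

(** Digits are listed latest first, so that reading one more digit is a [cons] and the ancestors of
    a word are its suffixes. *)
Fixpoint revword (k : nat) (s : nat -> nat) : seq nat :=
  if k is k'.+1 then s k' :: revword k' s else [::].

Lemma size_revword k s : size (revword k s) = k.
Proof. by elim: k => //= k ->. Qed.

Lemma revword_take k l s : (k <= l)%N ->
  drop (l - k) (revword l s) = revword k s.
Proof.
elim: l => [|l IH]; first by rewrite leqn0 => /eqP ->.
rewrite leq_eqVlt => /predU1P[->|]; first by rewrite subnn drop0.
by rewrite ltnS => kl; rewrite subSn//= IH.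
Qed.

(* [lft] and [q] describe nested half-open intervals [lft w, lft w + q w),
   those indexed by n :: w partitioning the one indexed by w. *)
Section nested_intervals.
Context (R : realType) (q : seq nat -> R).

Fixpoint lft (w : seq nat) : R :=
  if w is n :: w' then lft w' + \sum_(i < n) q (nat_of_ord i :: w') else 0.

Lemma lftS n w : lft (n.+1 :: w) = lft (n :: w) + q (n :: w).
Proof. by rewrite /= big_ord_recr /= addrA. Qed.

(** The index of the child of [w] whose interval contains [u]. The value 0 is a default to the right
    of all children, a case excluded inside the interval of [w] once the lengths add up. *)
Definition digit (w : seq nat) (u : R) : nat :=
  match pselect (exists n, u < lft (n.+1 :: w)) with
  | left h => ex_minn h
  | right _ => 0%N
  end.

Fixpoint digits (k : nat) (u : R) : seq nat :=
  if k is k'.+1 then digit (digits k' u) u :: digits k' u else [::].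

Definition digit_seq (u : R) : nat -> nat := fun k => digit (digits k u) u.

Lemma revword_digit_seq k u : revword k (digit_seq u) = digits k u.
Proof. by elim: k => //= k ->. Qed.

Lemma digitE w u n :
  (digit w u = n <->
   (u < lft (n.+1 :: w) /\ forall m, (m < n)%N -> lft (m.+1 :: w) <= u) \/
   (n = 0%N /\ forall m, lft (m.+1 :: w) <= u)).
Proof.
rewrite /digit; case: pselect => [h|h].
  case: ex_minnP => m um mmin; split=> [<-|[[un nmin]|[_ nex]]].
  - left; split => // k km; rewrite leNgt; apply/negP => /mmin.
    by rewrite leqNgt km.
  - apply/eqP; rewrite eqn_leq mmin// leqNgt; apply/negP => /nmin.
    by rewrite leNgt um.
  - by have := nex m; rewrite leNgt um.
split=> [<-|[[un _]|[-> //]]].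
  by right; split => // m; rewrite leNgt; apply/negP => um; apply: h; exists m.
by exfalso; apply: h; exists n.
Qed.

Hypothesis q0 : forall w, 0 <= q w.
Hypothesis q1 : q [::] = 1.
Hypothesis qsum : forall w, (\sum_(0 <= n <oo) (q (n :: w))%:E = (q w)%:E)%E.

Lemma partial_sum_le w n : \sum_(i < n) q (nat_of_ord i :: w) <= q w.
Proof.
rewrite -lee_fin -qsum -sumEFin.
rewrite -(big_mkord xpredT (fun i => (q (i :: w))%:E)).
by apply: nneseries_lim_ge => k _; rewrite lee_fin.
Qed.

Lemma lft_mono w m n : (m <= n)%N -> lft (m :: w) <= lft (n :: w).
Proof.
move=> mn; elim: n mn => [|n IH]; first by rewrite leqn0 => /eqP ->.
rewrite leq_eqVlt => /predU1P[->//|]; rewrite ltnS => /IH.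
by move/le_trans; apply; rewrite lftS lerDl.
Qed.

Lemma lft_ge w n : lft w <= lft (n :: w).
Proof. by rewrite /= lerDl sumr_ge0. Qed.

Lemma lft_le w n : lft (n :: w) + q (n :: w) <= lft w + q w.
Proof. by rewrite -lftS /= lerD2l partial_sum_le. Qed.

Lemma lft_bounds w : 0 <= lft w /\ lft w + q w <= 1.
Proof.
elim: w => [|n w [IH1 IH2]]; first by rewrite /= q1 add0r.
by split; [apply: le_trans IH1 (lft_ge _ _)|apply: le_trans (lft_le _ _) IH2].
Qed.

(** If [u] were to the right of all children, the partial sums of their lengths would not exceed
    [u - lft w], and neither would [q w]. *)
Lemma digit_exists w u : u < lft w + q w -> exists n, u < lft (n.+1 :: w).
Proof.
move=> uw; apply/not_existsP => nex.
have : ((q w)%:E <= (u - lft w)%:E)%E.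
  rewrite -qsum; apply: lime_le; first by apply: is_cvg_nneseries => n _ _; rewrite lee_fin.
  apply: nearW => n; rewrite big_mkord sumEFin lee_fin lerBrDl.
  case: n => [|n].
    rewrite big_ord0 addr0; have := nex 0%N; move/negP; rewrite -leNgt.
    by apply: le_trans; exact: lft_ge.
  by have := nex n; move/negP; rewrite -leNgt.
by rewrite lee_fin lerBrDl leNgt uw.
Qed.

Lemma digitsP k u w : 0 <= u < 1 -> size w = k ->
  (digits k u = w <-> lft w <= u < lft w + q w).
Proof.
move=> u01; elim: k w => [|k IH] [|n w] //=; first by rewrite q1 add0r.
move=> [sw]; split=> [[dn dw]|].
  have /IH := sw; rewrite dw => -[/(_ erefl)/andP[lu ur] _].
  have [m um] := digit_exists ur.
  move: dn; rewrite dw => /digitE[[un nmin]|[n0 nex]].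
    rewrite -lftS un andbT; case: n {un} nmin => [_|n nmin].
      by rewrite /= big_ord0 addr0.
    exact: nmin.
  by have := nex m; rewrite leNgt um.
rewrite -[_ + \sum_(_ < _) _]/(lft (n :: w)) => /andP[lu ur].
have dw : digits k u = w.
  apply/IH => //; rewrite (le_trans (lft_ge _ _) lu)/=.
  exact: lt_le_trans ur (lft_le _ _).
rewrite dw; congr (_ :: _); apply/digitE; left; split; first by rewrite lftS.
by move=> m mn; apply: le_trans lu; exact: lft_mono.
Qed.

Lemma unoise_digits w :
  measurable ([set u | digits (size w) u = w] : set (measurableTypeR R)) ->
  unoise R [set u | digits (size w) u = w] = (q w)%:E.
Proof.
move=> mD; have [l0 l1] := lft_bounds w.
have qE : (q w)%:E = unoise R [set u | lft w <= u < lft w + q w].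
  by rewrite unoise_itv//; [rewrite addrAC subrr add0r|rewrite lerDl].
rewrite qE.
have mI : measurable ([set u | lft w <= u < lft w + q w] : set (measurableTypeR R)).
  have -> : [set u | lft w <= u < lft w + q w] = [set` `[lft w, lft w + q w[%R] :> set R.
    by apply/seteqP; split => u /=; rewrite in_itv.
  exact: measurable_itv.
rewrite [RHS]unoise_unit// unoise_unit//.
congr (unoise R _); apply/seteqP; split => u [] /= + u01.
  by move=> /digitsP-/(_ u01 erefl).
by move=> H; split => //; apply/digitsP.
Qed.

End nested_intervals.

(** * Sampling a random sequence of integers given a random variable *)

Section product_generators.
Context d d' (T : measurableType d) (E : measurableType d').

Definition rectangles (D : set (set E)) : set (set (T * E)) :=
  [set A `*` B | A in measurable & B in D].

Lemma rectangles_setI (D : set (set E)) :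
  setI_closed D -> setI_closed (rectangles D).
Proof.
move=> ID _ _ [A mA [B DB <-]] [A' mA' [B' DB' <-]].
exists (A `&` A'); first exact: measurableI.
by exists (B `&` B'); [exact: ID|rewrite setXI].
Qed.

Lemma rectangles_setT (D : set (set E)) : D setT -> rectangles D setT.
Proof. by move=> DT; exists setT => //; exists setT => //; rewrite setXTT. Qed.

Lemma measurable_rectangles (D : set (set E)) :
  measurable = <<s D >> -> D setT ->
  (measurable : set (set (T * E))) = <<s rectangles D >>.
Proof.
move=> mD DT; apply/seteqP; split; last first.
  apply: smallest_sub; first exact: sigma_algebra_measurable.
  move=> _ [A mA [B DB <-]]; apply: measurableX => //.
  by rewrite mD; exact: sub_sigma_algebra.
(* Both projections are measurable for the generated sigma-algebra, hence so is the identity map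
   into the product. *)
pose G := g_sigma_algebraType (rectangles D).
have m1 : measurable_fun setT (fst : G -> T).
  move=> _ A mA; rewrite setTI; apply: sub_sigma_algebra; exists A => //.
  by exists setT => //; apply/seteqP; split => [[a b] []|[a b]].
have m2 : measurable_fun setT (snd : G -> E).
  apply: (measurability D mD) => _ [B DB <-]; rewrite setTI.
  apply: sub_sigma_algebra; exists setT => //.
  by exists B => //; apply/seteqP; split => -[] //= a b [].
move=> S mS; have := measurable_preim (measurable_fun_pair m1 m2) mS.
rewrite (_ : _ @^-1` S = S)//.
by apply/seteqP; split => -[].
Qed.

End product_generators.

Section noisy_laws.
Context (R : realType).

Lemma noisy_law_ext dA dB dC d (A : measurableType dA) (B : measurableType dB)
    (C : measurableType dC) (T : measurableType d) (G : set (set T))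
    (mu : probability A R) (nu : probability B R) (la : probability C R)
    (f : A -> T) (g : B * C -> T) :
  measurable = <<s G >> -> setI_closed G -> G setT ->
  measurable_fun setT f -> measurable_fun setT g ->
  (forall S, G S ->
    mu (f @^-1` S) = (\int[nu]_b la [set c | S (g (b, c))])%E) ->
  forall F : T -> \bar R, measurable_fun setT F -> (forall t, 0 <= F t)%E ->
  (\int[mu]_a F (f a) = \int[nu]_b \int[la]_c F (g (b, c)))%E.
Proof.
move=> mG IG GT mf mg fg F mF F0.
rewrite (@law_integral _ _ _ _ A (B * C)%type T mu (nu \x la)%E f g)//.
  by rewrite fubini_tonelli1//; exact: measurableT_comp.
apply: (law_ext mG) => // S GS.
rewrite fg// /= /product_measure1; apply: eq_integral => b _ /=.
congr (la _); apply/seteqP; split => c; rewrite /xsection /= inE//.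
Qed.

End noisy_laws.

Lemma measurable_bigcup_countable d (T : measurableType d) (I : countType)
    (D : set I) (F : I -> set T) :
  (forall i, D i -> measurable (F i)) -> measurable (\bigcup_(i in D) F i).
Proof.
move=> mF; rewrite bigcup_mkcond; apply: countable_bigcupT_measurable => // i.
by case: ifPn => // /set_mem; exact: mF.
Qed.

Section sampler_seq.
Context (R : realType).

Lemma measurable_revword w :
  measurable [set s : seqspace nat | revword (size w) s = w].
Proof.
elim: w => [|n w IH] /=.
  by rewrite (_ : [set _ | _] = setT)//; apply/seteqP; split.
have -> : [set s : seqspace nat | s (size w) :: revword (size w) s = n :: w] =
  [set s : seqspace nat | revword (size w) s = w] `&`
  ((fun s : seqspace nat => s (size w)) @^-1` [set n]).
  by apply/seteqP; split => s /= [-> ->].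
by apply: measurableI => //; apply: measurable_preim => //; exact: measurable_coord.
Qed.

(** Two words are either comparable as suffixes or have disjoint cylinders, so adding the empty set
    yields a pi-system. *)
Definition word_cylinders : set (set (seqspace nat)) :=
  [set S | S = set0 \/ exists w, S = [set s | revword (size w) s = w]].

Lemma word_cylinders_setT : word_cylinders setT.
Proof. by right; exists [::]; apply/seteqP; split. Qed.

Lemma word_cylinders_setI : setI_closed word_cylinders.
Proof.
have aux w1 w2 : (size w1 <= size w2)%N -> word_cylinders
    ([set s | revword (size w1) s = w1] `&` [set s | revword (size w2) s = w2]).
  move=> w12; have [E|N] := eqVneq (drop (size w2 - size w1) w2) w1.
    right; exists w2; apply/seteqP; split => s /= => [[]//|E2].
    by split => //; rewrite -(revword_take _ w12) E2.
  left; apply/seteqP; split => s //= [E1 E2].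
  by move/eqP: N; apply; rewrite -{2}E1 -(revword_take _ w12) E2.
move=> A B [->|[w1 ->]] [->|[w2 ->]]; rewrite ?set0I ?setI0; try by left.
have [w12|/ltnW w21] := leqP (size w1) (size w2); first exact: aux.
by rewrite setIC; exact: aux.
Qed.

Lemma measurable_word_cylinders :
  (measurable : set (set (seqspace nat))) = <<s word_cylinders >>.
Proof.
apply/seteqP; split; last first.
  apply: smallest_sub; first exact: sigma_algebra_measurable.
  by move=> _ [->//|[w ->]]; exact: measurable_revword.
apply: smallest_sub; first exact: smallest_sigma_algebra.
move=> _ [k _ [A _ <-]]; rewrite setTI.
pose G := g_sigma_algebraType word_cylinders.
rewrite -[<<s _ >>]/(measurable : set (set G)).
have -> : (fun s : nat -> nat => s k) @^-1` A =
    \bigcup_(w in [set w | A (head 0%N w) /\ size w = k.+1])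
      [set s | revword (size w) s = w].
  apply/seteqP; split => [s As|s [w [Aw sw]]].
    by exists (revword k.+1 s); rewrite /= ?size_revword.
  by rewrite /= sw => E; move: Aw; rewrite -E.
apply: measurable_bigcup_countable => w _.
by apply: sub_sigma_algebra; right; exists w.
Qed.

Section construction.
Context dA d (A : measurableType dA) (T : measurableType d).
Context (mu : probability A R) (f : A -> T) (x : A -> seqspace nat).
Hypotheses (mf : measurable_fun setT f) (mx : measurable_fun setT x).

Let m1 := image_law mu mf.

Let cyl w := [set a | revword (size w) (x a) = w].

Let mcyl w : measurable (cyl w).
Proof. exact: (measurable_preim mx (measurable_revword w)). Qed.

Context (q : seq nat -> T -> R).
Hypothesis mq : forall w, measurable_fun setT (q w).
Hypothesis q01 : forall w t, 0 <= q w t <= 1.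
Hypothesis qE : forall w S, measurable S ->
  (mu (f @^-1` S `&` cyl w) = \int[m1]_(t in S) (q w t)%:E)%E.

Let mqE w : measurable_fun setT (fun t => (q w t)%:E).
Proof. exact/measurable_EFinP. Qed.

Let q_nil : {ae m1, forall t, q [::] t = 1}.
Proof.
have : ae_eq m1 setT (fun t => (q [::] t)%:E) (cst 1%E).
  apply: integral_ae_eq => //.
    apply/integrableP; split=> //; apply: (@le_lt_trans _ _ (\int[m1]_t 1)%E).
      apply: ge0_le_integral => //; first exact: measurableT_comp.
      by move=> t _; rewrite /= lee_fin ger0_norm; case/andP: (q01 [::] t).
    by rewrite integral_probability_cst ltry.
  move=> S _ mS; rewrite -qE// integral_cst// mul1e -[RHS]/(mu (f @^-1` S)).
  by congr (mu _); apply/seteqP; split => a //= [].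
by apply: filterS => t /(_ I) [].
Qed.

(** For each word the two sides have the same integrals over all measurable sets, hence agree almost
    everywhere; words being countable, one null set serves them all. *)
Let q_sum : {ae m1, forall t, forall w,
  (\sum_(0 <= n <oo) (q (n :: w) t)%:E = (q w t)%:E)%E}.
Proof.
have aux w : {ae m1, forall t,
    (\sum_(0 <= n <oo) (q (n :: w) t)%:E = (q w t)%:E)%E}.
  have : ae_eq m1 setT (fun t => (q w t)%:E)
      (fun t => \sum_(0 <= n <oo) (q (n :: w) t)%:E)%E.
    apply: integral_ae_eq => //.
    - apply/integrableP; split=> //; apply: (@le_lt_trans _ _ (\int[m1]_t 1)%E).
        apply: ge0_le_integral => //; first exact: measurableT_comp.
        by move=> t _; rewrite /= lee_fin ger0_norm; case/andP: (q01 w t).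
      by rewrite integral_probability_cst ltry.
    - apply: ge0_emeasurable_sum => // n t _ _; rewrite lee_fin.
      by case/andP: (q01 (n :: w) t).
    - move=> S _ mS; rewrite integral_nneseries//; last 2 first.
      + by move=> n; exact: measurable_funTS.
      + by move=> n t _; rewrite lee_fin; case/andP: (q01 (n :: w) t).
      rewrite -qE//; under eq_eseriesr do rewrite -qE//.
      rewrite -measure_semi_bigcup//.
      + congr (mu _); apply/seteqP; split => a.
          by move=> [Sa wa]; exists (x a (size w)) => //; split; rewrite // /cyl /= wa.
        by move=> [n _ [Sa /= [_ wa]]].
      + by move=> n; apply: measurableI => //; exact: measurable_preim.
      + apply/trivIsetP => n m _ _ nm; apply/seteqP; split => a //=.
        by move=> [[_ [an _]] [_ [am _]]]; move: nm; rewrite -an -am eqxx.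
      + apply: bigcup_measurable => n _.
        by apply: measurableI => //; exact: measurable_preim.
  by apply: filterS => t /(_ I).
have : {ae m1, forall t, forall k w, unpickle k = Some w ->
    (\sum_(0 <= n <oo) (q (n :: w) t)%:E = (q w t)%:E)%E}.
  apply: ae_foralln => k; case E : (unpickle k) => [w|]; last by apply: nearW => t w.
  by apply: filterS (aux w) => t ht _ [<-].
by apply: filterS => t ht w; apply: (ht (pickle w)); rewrite pickleK.
Qed.

(** For each [t] the unit interval is subdivided with lengths [q w t], and the noise picks an
    infinite branch. [Phi] remains defined on the null set of those [t] whose lengths do not add
    up. *)
Let Phi (tu : T * measurableTypeR R) : seqspace nat :=
  digit_seq (fun w => q w tu.1) tu.2.

Let mlft w : measurable_fun setT
  (fun tu : T * measurableTypeR R => lft (fun w => q w tu.1) w).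
Proof.
elim: w => [|n w IH] /=; first exact: measurable_cst.
apply: measurable_funD => //; apply: measurable_sum => i.
exact: (measurableT_comp (mq _) measurable_fst).
Qed.

Let mlt w : measurable [set tu : T * measurableTypeR R |
  (tu.2 : R) < lft (fun w => q w tu.1) w].
Proof.
have := @measurable_fun_ltr _ _ R _ _ _ (measurable_snd : measurable_fun setT
  (snd : T * measurableTypeR R -> R)) (mlft w).
move=> /(_ measurableT [set true]) /=; rewrite setTI; exact.
Qed.

Let mdigit w n : measurable [set tu : T * measurableTypeR R |
  digit (fun w => q w tu.1) w tu.2 = n].
Proof.
pose L m := [set tu : T * measurableTypeR R |
  (tu.2 : R) < lft (fun w => q w tu.1) (m.+1 :: w)].
have mL m : measurable (L m) by exact: mlt.
have -> : [set tu : T * measurableTypeR R |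
    digit (fun w => q w tu.1) w tu.2 = n] =
    (L n `&` \bigcap_(m in [set m | (m < n)%N]) ~` L m) `|`
    ((if n == 0%N then setT else set0) `&` \bigcap_m ~` L m).
  apply/seteqP; split => tu /=.
    move=> /digitE[[un nmin]|[-> nex]].
      by left; split => // m /= /nmin um; rewrite /L /= ltNge um.
    by right; rewrite eqxx; split => // m _; rewrite /L /= ltNge nex.
  move=> [[un nmin]|[+ nex]].
    apply/digitE; left; split => // m mn; rewrite leNgt; apply/negP.
    exact: nmin.
  case: eqP => // -> _; apply/digitE; right; split => // m.
  by rewrite leNgt; apply/negP; exact: nex.
apply: measurableU; apply: measurableI => //.
- by apply: bigcap_measurableType => m _; exact: measurableC.
- by case: ifP.
- by apply: bigcap_measurableType => m _; exact: measurableC.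
Qed.

Let mdigits w : measurable [set tu : T * measurableTypeR R |
  digits (fun w => q w tu.1) (size w) tu.2 = w].
Proof.
elim: w => [|n w IH] /=.
  by rewrite (_ : [set _ | _] = setT)//; apply/seteqP; split.
have -> : [set tu : T * measurableTypeR R |
   digit (fun w => q w tu.1) (digits (fun w => q w tu.1) (size w) tu.2) tu.2 ::
   digits (fun w => q w tu.1) (size w) tu.2 = n :: w] =
  [set tu : T * measurableTypeR R |
    digits (fun w => q w tu.1) (size w) tu.2 = w] `&`
  [set tu : T * measurableTypeR R | digit (fun w => q w tu.1) w tu.2 = n].
  by apply/seteqP; split => tu /= => [[dn dw]|[dw dn]]; rewrite dw; [rewrite dw in dn|rewrite dn].
exact: measurableI.
Qed.

Let mPhi : measurable_fun setT Phi.
Proof.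
apply: (@measurability _ _ _ (seqspace nat) setT Phi _ measurable_word_cylinders).
move=> _ [_ [->|[w ->]] <-]; rewrite setTI ?preimage_set0//.
have -> // : Phi @^-1` [set s | revword (size w) s = w] =
  [set tu : T * measurableTypeR R | digits (fun w => q w tu.1) (size w) tu.2 = w].
by apply/seteqP; split => tu /=; rewrite revword_digit_seq.
Qed.

Let xsectionPhi w t :
  xsection (Phi @^-1` [set s | revword (size w) s = w]) t =
  [set u | digits (fun w => q w t) (size w) u = w].
Proof.
by apply/seteqP; split => u; rewrite /xsection /= inE /= revword_digit_seq.
Qed.

Let mnoise w : measurable_fun setT
  (fun t => unoise R [set u | digits (fun w => q w t) (size w) u = w]).
Proof.
rewrite (_ : (fun t => _) =
  unoise R \o xsection (Phi @^-1` [set s | revword (size w) s = w])).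
  exact: (measurable_fun_xsection (unoise R)
    (measurable_preim mPhi (measurable_revword w))).
by apply/funext => t /=; rewrite xsectionPhi.
Qed.

Lemma sampler_construction :
  exists Phi : T * measurableTypeR R -> seqspace nat,
    measurable_fun setT Phi /\
    forall F : T * seqspace nat -> \bar R, measurable_fun setT F ->
      (forall z, 0 <= F z)%E ->
      (\int[mu]_a F (f a, x a) =
       \int[mu]_a \int[unoise R]_u F (f a, Phi (f a, u)))%E.
Proof.
exists Phi; split => // F mF F0.
apply: (@noisy_law_ext _ _ _ _ _ A A (measurableTypeR R) (T * seqspace nat)%type
  _ mu mu (unoise R) (fun a => (f a, x a)) (fun au => (f au.1, Phi (f au.1, au.2)))
  (measurable_rectangles T measurable_word_cylinders word_cylinders_setT)) => //.
- exact/rectangles_setI/word_cylinders_setI.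
- exact/rectangles_setT/word_cylinders_setT.
- exact: measurable_fun_pair.
- apply: measurable_fun_pair; first exact: measurableT_comp.
  apply: measurableT_comp => //; apply: measurable_fun_pair => //.
  exact: measurableT_comp.
move=> _ [S mS [_ [->|[w ->]] <-]].
  rewrite setX0 preimage_set0 measure0 integral0_eq// => a _.
  by rewrite (_ : [set _ | _] = set0) ?measure0//; apply/seteqP; split => u //= [].
have -> : (fun a => (f a, x a)) @^-1` (S `*` [set s | revword (size w) s = w]) =
  f @^-1` S `&` cyl w by apply/seteqP; split.
rewrite qE//.
(* Off a null set of [t] the lengths form genuine partitions, so the noise produces [w] with
   probability [q w t]. *)
transitivity (\int[m1]_(t in S)
   unoise R [set u | digits (fun w => q w t) (size w) u = w])%E.
  apply: ge0_ae_eq_integral => //.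
  - exact: measurable_funTS.
  - apply: measurable_funTS.
    exact: mnoise.
  - by move=> t _; rewrite lee_fin; case/andP: (q01 w t).
  - apply: filterS2 q_nil q_sum => t t1 t2 _.
    rewrite unoise_digits// => [w'|]; first by case/andP: (q01 w' t).
    rewrite -xsectionPhi; apply: measurable_xsection.
    exact: (measurable_preim mPhi (measurable_revword w)).
rewrite integral_image_law//.
rewrite integral_mkcond; apply: eq_integral => a _; rewrite patchE.
case: ifPn => [/set_mem Sa|nSa].
  congr (unoise R _); apply/seteqP; split => u /=; rewrite revword_digit_seq => //.
  by case.
rewrite (_ : [set _ | _] = set0) ?measure0//; apply/seteqP; split => u //= [Sa _].
by move/negP: nSa; apply; rewrite inE.
Qed.

End construction.

(** The densities [q w] of the countably many word cylinders play the part of a regular conditional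
    distribution of [x] given [f]. *)
Lemma sampler_seq dA d (A : measurableType dA) (T : measurableType d)
    (mu : probability A R) (f : A -> T) (x : A -> seqspace nat) :
  measurable_fun setT f -> measurable_fun setT x ->
  exists Phi : T * measurableTypeR R -> seqspace nat,
    measurable_fun setT Phi /\
    forall F : T * seqspace nat -> \bar R, measurable_fun setT F ->
      (forall z, 0 <= F z)%E ->
      (\int[mu]_a F (f a, x a) =
       \int[mu]_a \int[unoise R]_u F (f a, Phi (f a, u)))%E.
Proof.
move=> mf mx.
have /choice[q qP] : forall w, exists q : T -> R,
    [/\ measurable_fun setT q, (forall t, 0 <= q t <= 1) &
    forall S, measurable S -> (mu (f @^-1` S `&`
      [set a | revword (size w) (x a) = w]) =
      \int[image_law mu mf]_(t in S) (q t)%:E)%E].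
  move=> w; apply: conditional_density.
  exact: (measurable_preim mx (measurable_revword w)).
by apply: (@sampler_construction _ _ _ _ mu f x mf mx q) => w; have [] := qP w.
Qed.

End sampler_seq.

(* Standard Borel spaces enter only through this retraction onto sequences of
   integers, for which conditional laws can be sampled digit by digit. *)
Definition codable d (E : measurableType d) : Prop :=
  exists (s : E -> seqspace nat) (r : seqspace nat -> E),
    [/\ measurable_fun setT s, measurable_fun setT r & cancel s r].

(** * Coding of standard Borel spaces by sequences of integers *)

Section codable_spaces.

Lemma codable_seqspace d (E : measurableType d) :
  codable E -> codable (seqspace E).
Proof.
move=> [s [r [ms mr sK]]].
exists (fun e n => if unpickle n is Some (i, j) then s (e i) j else 0%N).
exists (fun c i => r (fun j => c (pickle (i, j)))); split.
- apply: measurable_seq => n; case: (unpickle n) => [[i j]|]; last exact: measurable_cst.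
  apply: (measurable_comp_coord j (f := fun e : seqspace E => s (e i))).
  by apply: measurableT_comp => //; exact: measurable_coord.
- apply: measurable_seq => i; apply: (measurableT_comp mr).
  by apply: measurable_seq => j; exact: measurable_coord.
- move=> e; apply/funext => i.
  under eq_fun do rewrite pickleK.
  exact: sK.
Qed.

Lemma codable_prod d1 d2 (E1 : measurableType d1) (E2 : measurableType d2) :
  codable E1 -> codable E2 -> codable (E1 * E2)%type.
Proof.
move=> [s1 [r1 [ms1 mr1 s1K]]] [s2 [r2 [ms2 mr2 s2K]]].
exists (fun e n => if odd n then s2 e.2 n./2 else s1 e.1 n./2).
exists (fun c => (r1 (fun j => c j.*2), r2 (fun j => c j.*2.+1))); split.
- apply: measurable_seq => n; case: (odd n).
    apply: (measurable_comp_coord _ (f := fun e : E1 * E2 => s2 e.2)).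
    exact: measurableT_comp.
  apply: (measurable_comp_coord _ (f := fun e : E1 * E2 => s1 e.1)).
  exact: measurableT_comp.
- apply: measurable_fun_pair; [apply: (measurableT_comp mr1)|apply: (measurableT_comp mr2)];
    by apply: measurable_seq => j; exact: measurable_coord.
- move=> [a b] /=; congr (_, _).
    by under eq_fun do rewrite odd_double doubleK; exact: s1K.
  by under eq_fun do rewrite /= odd_double /= uphalf_double; exact: s2K.
Qed.

Section polish_codable.
Context (R : realType) (Y : metricType R) (D : nat -> Y).
Hypothesis Ydense : dense (range D).
Hypothesis Ycomplete : forall F : set_system Y,
  ProperFilter F -> cauchy F -> exists y : Y, F --> y.

Let e (n : nat) : R := 2^-1 ^+ n.

Let e0 n : 0 < e n. Proof. by rewrite exprn_gt0. Qed.

Let eS n : e n = 2 * e n.+1.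
Proof. by rewrite /e exprS mulrA divff ?mul1r. Qed.

Let open_mball (y : Y) eps : open (ball y eps).
Proof.
rewrite openE => z; rewrite ballEmdist /= => yz.
apply/nbhs_ballP; exists (eps - mdist y z); first by rewrite /= subr_gt0.
move=> w; rewrite !ballEmdist /= => zw.
by apply: le_lt_trans (metric_triangle _ z _) _; rewrite -ltrBrDl.
Qed.

Let approx_ex (y : Y) n : exists m, mdist (D m) y < e n.
Proof.
have [|z [Bz [m _ mz]]] := @Ydense _ _ (open_mball y (e n)).
  by exists y; rewrite ballEmdist /= mdistxx e0.
by exists m; rewrite mz metric_sym; move: Bz; rewrite ballEmdist.
Qed.

(** Codes of actual points have this property, as [e n + e n.+1 < 2 * e n]. It involves two digits
    at a time, so it is a measurable condition, and it forces convergence. *)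
Let fast (c : nat -> nat) : Prop :=
  forall n, mdist (D (c n)) (D (c n.+1)) < 2 * e n.

(** The bound telescopes: [2 * e k = 4 * e k - 4 * e k.+1]. *)
Let fast_tail c n k : fast c -> mdist (D (c n)) (D (c (n + k)%N)) <= 4 * e n - 4 * e (n + k).
Proof.
move=> fc; elim: k => [|k IH]; first by rewrite addn0 mdistxx subrr.
rewrite addnS; apply: le_trans (metric_triangle _ (D (c (n + k)%N)) _) _.
apply: le_trans (lerD IH (ltW (fc _))) _.
by rewrite (eS (n + k)); lra.
Qed.

Let e_small (eps : R) : 0 < eps -> exists N, forall n, (N <= n)%N -> e n < eps.
Proof.
move=> eps0.
have h : (`|2^-1 : R| < 1) by rewrite ger0_norm ?invr_ge0// invf_lt1 ?ltr1n.
have /cvgrPdist_lt/(_ _ eps0)[N _ Nh] := cvg_expr h.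
exists N => n Nn; have := Nh n Nn.
by rewrite /= sub0r normrN ger0_norm// ltW.
Qed.

Let fast_limit c : fast c -> exists y, forall n, mdist y (D (c n)) <= 4 * e n.
Proof.
move=> fc; pose F := (D \o c) @ \oo.
have cF : cauchy F.
  apply: cauchy_exP => eps eps0.
  have [N Nh] := @e_small (eps / 4) (divr_gt0 eps0 (ltr0Sn _ 3)).
  exists (D (c N)); rewrite ballEmdist; exists N => // n /= Nn.
  rewrite -(subnKC Nn); apply: le_lt_trans (fast_tail _ _ fc) _.
  have := Nh N (leqnn N); have := e0 (N + (n - N)); lra.
have [y Fy] := Ycomplete _ cF.
exists y => n; apply/ler_addgt0Pl => eps eps0.
have /metricType_numDomainType.cvgr_dist_lt/(_ _ eps0)[N _ Nh] := Fy.
apply: le_trans (metric_triangle _ (D (c (n + N)%N)) _) _.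
apply: lerD; first exact/ltW/(Nh (n + N)%N)/leq_addl.
rewrite metric_sym; apply: le_trans (fast_tail n N fc) _.
by rewrite lerBlDr lerDl mulr_ge0// ltW.
Qed.

(** A point is coded, for each [n], by the first dense point within [e n] of it; decoding takes the
    limit of these approximants. *)
Lemma polish_codable d (X : measurableType d) (phi : X -> Y) (x0 : X) :
  bijective phi ->
  (forall A : set X, measurable A <-> borel (phi @` A)) -> codable X.
Proof.
move=> [psi phiK psiK] bphi.
have mphi (B : set Y) : borel B -> measurable (phi @^-1` B).
  move=> bB; apply/bphi; rewrite image_preimage//.
  by apply/seteqP; split => // y _; exists (psi y).
pose B m n := [set x | mdist (D m) (phi x) < e n].
have mB m n : measurable (B m n).
  have -> : B m n = phi @^-1` (ball (D m) (e n)) by rewrite ballEmdist.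
  apply: mphi; apply: sub_sigma_algebra; exact: open_mball.
pose s x n : nat := ex_minn (approx_ex (phi x) n).
have sP x n m : s x n = m <-> (B m n x /\ forall k, (k < m)%N -> ~ B k n x).
  rewrite /s; case: ex_minnP => p pB pmin; split=> [<-|[mBx mmin]].
    by split => // k kp /pmin; rewrite leqNgt kp.
  apply/eqP; rewrite eqn_leq pmin// leqNgt; apply/negP => /mmin; exact.
have /choice[lim limP] : forall c, exists y, fast c -> forall n, mdist y (D (c n)) <= 4 * e n.
  move=> c; have [/fast_limit[y yc]|nf] := pselect (fast c); first by exists y.
  by exists (D 0%N).
(* [x0] is a default on the sequences that are not [fast], which code no point. *)
pose r c := if pselect (fast c) is left _ then psi (lim c) else x0.
exists s, r; split.
- apply: measurable_seq => n; move=> _ A _; rewrite setTI.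
  have -> : (fun x => s x n) @^-1` A =
      \bigcup_(m in A) (B m n `&` \bigcap_(k in [set k | (k < m)%N]) ~` B k n).
    apply/seteqP; split => x /=.
      move=> As; exists (s x n) => //; have /sP[sB smin] := erefl (s x n).
      by split => // k /= /smin.
    by move=> [m Am [mBx mmin]]; rewrite (_ : s x n = m)//; apply/sP; split.
  apply: measurable_bigcup_countable => m _; apply: measurableI => //.
  by apply: bigcap_measurableType => k _; exact: measurableC.
- have mfast : measurable (fast : set (seqspace nat)).
    have -> : fast = \bigcap_n \bigcup_(ij in
        [set ij : nat * nat | mdist (D ij.1) (D ij.2) < 2 * e n])
        ([set c : nat -> nat | c n = ij.1] `&` [set c | c n.+1 = ij.2]).
      apply/seteqP; split => c fc.
        by move=> n _; exists (c n, c n.+1) => //; exact: fc.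
      by move=> n; have [ij ijn [/= -> ->]] := fc n I.
    apply: bigcapT_measurable => n; apply: measurable_bigcup_countable => ij _.
    apply: measurableI.
      exact: (measurable_preim (measurable_coord n) (_ : measurable [set ij.1])).
    exact: (measurable_preim (measurable_coord n.+1) (_ : measurable [set ij.2])).
  have mlim U : borel U -> measurable (fast `&` lim @^-1` U : set (seqspace nat)).
    pose G := [set U : set Y | measurable (fast `&` lim @^-1` U : set (seqspace nat))].
    suff : @borel Y `<=` G by exact.
    apply: smallest_sub.
      split.
      + by rewrite /G /= preimage_set0 setI0; exact: measurable0.
      + move=> V GV; rewrite /G /=.
        have -> : fast `&` lim @^-1` (setT `\` V) = fast `\` (fast `&` lim @^-1` V).
          apply/seteqP; split => c /= [fc]; first by move=> [_ nV]; split => // -[].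
          by move=> h; split => //; split => // Vc; apply: h.
        exact: measurableD.
      + move=> V GV; rewrite /G /= preimage_bigcup setI_bigcupr.
        by apply: bigcupT_measurable => n; exact: GV.
    move=> {}U oU; rewrite /G /=.
    (* The radius [8 * e n] exceeds the error [4 * e n] between [lim c] and [D (c n)], so such a
       ball contains the limit. Conversely it lies within [12 * e n] of the limit, which is below
       [eps] once [e n < eps / 16]. *)
    have -> : fast `&` lim @^-1` U = fast `&` \bigcup_n \bigcup_(m in
        [set m | ball (D m) (8 * e n) `<=` U]) [set c | c n = m].
      apply/seteqP; split => c /= [fc].
        move=> Uc; split => //.
        have : nbhs (lim c) U by exact: open_nbhs_nbhs (conj oU Uc).
        move=> /nbhs_ballP[eps /= eps0 sU].
        have [N /(_ _ (leqnn N)) Nh] := @e_small (eps / 16) (divr_gt0 eps0 (ltr0Sn _ 15)).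
        exists N => //; exists (c N) => //= y; rewrite ballEmdist /= => yc.
        apply: sU; rewrite ballEmdist /=.
        apply: le_lt_trans (metric_triangle _ (D (c N)) _) _.
        have := limP c fc N; lra.
      move=> [n _ [m mU /= cm]]; split => //; apply: mU.
      rewrite ballEmdist /= -cm metric_sym.
      by apply: le_lt_trans (limP c fc n) _; have := e0 n; lra.
    apply: measurableI => //; apply: bigcupT_measurable => n.
    apply: measurable_bigcup_countable => m _.
    exact: (measurable_preim (measurable_coord n) (_ : measurable [set m])).
  move=> _ A mA; rewrite setTI.
  have -> : r @^-1` A = (fast `&` lim @^-1` (phi @` A)) `|`
      (~` fast `&` (if pselect (A x0) then setT else set0)).
    apply/seteqP; split => c; rewrite /r /=; case: (pselect (fast c)) => fc.
    + by move=> Ac; left; split => //; exists (psi (lim c)).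
    + by move=> Ac; right; split => //; case: (pselect (A x0)).
    + by move=> [[_ [x Ax <-]]|[]//]; rewrite phiK.
    + by move=> [[]//|[_]]; case: (pselect (A x0)).
  apply: measurableU; first by apply: mlim; exact/bphi.
  apply: measurableI; first exact: measurableC.
  by case: (pselect (A x0)) => ?; [exact: measurableT|exact: measurable0].
- move=> x; have sB n : mdist (D (s x n)) (phi x) < e n.
    by have /sP[] := erefl (s x n).
  have fs : fast (s x).
    move=> n; apply: le_lt_trans (metric_triangle _ (phi x) _) _.
    rewrite (metric_sym (phi x)).
    have := sB n; have := sB n.+1; rewrite (eS n); have := e0 n.+1; lra.
  rewrite /r; case: pselect => // _.
  apply: (canLR phiK); apply/esym/mdist_positivity/eqP.
  rewrite eq_le mdist_ge0 andbT; apply/ler_addgt0Pl => eps eps0; rewrite addr0.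
  (* The errors [e N] of the code and [4 * e N] of the limit add up to [5 * e N]. *)
  have [N /(_ _ (leqnn N)) Nh] := @e_small (eps / 5) (divr_gt0 eps0 (ltr0Sn _ 4)).
  apply: le_trans (metric_triangle _ (D (s x N)) _) _.
  rewrite (metric_sym (phi x)).
  have := sB N; have := limP _ fs N; rewrite (metric_sym (lim _)).
  lra.
Qed.

End polish_codable.

(** The noise space has to be codable too, since noise will be split by sampling a pair of
    noises. *)
Lemma unoise_standard_borel (R : realType) : standard_borel R (measurableTypeR R).
Proof.
exists R^o, id; split.
- split.
    move=> F FF cF; exists (lim F); exact: (@R_complete R F FF cF).
  exists (range (@ratr R)); last exact: dense_rat.
  apply: (card_le_trans (card_image_le _ _)).
  exact: countableP.
- by exists id.
- move=> A; rewrite image_id.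
  suff -> : (measurable : set (set (measurableTypeR R))) = @borel R^o by [].
  rewrite RGenOpens.measurableE; apply/seteqP; split.
    apply: smallest_sub; first exact: smallest_sigma_algebra.
    by move=> _ [x [y ->]]; apply: sub_sigma_algebra; exact: interval_open.
  apply: smallest_sub; first exact: smallest_sigma_algebra.
  by move=> A' oA'; rewrite -RGenOpens.measurableE; exact: open_measurable.
Qed.

Lemma standard_borel_codable (R : realType) d (X : measurableType d) (x0 : X) :
  standard_borel R X -> codable X.
Proof.
move=> [Y [phi [[Yc [D cD dD]] bphi mphi]]].
have D0 : D !=set0.
  by have [|y []] := @dD setT _ openT; [exists (phi x0)|exists y].
have [f fD] : exists f : nat -> Y, range f = D.
  have /pfcard_geP[D0'|[f]] := cD; first by case: D0 => y; rewrite D0'.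
  by exists f; apply/seteqP; split => [_ [n _ <-]|y Dy]; [exact: funS|exact: surj].
by apply: (@polish_codable R Y f _ Yc d X phi x0) => //; rewrite fD.
Qed.

Lemma codable_unoise (R : realType) : codable (measurableTypeR R).
Proof. exact: (standard_borel_codable (0 : R) (unoise_standard_borel R)). Qed.

End codable_spaces.

(** * Sampling conditional laws from uniform noise *)

Section samplers.
Context (R : realType).

Lemma sampler dA d dE (A : measurableType dA) (T : measurableType d)
    (E : measurableType dE) (mu : probability A R) (f : A -> T) (x : A -> E) :
  codable E -> measurable_fun setT f -> measurable_fun setT x ->
  exists Phi : T * measurableTypeR R -> E,
    measurable_fun setT Phi /\
    forall F : T * E -> \bar R, measurable_fun setT F ->
      (forall z, 0 <= F z)%E ->
      (\int[mu]_a F (f a, x a) =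
       \int[mu]_a \int[unoise R]_u F (f a, Phi (f a, u)))%E.
Proof.
move=> [s [r [ms mr sK]]] mf mx.
have [Phi [mPhi PhiE]] := sampler_seq mu mf (measurableT_comp ms mx).
exists (r \o Phi); split; first exact: measurableT_comp.
move=> F mF F0; pose F' (z : T * seqspace nat) := F (z.1, r z.2).
rewrite -(PhiE F')//.
  by apply: eq_integral => a _; rewrite /F' /= sK.
  apply: (measurableT_comp mF); apply: measurable_fun_pair => //.
  exact: measurableT_comp.
by move=> z; exact: F0.
Qed.

(** A sampler for the product law of two uniform variables, given the trivial variable [tt], is a
    map of the kind sought. *)
Lemma noise_splitting :
  exists tau : measurableTypeR R -> measurableTypeR R * measurableTypeR R,
    measurable_fun setT tau /\
    forall F : measurableTypeR R * measurableTypeR R -> \bar R,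
      measurable_fun setT F -> (forall z, 0 <= F z)%E ->
      (\int[unoise R]_u F (tau u) =
       \int[unoise R]_a \int[unoise R]_b F (a, b))%E.
Proof.
have [Phi [mPhi PhiE]] := sampler (unoise R \x unoise R)%E
  (codable_prod (codable_unoise R) (codable_unoise R))
  (measurable_cst tt) (@measurable_id _ _ setT).
exists (fun u => Phi (tt, u)); split.
  by apply: (measurableT_comp mPhi); apply: measurable_fun_pair.
move=> F mF F0; pose F' (z : unit * (measurableTypeR R * measurableTypeR R)) := F z.2.
have := PhiE F'; rewrite /F' /= integral_probability_cst => <- //; last first.
  exact: (measurableT_comp mF).
by rewrite fubini_tonelli1.
Qed.

End samplers.

Section sigma_algebra_generated_by_a_sequence.

(** This turns events generated by a family of coordinates into preimages under one map into the
    sequence space; events of the past become measurable sets of histories. *)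
Lemma sigma_gen_preimage d (X : measurableType d) (O : pointedType) (I : Type)
    (K : set I) (Z : I -> O -> X) (h : O -> nat -> X) (i : nat -> I) :
  (forall k, K (i k)) -> (forall w k, h w k = Z (i k) w) ->
  (forall j, K j -> exists k, j = i k) ->
  forall A, sigma_gen K Z A <->
    exists2 B : set (seqspace X), measurable B & A = h @^-1` B.
Proof.
move=> Ki hE Kex A; split.
  move: A; apply: smallest_sub.
    pose G : set (set O) := [set A | exists2 B : set (seqspace X), measurable B & A = h @^-1` B].
    split => //.
    - by exists set0 => //; rewrite preimage_set0.
    - by move=> _ [B mB ->]; exists (~` B); [exact: measurableC|rewrite setTD].
    - move=> F HF.
      have /choice[B HB] : forall n, exists B : set (seqspace X),
          measurable B /\ F n = h @^-1` B.
        by move=> n; have [B ? ?] := HF n; exists B.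
      exists (\bigcup_k B k); first by apply: bigcupT_measurable => k; case: (HB k).
      by rewrite preimage_bigcup; apply: eq_bigcupr => k _; case: (HB k).
  move=> _ [j Kj [C mC <-]]; have [k jk] := Kex _ Kj.
  exists ((fun s : seqspace X => s k) @^-1` C).
    by apply: measurable_preim => //; exact: measurable_coord.
  by rewrite setTI; apply/seteqP; split => w /=; rewrite hE jk.
move=> [B mB ->].
have := @measurable_seq _ X _ (g_sigma_algebraType
  (\bigcup_(k in K) preimage_set_system setT (Z k) measurable)) h.
move=> /(_ _)/measurable_preim; apply => // k _ C mC; rewrite setTI.
apply: sub_sigma_algebra; exists (i k) => //; exists C => //.
by rewrite setTI; apply/seteqP; split => w /=; rewrite hE.
Qed.

End sigma_algebra_generated_by_a_sequence.

Section kernel_integrals.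
Context (R : realType) d (X : measurableType d) (P : R.-pker X ~> X).

Lemma integral_kernel_cst x (c : \bar R) : (\int[P x]_y c = c)%E.
Proof. by rewrite integral_cst// prob_kernel mule1. Qed.

Context (f : X -> R).
Hypotheses (mf : measurable_fun setT f) (f01 : forall x, 0 <= f x <= 1).

Lemma kerfE x : ((kerf P f x)%:E = \int[P x]_y (f y)%:E)%E.
Proof.
rewrite /kerf /Rintegral fineK// ge0_fin_numE; last first.
  by apply: integral_ge0 => y _; rewrite lee_fin; case/andP: (f01 y).
apply: (@le_lt_trans _ _ (\int[P x]_y 1)%E); last by rewrite integral_kernel_cst ltry.
apply: ge0_le_integral => //.
- by move=> y _; rewrite lee_fin; case/andP: (f01 y).
- exact/measurable_EFinP.
- by move=> y _; rewrite lee_fin; case/andP: (f01 y).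
Qed.

Lemma measurable_kerf : measurable_fun setT (kerf P f).
Proof.
apply/measurable_EFinP; rewrite (_ : EFin \o _ = (fun x => \int[P x]_y (f y)%:E)%E).
  apply: measurable_fun_integral_kernel.
  - by move=> U mU; exact: measurable_kernel.
  - by move=> y; rewrite lee_fin; case/andP: (f01 y).
  - exact/measurable_EFinP.
by apply/funext => x /=; exact: kerfE.
Qed.

Lemma kerf_bounds x : 0 <= kerf P f x <= 1.
Proof.
rewrite -!lee_fin kerfE integral_ge0/=; last first.
  by move=> y _; rewrite lee_fin; case/andP: (f01 y).
rewrite -[leRHS](integral_kernel_cst x); apply: ge0_le_integral => //.
- by move=> y _; rewrite lee_fin; case/andP: (f01 y).
- exact/measurable_EFinP.
- by move=> y _; rewrite lee_fin; case/andP: (f01 y).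
Qed.

End kernel_integrals.

(** * Past and future of the chain *)

Section markov_chain.
Context (R : realType) d (X : measurableType d) (P : R.-pker X ~> X)
  (pi : probability X R) dO (O : measurableType dO) (Pr : probability O R)
  (Z : int -> O -> X).
Hypothesis chain : stationary_markov_chain Pr P pi Z.

(** Histories are read backwards, so that the present sits at index 0 and passing from [t] to
    [t + 1] shifts the sequence by one place. *)
Definition hist (t : int) (w : O) : seqspace X := fun k => Z (t - k%:Z) w.
Definition path (t : int) (w : O) : seqspace X := fun k => Z (t + k%:Z) w.

Lemma measurable_chain t : measurable_fun setT (Z t).
Proof. by case: chain. Qed.

Lemma measurable_hist t : measurable_fun setT (hist t).
Proof. by apply: measurable_seq => k; exact: measurable_chain. Qed.

Lemma measurable_path t : measurable_fun setT (path t).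
Proof. by apply: measurable_seq => k; exact: measurable_chain. Qed.

Lemma hist0 t w : hist t w 0%N = Z t w.
Proof. by rewrite /hist subr0. Qed.

Lemma path0 t w : path t w 0%N = Z t w.
Proof. by rewrite /path addr0. Qed.

Lemma pastP t A : sigma_gen [set j : int | j <= t] Z A <->
  exists2 B : set (seqspace X), measurable B & A = hist t @^-1` B.
Proof.
apply: (sigma_gen_preimage (i := fun k : nat => t - k%:Z)) => //.
  by move=> k /=; lia.
by move=> j /= jt; exists `|t - j|%N; lia.
Qed.

Lemma markov_step t (B : set (seqspace X)) (f : X -> R) : measurable B -> measurable_fun setT f ->
  (forall x, 0 <= f x <= 1) ->
  (\int[Pr]_(w in hist t @^-1` B) (f (Z (t + 1) w))%:E =
   \int[Pr]_(w in hist t @^-1` B) (kerf P f (Z t w))%:E)%E.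
Proof.
move=> mB mf f01; case: chain => _ _ /(_ t f)[].
  by split => //; exists 1 => x; rewrite ger0_norm; case/andP: (f01 x).
by move=> _ _ _ ->//; apply/pastP; exists B.
Qed.

Lemma integral_chain t (S : set X) (F : X -> \bar R) :
  measurable S -> measurable_fun setT F -> (forall x, 0 <= F x)%E ->
  (\int[Pr]_(w in Z t @^-1` S) F (Z t w) = \int[pi]_(x in S) F x)%E.
Proof.
move=> mS mF F0; rewrite -(integral_image_law _ (measurable_chain t))//.
by apply: eq_measure_integral => A mA _; case: chain => _ + _; exact.
Qed.

Lemma chain_ae t (Q : X -> Prop) :
  {ae pi, forall x, Q x} -> {ae Pr, forall w, Q (Z t w)}.
Proof.
move=> [N [mN N0 sN]]; exists (Z t @^-1` N); split.
- exact: (measurable_preim (measurable_chain t)).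
- by case: chain => _ -> // _.
- by move=> w /= nQ; exact: sN.
Qed.

End markov_chain.

(** * The law of the future given the past *)

Section box_cylinders.
Context d (X : measurableType d).

(** Sides beyond the list are [setT]: a box constrains finitely many coordinates, and lists of
    different lengths can be intersected. *)
Definition box (Bs : seq (set X)) : set (nat -> X) :=
  [set s | forall i, nth setT Bs i (s i)].

Definition measurable_sides (Bs : seq (set X)) : Prop :=
  forall i, measurable (nth setT Bs i).

Definition boxes : set (set (seqspace X)) :=
  [set C | exists2 Bs, measurable_sides Bs & C = box Bs].

Lemma box_nil : box [::] = setT.
Proof. by apply/seteqP; split => s // _ i; rewrite nth_nil. Qed.

Lemma box_cons B Bs :
  box (B :: Bs) = [set s | B (s 0%N) /\ box Bs (fun k => s k.+1)].
Proof.
apply/seteqP; split => s /=.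
  by move=> H; split; [exact: (H 0%N)|move=> i; exact: (H i.+1)].
by move=> [B0 Bi] [|i] //=; exact: Bi.
Qed.

Lemma measurable_sides_cons B Bs :
  measurable_sides (B :: Bs) -> measurable B /\ measurable_sides Bs.
Proof. by move=> H; split; [exact: (H 0%N)|move=> i; exact: (H i.+1)]. Qed.

Lemma boxes_setT : boxes setT.
Proof. by exists [::]; [move=> i; rewrite nth_nil|rewrite box_nil]. Qed.

Lemma boxes_setI : setI_closed boxes.
Proof.
move=> _ _ [B1 m1 ->] [B2 m2 ->].
pose n := maxn (size B1) (size B2).
pose B := mkseq (fun i => nth setT B1 i `&` nth setT B2 i) n.
have BE i : nth setT B i = nth setT B1 i `&` nth setT B2 i.
  have [iN|Ni] := ltnP i n; first by rewrite nth_mkseq.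
  rewrite !nth_default ?setIT// ?size_mkseq//.
  - by apply: leq_trans Ni; rewrite leq_maxr.
  - by apply: leq_trans Ni; rewrite leq_maxl.
exists B; first by move=> i; rewrite BE; exact: measurableI.
apply/seteqP; split => s /=.
  by move=> [s1 s2] i; rewrite BE; split; [exact: s1|exact: s2].
by move=> H; split => i; have := H i; rewrite BE => -[].
Qed.

Lemma measurable_box Bs : measurable_sides Bs ->
  measurable (box Bs : set (seqspace X)).
Proof.
move=> mB; have -> : box Bs = \bigcap_i ((fun s => s i) @^-1` nth setT Bs i).
  by apply/seteqP; split => s H i; [move=> _|]; exact: H.
apply: bigcapT_measurable => i.
by apply: (measurable_preim (measurable_coord i)).
Qed.

Lemma measurable_boxes :
  (measurable : set (set (seqspace X))) = <<s boxes >>.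
Proof.
apply/seteqP; split; last first.
  apply: smallest_sub; first exact: sigma_algebra_measurable.
  by move=> _ [Bs mB ->]; exact: measurable_box.
apply: smallest_sub; first exact: smallest_sigma_algebra.
move=> _ [k _ [A mA <-]]; rewrite setTI; apply: sub_sigma_algebra.
pose B := mkseq (fun i => if i == k then A else setT) k.+1.
have BE i : nth setT B i = if i == k then A else setT.
  have [iN|Ni] := ltnP i k.+1; first by rewrite nth_mkseq.
  by rewrite nth_default ?size_mkseq//; case: eqP Ni => // ->; rewrite ltnn.
exists B; first by move=> i; rewrite BE; case: ifP.
apply/seteqP; split => s /=; last by move=> /(_ k); rewrite BE eqxx.
by move=> As i; rewrite BE; case: eqP => // ->.
Qed.

End box_cylinders.

Section noisy_events.
Context (R : realType).

Lemma noisy_law_set dA dB dC d (A : measurableType dA) (B : measurableType dB)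
    (C : measurableType dC) (T : measurableType d)
    (mu : probability A R) (nu : probability B R) (la : probability C R)
    (f : A -> T) (g : B * C -> T) (S : set T) :
  measurable_fun setT f -> measurable_fun setT g -> measurable S ->
  (forall F : T -> \bar R, measurable_fun setT F -> (forall t, 0 <= F t)%E ->
    (\int[mu]_a F (f a) = \int[nu]_b \int[la]_c F (g (b, c)))%E) ->
  (mu (f @^-1` S) = \int[nu]_b la [set c | S (g (b, c))])%E.
Proof.
move=> mf mg mS H.
have m1 : measurable_fun setT (EFin \o (\1_S : T -> R)).
  exact/measurable_EFinP/measurable_indic.
have p1 t : (0 <= (EFin \o (\1_S : T -> R)) t)%E by rewrite /= lee_fin.
have <- : (\int[mu]_a (EFin \o \1_S) (f a) = mu (f @^-1` S))%E.
  rewrite -[X in _ = mu X]setIT -integral_indic//.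
  exact: measurable_preim.
rewrite (H _ m1 p1); apply: eq_integral => b _.
have mSb : measurable [set c | S (g (b, c))].
  have := measurable_xsection b (measurable_preim mg mS).
  by rewrite (_ : xsection _ _ = [set c | S (g (b, c))])//;
    apply/seteqP; split => c; rewrite /xsection /= inE.
by rewrite -[X in _ = la X]setIT -integral_indic.
Qed.

Lemma integral_noise_patch dB dC (B : measurableType dB) (C : measurableType dC)
    (nu : measure B R) (la : measure C R) (D : set B) (Q : B -> set C) :
  (\int[nu]_(b in D) la (Q b) = \int[nu]_b la [set c | D b /\ Q b c])%E.
Proof.
rewrite integral_mkcond; apply: eq_integral => b _; rewrite patchE.
case: ifPn => [/set_mem Db|nDb].
  by congr (la _); apply/seteqP; split => c //= [].
rewrite (_ : [set _ | _] = set0) ?measure0//; apply/seteqP; split => c //= [Db _].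
by move/negP: nDb; apply; rewrite inE.
Qed.

End noisy_events.

Section path_law.
Context (R : realType) d (X : measurableType d) (P : R.-pker X ~> X).

(** The probability that the chain started at [x] runs through the box, computed backwards in
    time. *)
Fixpoint box_prob (Bs : seq (set X)) (x : X) : R :=
  if Bs is B :: Bs' then \1_B x * kerf P (box_prob Bs') x else 1.

Lemma box_prob_ok Bs : measurable_sides Bs ->
  measurable_fun setT (box_prob Bs) /\ forall x, 0 <= box_prob Bs x <= 1.
Proof.
elim: Bs => [|B Bs IH] /=; first by split=> //; move=> x; rewrite ler01 lexx.
move=> /measurable_sides_cons[mB /IH[mq q01]]; split.
  apply: measurable_funM; [exact: measurable_indic|exact: measurable_kerf].
move=> x; have /andP[k0 k1] := kerf_bounds P mq q01 x.
by rewrite indicE; case: (x \in B); rewrite ?mul1r ?mul0r ?k0 ?k1 ?lexx ?ler01.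
Qed.

Context (pi : probability X R) dO (O : measurableType dO) (Pr : probability O R)
  (Z : int -> O -> X).
Hypothesis chain : stationary_markov_chain Pr P pi Z.

Let mZ := measurable_chain chain.
Let mhist := measurable_hist chain.
Let mpath := measurable_path chain.

(** Induction on the box: the constraint on the present joins the event of the past, and the time
    origin moves by one. *)
Lemma hist_box_law Bs t (A : set (seqspace X)) :
  measurable_sides Bs -> measurable A ->
  (Pr (hist Z t @^-1` A `&` path Z t @^-1` box Bs) =
   \int[Pr]_(w in hist Z t @^-1` A) (box_prob Bs (Z t w))%:E)%E.
Proof.
elim: Bs t A => [|B Bs IH] t A.
  move=> _ mA; rewrite box_nil preimage_setT setIT /= integral_cst ?mul1e//.
  exact: measurable_preim.
move=> /measurable_sides_cons[mB mBs] mA.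
pose A1 : set (seqspace X) := A `&` (fun s => s 0%N) @^-1` B.
have mA1 : measurable A1.
  by apply: measurableI => //; apply: (measurable_preim (measurable_coord 0)).
(* The event [A1] of the history at [t], read off the history at [t + 1] by dropping its first
   entry. *)
pose A' : set (seqspace X) := (fun s => fun k => s k.+1) @^-1` A1.
have mA' : measurable A'.
  exact: (@measurable_preim _ _ (seqspace X) (seqspace X) _ A1
    (@measurable_reindex _ X succn) mA1).
have hA' : hist Z (t + 1) @^-1` A' = hist Z t @^-1` A1.
  apply/seteqP; split => w; rewrite /A' /=;
    have -> // : (fun k => hist Z (t + 1) w k.+1) = hist Z t w;
    by apply/funext => k; rewrite /hist; congr (Z _ w); lia.
have -> : hist Z t @^-1` A `&` path Z t @^-1` box (B :: Bs) =
    hist Z (t + 1) @^-1` A' `&` path Z (t + 1) @^-1` box Bs.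
  rewrite hA' box_cons.
  have pE w : (fun k => path Z t w k.+1) = path Z (t + 1) w.
    by apply/funext => k; rewrite /path; congr (Z _ w); lia.
  apply/seteqP; split => w; rewrite /A1 /=; rewrite path0 hist0 pE.
    by move=> [? []].
  by move=> [[]].
have [mq q01] := box_prob_ok mBs.
rewrite IH// hA' (markov_step chain)//.
rewrite [LHS]integral_mkcond [RHS]integral_mkcond; apply: eq_integral => w _.
rewrite !patchE /A1 /= preimage_setI in_setI.
case: (w \in _ @^-1` A) => //=.
rewrite indicE; have -> : (w \in hist Z t @^-1` ((fun s => s 0%N) @^-1` B)) = (Z t w \in B).
  by apply/idP/idP; rewrite !inE /= hist0.
by case: (_ \in B); rewrite ?mul1r ?mul0r.
Qed.

(** [Xi] is sampled at time 0, given [Z 0] only. Its box probabilities agree [pi]-almost everywhere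
    with [box_prob], which does not depend on time; so the same [Xi] works at every [t] and given
    the whole history. *)
Lemma path_sampler : codable X ->
  exists Xi : X * measurableTypeR R -> seqspace X,
    measurable_fun setT Xi /\
    forall t (F : seqspace X * seqspace X -> \bar R),
      measurable_fun setT F -> (forall z, 0 <= F z)%E ->
      (\int[Pr]_w F (hist Z t w, path Z t w) =
       \int[Pr]_w \int[unoise R]_u F (hist Z t w, Xi (Z t w, u)))%E.
Proof.
move=> cX; have [Xi [mXi XiE]] := sampler Pr (codable_seqspace cX) (mZ 0) (mpath 0).
exists Xi; split => // t F mF F0.
have mXi' x : measurable_fun setT (fun u => Xi (x, u)).
  exact: measurable_fun_pair2.
pose psi Bs x := unoise R [set u | box Bs (Xi (x, u))].
have mpsi Bs : measurable_sides Bs -> measurable_fun setT (psi Bs).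
  move=> mBs; have := measurable_fun_xsection (unoise R) (measurable_preim mXi (measurable_box mBs)).
  rewrite (_ : _ \o _ = psi Bs)//; apply/funext => x /=; congr (unoise R _).
  by apply/seteqP; split => u; rewrite /xsection /= inE.
have psiE Bs : measurable_sides Bs ->
    {ae pi, forall x, (box_prob Bs x)%:E = psi Bs x}.
  move=> mBs; have [mq q01] := box_prob_ok mBs.
  have q0 x : (0 <= (box_prob Bs x)%:E)%E by rewrite lee_fin; case/andP: (q01 x).
  have : ae_eq pi setT (fun x => (box_prob Bs x)%:E) (psi Bs).
    apply: integral_ae_eq => //.
    - apply/integrableP; split; first exact/measurable_EFinP.
      apply: (@le_lt_trans _ _ (\int[pi]_x 1)%E); last by rewrite integral_probability_cst ltry.
      apply: ge0_le_integral => //.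
      + by apply: measurableT_comp => //; exact/measurable_EFinP.
      + by move=> x _; rewrite gee0_abs// lee_fin; case/andP: (q01 x).
    - exact: mpsi.
    - move=> S _ mS.
      rewrite -!(integral_chain chain 0)//; [|exact: mpsi|exact/measurable_EFinP].
      have h0 : Z 0 @^-1` S = hist Z 0 @^-1` ((fun s => s 0%N) @^-1` S).
        by apply/seteqP; split => w /=; rewrite hist0.
      rewrite {1}h0 -hist_box_law//; last by apply: (measurable_preim (measurable_coord 0)).
      rewrite -h0.
      have mf1 : measurable_fun setT (fun w => (Z 0 w, path Z 0 w)).
        by apply: measurable_fun_pair; [exact: mZ|exact: mpath].
      have mg1 : measurable_fun setT (fun wu : O * measurableTypeR R =>
          (Z 0 wu.1, Xi (Z 0 wu.1, wu.2))).
        have mZ1 : measurable_fun setT (fun wu : O * measurableTypeR R => Z 0 wu.1).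
          exact: (measurableT_comp (mZ 0) measurable_fst).
        apply: (measurable_fun_pair mZ1); apply: (measurableT_comp mXi).
        exact: (measurable_fun_pair mZ1 measurable_snd).
      have mS1 : measurable (S `*` (box Bs : set (seqspace X))).
        by apply: measurableX => //; exact: measurable_box.
      etransitivity; first exact: (noisy_law_set mf1 mg1 mS1 XiE).
      exact/esym/(integral_noise_patch Pr (unoise R) (Z 0 @^-1` S)).
  by apply: filterS => x /(_ I).
have mf1 : measurable_fun setT (fun w => (hist Z t w, path Z t w)).
  by apply: measurable_fun_pair; [exact: mhist|exact: mpath].
have mg1 : measurable_fun setT (fun wu : O * measurableTypeR R =>
    (hist Z t wu.1, Xi (Z t wu.1, wu.2))).
  apply: measurable_fun_pair; first exact: (measurableT_comp (mhist t) measurable_fst).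
  apply: (measurableT_comp mXi); apply: measurable_fun_pair => //.
  exact: (measurableT_comp (mZ t) measurable_fst).
have K := @noisy_law_ext R _ _ _ _ O O (measurableTypeR R) _ _ Pr Pr (unoise R) _ _
  (measurable_rectangles (seqspace X) (measurable_boxes X) (boxes_setT X))
  (@rectangles_setI _ _ _ _ _ (@boxes_setI _ X))
  (@rectangles_setT _ _ _ _ _ (boxes_setT X)) mf1 mg1.
apply: (K _ F mF F0).
move=> _ [A mA [_ [Bs mBs ->] <-]].
rewrite [_ @^-1` (A `*` _)](_ : _ = hist Z t @^-1` A `&` path Z t @^-1` box Bs)//.
rewrite hist_box_law//.
have [mq q01] := box_prob_ok mBs.
transitivity (\int[Pr]_(w in hist Z t @^-1` A) psi Bs (Z t w))%E; last first.
  exact: (integral_noise_patch Pr (unoise R) (hist Z t @^-1` A)).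
have mqZ : measurable_fun setT (fun w => (box_prob Bs (Z t w))%:E).
  by apply/measurable_EFinP; exact: (measurableT_comp mq (mZ t)).
have mpZ : measurable_fun setT (fun w => psi Bs (Z t w)).
  exact: (measurableT_comp (mpsi _ mBs) (mZ t)).
apply: ge0_ae_eq_integral.
- exact: (measurable_preim (mhist t)).
- exact: measurable_funTS.
- exact: measurable_funTS.
- by move=> w _; rewrite lee_fin; case/andP: (q01 (Z t w)).
- by [].
- by apply: filterS (chain_ae chain t (psiE _ mBs)) => w H _.
Qed.

End path_law.

(** * Doeblin minorization *)

Section kernel_powers.
Context (R : realType) d (X : measurableType d) (P : R.-pker X ~> X).

Definition kernel_step (K : R.-pker X ~> X) : X -> {measure set X -> \bar R} :=
  mkcomp P (kernel.kernel_snd K).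

Section kernel_step_probability.
Context (K : R.-pker X ~> X).

Let measurable_step U : measurable U ->
  measurable_fun setT (kernel_step K ^~ U).
Proof.
move=> mU.
apply: (@measurable_fun_integral_kernel _ _ X X R P _ (fun y => K y U)) => //.
  by move=> V mV; exact: measurable_kernel.
exact: measurable_kernel.
Qed.

HB.instance Definition _ :=
  @isKernel.Build _ _ _ _ _ (kernel_step K) measurable_step.

Let step_setT x : kernel_step K x setT = 1%E.
Proof.
rewrite /kernel_step /= /kcomp (eq_integral (cst 1%E)).
  by rewrite integral_kernel_cst.
by move=> y _; rewrite /kernel.kernel_snd /= prob_kernel.
Qed.

HB.instance Definition _ :=
  @Kernel_isProbability.Build _ _ _ _ _ (kernel_step K) step_setT.

End kernel_step_probability.

(** [kpow] is a bare function of points and sets; [K] is the same object with the structure of a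
    probability kernel. *)
Lemma kpow_kernel n : exists K : R.-pker X ~> X,
  forall x B, measurable B -> kpow P n x B = K x B.
Proof.
elim: n => [|n [K KE]].
  exists (kdirac (@measurable_id _ X setT)) => x B mB /=.
  by rewrite /kdirac.
exists (kernel_step K : R.-pker X ~> X) => x B mB /=.
by apply: eq_integral => y _; rewrite KE.
Qed.

End kernel_powers.

Lemma measurable_kernel_xsection (R : realType) dA d (A : measurableType dA)
    (X : measurableType d) (k : R.-fker A ~> X) (E : set (A * X)) :
  measurable E -> measurable_fun setT (fun a => k a (xsection E a)).
Proof.
move=> mE.
have mI : measurable_fun setT (fun az : A * X => (\1_E az)%:E : \bar R).
  exact/measurable_EFinP/measurable_indic.
have := @measurable_fun_integral_finite_kernel _ _ _ _ R _ k _ mI.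
rewrite (_ : (fun a => _) = (fun a => k a (xsection E a))); last first.
  apply/funext => a; rewrite -[in RHS](setIT (xsection E a)) -integral_indic//.
    by apply: eq_integral => z _; rewrite xsectionE.
  exact: measurable_xsection.
by apply=> az; rewrite lee_fin.
Qed.

Lemma product_measure_ysection (R : realType) d1 d2 (T1 : measurableType d1)
    (T2 : measurableType d2) (m1 : probability T1 R) (m2 : probability T2 R)
    (E : set (T1 * T2)) :
  measurable E -> ((m1 \x m2) E = \int[m2]_y m1 (ysection E y))%E.
Proof.
move=> mE; transitivity (\int[m1 \x m2]_z (\1_E z)%:E)%E.
  by rewrite integral_indic// setIT.
rewrite fubini_tonelli2//; last exact/measurable_EFinP/measurable_indic.
apply: eq_integral => y _; rewrite /fubini_G.
rewrite -[in RHS](setIT (ysection E y)) -integral_indic//; last exact: measurable_ysection.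
by apply: eq_integral => x _; rewrite ysectionE.
Qed.

Section kernel_laws.
Context (R : realType) d (X : measurableType d) (P : R.-pker X ~> X)
  (pi : probability X R) dO (O : measurableType dO) (Pr : probability O R)
  (Z : int -> O -> X).
Hypothesis chain : stationary_markov_chain Pr P pi Z.

Let mZ := measurable_chain chain.
Let mhist := measurable_hist chain.

Lemma kpow_markov n t (C : set (seqspace X)) (B : set X) :
  measurable C -> measurable B ->
  (Pr (hist Z t @^-1` C `&` Z (t + n%:Z) @^-1` B) =
   \int[Pr]_(w in hist Z t @^-1` C) kpow P n (Z t w) B)%E.
Proof.
move=> + mB; elim: n t C => [|n IH] t C mC.
  have mZB : measurable (Z t @^-1` B) by exact: (measurable_preim (mZ t)).
  have mhC : measurable (hist Z t @^-1` C) by exact: (measurable_preim (mhist t)).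
  rewrite addr0 setIC -integral_indic//.
have [K KE] := kpow_kernel P n.
have -> : t + n.+1%:Z = (t + 1) + n%:Z by lia.
pose C' : set (seqspace X) := (fun s => fun k => s k.+1) @^-1` C.
have mC' : measurable C'.
  exact: (@measurable_preim _ _ (seqspace X) (seqspace X) _ C
    (@measurable_reindex _ X succn) mC).
have hC' : hist Z (t + 1) @^-1` C' = hist Z t @^-1` C.
  apply/seteqP; split => w; rewrite /C' /=;
    have -> // : (fun k => hist Z (t + 1) w k.+1) = hist Z t w;
    by apply/funext => k; rewrite /hist; congr (Z _ w); lia.
rewrite -hC' IH//.
pose f x := fine (K x B).
have K01 x : (K x B <= 1)%E.
  by rewrite -(@prob_kernel _ _ _ _ _ K x); apply: le_measure; rewrite ?inE.
have fE x : (f x)%:E = K x B.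
  by rewrite fineK// ge0_fin_numE// (le_lt_trans (K01 x) (ltry 1)).
have mf : measurable_fun setT f.
  by apply: measurableT_comp => //; exact: measurable_kernel.
have f01 x : 0 <= f x <= 1 by rewrite -!lee_fin fE K01 measure_ge0.
under eq_integral do rewrite KE// -fE.
rewrite hC' (markov_step chain)//; apply: eq_integral => w _ /=.
by rewrite kerfE//; apply: eq_integral => y _; rewrite fE KE.
Qed.

(** Both sides are finite measures in [E], the right one being a kernel product started from the
    constant kernel [k1]. On rectangles the claim is the Markov property at the middle time. *)
Lemma triple_law n (K : R.-pker X ~> X) t m (E : set (X * X * X)) :
  (forall x B, measurable B -> kpow P n x B = K x B) -> measurable E ->
  (Pr [set w | E (Z t w, Z (t + m%:Z) w, Z (t + m%:Z + n%:Z) w)] =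
   \int[Pr]_w K (Z (t + m%:Z) w) (xsection E (Z t w, Z (t + m%:Z) w)))%E.
Proof.
move=> KE mE.
set s := t + m%:Z.
have mH : measurable_fun setT (fun w => (Z t w, Z s w)) by exact: measurable_fun_pair.
have mHV : measurable_fun setT (fun w => (Z t w, Z s w, Z (s + n%:Z) w)).
  exact: measurable_fun_pair.
pose eta := image_law Pr mH.
pose k1 := kprobability (measurable_cst (eta : pprobability (X * X)%type R)) : R.-pker X ~> _.
pose k2 : R.-spker (X * (X * X)) ~> X := kernel.kernel_snd (kernel.kernel_snd K).
pose m1 : measure _ R := image_law Pr mHV.
pose m2 := mkproduct k1 k2 point.
have m2E (F : set (X * X * X)) : measurable F ->
    (m2 F = \int[Pr]_w K (Z s w) (xsection F (Z t w, Z s w)))%E.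
  move=> mF.
  have mKF : measurable_fun setT (fun y : X * X => K y.2 (xsection F y)).
      exact: (@measurable_kernel_xsection R _ _ _ _ (kernel.kernel_snd K)).
  rewrite /m2 /= /kproduct.
  transitivity (\int[eta]_y K y.2 (xsection F y))%E.
    rewrite /k1 /= /kprobability /=; apply: eq_integral => y _.
    exact: kernel.intker_indicE.
  by rewrite integral_image_law.
have m1E (F : set (X * X * X)) : m1 F = Pr [set w | F (Z t w, Z s w, Z (s + n%:Z) w)] by [].
rewrite -m1E -m2E//.
apply: (@measure_unique _ R (X * X * X)%type _ (fun=> setT)
  (measurable_prod_measurableType (X * X)%type X)) => //.
- by move=> _ _ [A mA [B mB <-]] [A' mA' [B' mB' <-]]; exists (A `&` A');
    [exact: measurableI|exists (B `&` B'); [exact: measurableI|rewrite setXI]].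
- by move=> _; exists setT => //; exists setT => //; rewrite setXTT.
- by rewrite bigcup_const.
- move=> _ [A mA [B mB <-]]; rewrite m2E; last exact: measurableX.
  rewrite m1E.
  pose C : set (seqspace X) := (fun h => (h m, h 0%N)) @^-1` A.
  have mC : measurable C.
    apply: (@measurable_preim _ _ (seqspace X) (X * X)%type (fun h => (h m, h 0%N))) => //.
    by apply: measurable_fun_pair; exact: measurable_coord.
  have hC : hist Z s @^-1` C = [set w | A (Z t w, Z s w)].
    have hE w : (hist Z s w m, hist Z s w 0%N) = (Z t w, Z s w).
      by rewrite hist0 /hist; congr (Z _ w, _); rewrite /s; lia.
    by apply/seteqP; split => w; rewrite /C /= hE.
  have -> : [set w | (A `*` B) (Z t w, Z s w, Z (s + n%:Z) w)] =
      hist Z s @^-1` C `&` Z (s + n%:Z) @^-1` B by rewrite hC.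
  rewrite kpow_markov// hC [LHS]integral_mkcond; apply: eq_integral => w _.
  rewrite patchE; case: ifPn => [/set_mem Aw|nAw].
    by rewrite KE// in_xsectionX ?inE.
  rewrite notin_xsectionX ?measure0//.
- by move=> _; apply: probability_lty.
Qed.

End kernel_laws.

Section density_set.
Context (R : realType) d (T : measurableType d).

(** A Hahn set of the signed measure [b - p / 2]. It replaces the set where the density of [b] is at
    least 1/2, although [b] may have a part singular to [p]. *)
Lemma half_density_set (b p : probability T R) :
  exists D : set T, [/\ measurable D,
    forall A, measurable A -> A `<=` D -> (2^-1%:E * p A <= b A)%E &
    forall A, measurable A -> A `<=` ~` D -> (b A <= 2^-1%:E * p A)%E].
Proof.
pose nu : {charge set T -> \bar R} :=
  cadd (charge_of_finite_measure b) (cscale (- 2^-1) (charge_of_finite_measure p)).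
have nuE A : measurable A -> nu A = (b A - 2^-1%:E * p A)%E.
  by move=> mA; rewrite /nu /= /cadd /= /cscale /= EFinN mulNe.
have pfin A : measurable A -> (2^-1%:E * p A)%E \is a fin_num.
  by move=> mA; rewrite fin_numM// ge0_fin_numE// probability_lty.
have [D [N [[mD posD] [mN negN] DN1 DN0]]] := Hahn_decomposition nu.
exists D; split => //.
- by move=> A mA AD; rewrite -sube_ge0 ?pfin ?orbT// -nuE// posD.
- move=> A mA AD; rewrite -sube_le0 -nuE//; apply: negN => // x Ax.
  by have [Dx|//] : (D `|` N) x; [rewrite DN1|have := AD _ Ax].
Qed.

Lemma half_density_integral (b p : probability T R) (D : set T) (f : T -> \bar R) :
  measurable D ->
  (forall A, measurable A -> A `<=` D -> (2^-1%:E * p A <= b A)%E) ->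
  measurable_fun setT f -> (forall x, 0 <= f x)%E -> (forall x, ~ D x -> f x = 0%E) ->
  (2^-1%:E * \int[p]_x f x <= \int[b]_x f x)%E.
Proof.
move=> mD pb mf f0 fD.
have restr (mu : measure T R) : (\int[mu]_x f x = \int[mrestr mu mD]_(x in D) f x)%E.
  rewrite (@eq_measure_integral _ _ _ _ mu); last first.
    by move=> A mA AD; rewrite /= /mrestr setIidl.
  rewrite [RHS]integral_mkcond; apply: eq_integral => x _; rewrite patchE.
  by case: ifPn => // /negP nD; apply: fD => Dx; apply: nD; rewrite inE.
rewrite !restr.
have h0 : (0 <= 2^-1 :> R) by rewrite invr_ge0.
rewrite -[(2^-1)%R]/((NngNum h0)%:num) -ge0_integral_mscale//; last exact: measurable_funTS.
apply: ge0_le_measure_integral => // S mS.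
by rewrite /mscale /mrestr /=; apply: pb; [exact: measurableI|exact: subIsetr].
Qed.

End density_set.

Section sections.
Context (R : realType) d (X : measurableType d).

Lemma integral_xsection_strip (mu : measure X R) (k : X -> measure X R)
    (A : set X) (E : set (X * X)) :
  (\int[mu]_x k x (xsection ((A `*` setT) `&` E) x) =
   \int[mu]_(x in A) k x (xsection E x))%E.
Proof.
rewrite [RHS]integral_mkcond; apply: eq_integral => x _; rewrite patchE xsectionI.
case: ifPn => xA; first by rewrite in_xsectionX// setTI.
by rewrite notin_xsectionX// set0I measure0.
Qed.

End sections.

Section doeblin.
Context (R : realType) d (X : measurableType d) (P : R.-pker X ~> X)
  (pi : probability X R) dO (O : measurableType dO) (Pr : probability O R)
  (Z : int -> O -> X).
Hypothesis chain : stationary_markov_chain Pr P pi Z.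
Context (m : nat) (K : R.-pker X ~> X).
Hypothesis KE : forall x B, measurable B -> kpow P m x B = K x B.
Hypothesis Ktv : forall x B, measurable B -> (pi B <= K x B + 16^-1%:E)%E.

Let mZ := measurable_chain chain.

Lemma kpow_pair_law t (E : set (X * X)) : measurable E ->
  (Pr [set w | E (Z t w, Z (t + m%:Z) w)] = \int[pi]_x K x (xsection E x))%E.
Proof.
move=> mE; pose E' : set (X * X * X) := (fun z => (z.1.2, z.2)) @^-1` E.
have mE' : measurable E'.
  apply: (@measurable_preim _ _ (X * X * X)%type (X * X)%type (fun z => (z.1.2, z.2))) => //.
  apply: measurable_fun_pair => //.
  exact: (measurableT_comp (@measurable_snd _ _ X X) measurable_fst).
have := @triple_law _ _ _ _ _ _ _ _ _ chain m K t 0 _ KE mE'.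
rewrite addr0 => ->.
have := integral_chain chain t measurableT (measurable_kernel_xsection K mE).
move=> /(_ (fun=> measure_ge0 _ _)) <-; rewrite preimage_setT.
by apply: eq_integral => w _; congr (K _ _); rewrite !xsectionE.
Qed.

(** The factor is [1/8 = 1/2 * 1/2 * 1/2]: one half from the domination on [D] for each half-block,
    and one half as a lower bound for the [pi]-mass of the midpoints [y] such that [(x, y)] and
    [(y, z)] both lie in [D]. [G] collects the endpoints [z] with few bad [y]. *)
Lemma doeblin_minorization : exists G : set X, [/\ measurable G,
  (2^-1%:E <= pi G)%E & forall t (E : set (X * X)), measurable E ->
  (8^-1%:E * \int[pi]_x pi (xsection E x `&` G) <=
   Pr [set w | E (Z t w, Z (t + (m + m)%:Z) w)])%E].
Proof.
have mpair t : measurable_fun setT (fun w => (Z t w, Z (t + m%:Z) w)).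
  exact: measurable_fun_pair.
pose b := image_law Pr (mpair 0).
have bE E : measurable E -> (b E = \int[pi]_x K x (xsection E x))%E.
  exact: kpow_pair_law.
have [D [mD Dge Dle]] := half_density_set b (pi \x pi)%E.
have mDC : measurable (~` D) by exact: measurableC.
have h0 : (0 <= (2^-1)%:E :> \bar R)%E by rewrite lee_fin invr_ge0.
have ppE E : (pi \x pi)%E E = (\int[pi]_x pi (xsection E x))%E by [].
have mpx (E : set (X * X)) : measurable E -> measurable_fun setT (fun x => pi (xsection E x)).
  by move=> mE; exact: measurable_fun_xsection.
have mpy (E : set (X * X)) : measurable E -> measurable_fun setT (fun x => pi (ysection E x)).
  by move=> mE; exact: measurable_fun_ysection.
have lty (f : X -> \bar R) : (forall x, 0 <= f x <= 1)%E -> measurable_fun setT f ->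
    (\int[pi]_x f x < +oo)%E.
  move=> f01 mf; apply: (@le_lt_trans _ _ (\int[pi]_x 1)%E); last by rewrite integral_probability_cst ltry.
  by apply: ge0_le_integral => // x _; case/andP: (f01 x).
have p1 (mu : probability X R) A : measurable A -> (mu A <= 1)%E by exact: probability_le1.
have K1 x A : measurable A -> (K x A <= 1)%E.
  by move=> mA; rewrite -(@prob_kernel _ _ _ _ _ K x); apply: le_measure; rewrite ?inE.
have half1 (r : \bar R) : (0 <= r <= 1 -> 0 <= 2^-1%:E * r <= 1)%E.
  move=> /andP[r0 r1]; rewrite mule_ge0//=; apply: (@le_trans _ _ (1 * r)%E); last by rewrite mul1e.
  by apply: lee_wpmul2r => //; rewrite lee_fin invf_le1// ler1n.
(* On the section off [D] one has [pi <= K + 1/16 <= pi / 2 + 1/16], whence [pi <= 1/8]. *)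
have Dsmall : {ae pi, forall x, (pi (xsection (~` D) x) <= 8^-1%:E)%E}.
  have : {ae pi, forall x, (K x (xsection (~` D) x) <= 2^-1%:E * pi (xsection (~` D) x))%E}.
    apply: ae_le_integral => //.
    - exact: measurable_kernel_xsection.
    - by apply: emeasurable_funM => //; exact: mpx.
    - by move=> x; rewrite mule_ge0.
    - apply: lty; last by apply: emeasurable_funM => //; exact: mpx.
      by move=> x; apply: half1; rewrite measure_ge0 p1//; exact: measurable_xsection.
    - move=> A mA; rewrite ge0_integralZl//; last by apply: measurable_funTS; exact: mpx.
      rewrite -(integral_xsection_strip pi K A (~` D)) -(integral_xsection_strip pi (fun=> pi) A (~` D)) -bE;
        last by apply: measurableI => //; exact: measurableX.
      by apply: Dle; [apply: measurableI => //; exact: measurableX|move=> x []].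
  apply: filterS => x Kx.
  have mDx : measurable (xsection (~` D) x) by exact: measurable_xsection.
  have := Ktv x mDx => /le_trans/(_ (leeD2r _ Kx)).
  have : pi (xsection (~` D) x) \is a fin_num by rewrite ge0_fin_numE// probability_lty.
  move=> /fineK <-; rewrite -EFinM -EFinD !lee_fin; lra.
(* The null set of [y] depends on [B]. This is harmless: [B] will be the section of [E] at a point
   [x] fixed before [y] is integrated. *)
have Dbig B : measurable B ->
    {ae pi, forall y, (2^-1%:E * pi (xsection D y `&` B) <= K y (xsection D y `&` B))%E}.
  move=> mB; pose E : set (X * X) := (setT `*` B) `&` D.
  have mE : measurable E by apply: measurableI => //; exact: measurableX.
  have EE y : xsection E y = xsection D y `&` B.
    by rewrite xsectionI in_xsectionX ?inE// setIC.
  have : {ae pi, forall y, (2^-1%:E * pi (xsection E y) <= K y (xsection E y))%E}.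
    apply: ae_le_integral => //.
    - by apply: emeasurable_funM => //; exact: mpx.
    - exact: measurable_kernel_xsection.
    - by move=> x; rewrite mule_ge0.
    - apply: lty; last exact: measurable_kernel_xsection.
      by move=> x; rewrite measure_ge0 K1//; exact: measurable_xsection.
    - move=> A mA; rewrite ge0_integralZl//; last by apply: measurable_funTS; exact: mpx.
      rewrite -(integral_xsection_strip pi K A E) -(integral_xsection_strip pi (fun=> pi) A E) -bE;
        last by apply: measurableI => //; exact: measurableX.
      by apply: Dge; [apply: measurableI => //; exact: measurableX|move=> x [_ []]].
  by apply: filterS => y; rewrite EE.
(* The complement of [D] has product mass at most 1/8, so by Markov's inequality the [z] whose
   section exceeds 1/4 have mass at most 1/2. *)
pose G := [set z | pi (ysection (~` D) z) <= 4^-1%:E]%E.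
have mG : measurable G.
  rewrite -[G]setTI; apply: emeasurable_fun_infty_c => //; exact: mpy.
have ppD : ((pi \x pi) (~` D) <= 8^-1%:E)%E.
  rewrite ppE -[leRHS](integral_probability_cst pi).
  by apply: ae_ge0_le_integral => //; [exact: mpx|apply: filterS Dsmall].
have GC : (pi (~` G) <= 2^-1%:E)%E.
  have : (4^-1%:E * pi (~` G) <= 8^-1%:E)%E.
    apply: le_trans ppD; rewrite -integral_cst//; last exact: measurableC.
    rewrite product_measure_ysection//.
    apply: (@le_trans _ _ (\int[pi]_(z in ~` G) pi (ysection (~` D) z))%E).
      apply: ge0_le_integral => //; first exact: measurableC.
      - by move=> z _; rewrite lee_fin invr_ge0.
      - by apply: measurable_funTS; exact: mpy.
      - by move=> z /negP; rewrite -ltNge => /ltW.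
    by apply: ge0_subset_integral => //; [exact: measurableC|exact: mpy].
  have : pi (~` G) \is a fin_num by rewrite ge0_fin_numE// probability_lty//; exact: measurableC.
  move=> /fineK <-; rewrite -EFinM !lee_fin; lra.
exists G; split => //.
  have /fineK GF : pi G \is a fin_num by rewrite ge0_fin_numE// probability_lty.
  move: GC; rewrite probability_setC// -GF -EFinB !lee_fin; lra.
move=> t E mE.
(* Triples with endpoints in [E] and a midpoint good on both sides; their probability bounds that of
   [E] from below. *)
pose T : set (X * X * X) := [set z | [/\ D z.1, D (z.1.2, z.2) & E (z.1.1, z.2)]].
have mT : measurable T.
  have -> : T = (fst @^-1` D) `&` (((fun z => (z.1.2, z.2)) @^-1` D) `&`
      ((fun z => (z.1.1, z.2)) @^-1` E)).
    by apply/seteqP; split => z /= [// ? []].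
  apply: measurableI; first exact: (measurable_preim measurable_fst mD).
  apply: measurableI.
    apply: (@measurable_preim _ _ (X * X * X)%type (X * X)%type (fun z => (z.1.2, z.2))) => //.
    apply: measurable_fun_pair => //.
    exact: (measurableT_comp (@measurable_snd _ _ X X) measurable_fst).
  apply: (@measurable_preim _ _ (X * X * X)%type (X * X)%type (fun z => (z.1.1, z.2))) => //.
  apply: measurable_fun_pair => //.
  exact: (measurableT_comp (@measurable_fst _ _ X X) measurable_fst).
pose phi (xy : X * X) := K xy.2 (xsection T xy).
have mphi : measurable_fun setT phi.
  exact: (@measurable_kernel_xsection R _ _ _ _ (kernel.kernel_snd K)).
have phi0 xy : (0 <= phi xy)%E by exact: measure_ge0.
have TE x y : D (x, y) -> xsection T (x, y) = xsection D y `&` xsection E x.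
  by move=> Dxy; apply/seteqP; split => z; rewrite /xsection /= !inE /T /= => -[].
have TN x y : ~ D (x, y) -> xsection T (x, y) = set0.
  by move=> nD; apply/seteqP; split => z //; rewrite /xsection /= inE /T /= => -[].
apply: (@le_trans _ _ (\int[b]_xy phi xy)%E); last first.
  have -> : (\int[b]_xy phi xy = Pr [set w | T (Z t w, Z (t + m%:Z) w, Z (t + m%:Z + m%:Z) w)])%E.
    rewrite (@triple_law _ _ _ _ _ _ _ _ _ chain m K t m _ KE mT).
    rewrite (@eq_measure_integral _ _ _ _ (image_law Pr (mpair t))); last first.
      by move=> A mA _; apply: (eq_trans (bE A mA)); exact/esym/(kpow_pair_law t mA).
    by rewrite integral_image_law.
  have -> : t + (m + m)%:Z = t + m%:Z + m%:Z by lia.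
  apply: le_measure; rewrite ?inE.
  - by apply: (@measurable_preim _ _ O (X * X * X)%type 
      (fun w => (Z t w, Z (t + m%:Z) w, Z (t + m%:Z + m%:Z) w))) => //; apply: measurable_fun_pair.
  - by apply: (@measurable_preim _ _ O (X * X)%type
      (fun w => (Z t w, Z (t + m%:Z + m%:Z) w))) => //; apply: measurable_fun_pair.
  - by move=> w [].
apply: le_trans (half_density_integral mD Dge mphi phi0 _); last first.
  by move=> [x y] nD; rewrite /phi TN ?measure0.
rewrite fubini_tonelli1// /fubini_F.
have -> : (8^-1%:E = 2^-1%:E * 4^-1%:E :> \bar R)%E.
  by rewrite -EFinM; congr (_%:E); rewrite -invfM -natrM.
pose EG := E `&` (setT `*` G).
have mEG : measurable EG by apply: measurableI => //; exact: measurableX.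
have EGE x : xsection E x `&` G = xsection EG x.
  by rewrite xsectionI [xsection (setT `*` G) x]in_xsectionX ?inE.
have mpEG : measurable_fun setT (fun x => pi (xsection E x `&` G)).
  by under eq_fun do rewrite EGE; exact: mpx.
have q0 : (0 <= (4^-1)%:E :> \bar R)%E by rewrite lee_fin invr_ge0.
rewrite -muleA lee_wpmul2l// -ge0_integralZl//.
apply: ae_ge0_le_integral => //.
- by move=> x _; rewrite mule_ge0.
- exact: emeasurable_funM.
- by move=> x _; exact: integral_ge0.
- exact: measurable_fun_fubini_tonelli_F.
apply: filterS Dsmall => x xD _.
have mEx : measurable (xsection E x) by exact: measurable_xsection.
pose S : set (X * X) := (fun yz => (x, yz.1, yz.2)) @^-1` T.
have mS : measurable S.
  apply: (@measurable_preim _ _ (X * X)%type (X * X * X)%type (fun yz => (x, yz.1, yz.2))) => //.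
  by do 2 apply: measurable_fun_pair => //.
have SE y : xsection T (x, y) = xsection S y by rewrite !xsectionE.
apply: (@le_trans _ _ (\int[pi]_y (2^-1%:E * pi (xsection S y))))%E; last first.
  apply: ae_ge0_le_integral => //.
  - by move=> y _; rewrite mule_ge0.
  - by apply: emeasurable_funM => //; exact: mpx.
  - exact: (measurable_fun_pair2 x mphi).
  - apply: filterS (Dbig _ mEx) => y Hy _; rewrite /phi /= -SE.
    have [Dxy|nD] := pselect (D (x, y)); first by rewrite TE.
    by rewrite TN// !measure0 mule0.
rewrite ge0_integralZl//; last exact: mpx.
have -> : (4^-1%:E = 2^-1%:E * 2^-1%:E :> \bar R)%E.
  by rewrite -EFinM; congr (_%:E); rewrite -invfM -natrM.
rewrite -muleA lee_wpmul2l// -ppE product_measure_ysection//.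
rewrite EGE -integral_cst//; last exact: measurable_xsection.
have mEGx : measurable (xsection EG x) by exact: measurable_xsection.
apply: (@le_trans _ _ (\int[pi]_(z in xsection EG x) pi (ysection S z)))%E; last first.
  by apply: ge0_subset_integral => //; exact: mpy.
apply: ge0_le_integral => //.
- by apply: measurable_funTS; exact: mpy.
rewrite -EGE => z [/= Exz Gz].
(* The bad midpoints have mass at most [1/8 + 1/4], which leaves 5/8 and in particular 1/2. *)
pose U := xsection (~` D) x `|` ysection (~` D) z.
have mU : measurable U.
  by apply: measurableU; [exact: measurable_xsection|exact: measurable_ysection].
have piU : (pi U <= 8^-1%:E + 4^-1%:E)%E.
  apply: le_trans (measureU2 _ _ _) _; [exact: measurable_xsection|exact: measurable_ysection|].
  exact: leeD.
have mUC : measurable (~` U) by exact: measurableC.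
apply: (@le_trans _ _ (pi (~` U))).
  have /fineK UF : pi U \is a fin_num by rewrite ge0_fin_numE// probability_lty.
  move: piU; rewrite probability_setC// -UF -EFinB -EFinD !lee_fin; lra.
apply: le_measure; rewrite ?inE//; first exact: measurable_ysection.
move=> y nU; rewrite /ysection /= inE /S /T /=; split.
- by apply: contrapT => nD; apply: nU; left; rewrite /xsection /= inE.
- by apply: contrapT => nD; apply: nU; right; rewrite /ysection /= inE.
- by move: Exz; rewrite /xsection /= inE.
Qed.

End doeblin.

(** * Sampling a block given its starting point and its bell *)

Section noise_transfer.
Context (R : realType) d (X : measurableType d) (P : R.-pker X ~> X)
  (pi : probability X R) dO (O : measurableType dO) (Pr : probability O R)
  (Z : int -> O -> X).
Hypothesis chain : stationary_markov_chain Pr P pi Z.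

Let mZ := measurable_chain chain.
Let mhist := measurable_hist chain.
Let mpath := measurable_path chain.

Context dA dB dD (A : measurableType dA) (B : measurableType dB)
  (D : measurableType dD) (la : probability A R) (lb : probability B R)
  (f : X * A -> D) (g : X * B -> D).
Hypotheses (mf : measurable_fun setT f) (mg : measurable_fun setT g).

(* By the Markov property, an equality of laws jointly with Z 0 is one jointly
   with the whole past. *)
Lemma noise_transfer :
  (forall F : X * D -> \bar R, measurable_fun setT F -> (forall z, 0 <= F z)%E ->
    (\int[Pr]_w \int[la]_a F (Z 0 w, f (Z 0 w, a)) =
     \int[Pr]_w \int[lb]_b F (Z 0 w, g (Z 0 w, b)))%E) ->
  forall t (F : seqspace X * D -> \bar R), measurable_fun setT F ->
    (forall z, 0 <= F z)%E ->
    (\int[Pr]_w \int[la]_a F (hist Z t w, f (Z t w, a)) =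
     \int[Pr]_w \int[lb]_b F (hist Z t w, g (Z t w, b)))%E.
Proof.
move=> fg t F mF F0.
have msec dN (N : measurableType dN) (ln : probability N R) (k : X * N -> D) (C : set D) :
    measurable_fun setT k -> measurable C ->
    measurable_fun setT (fun x => ln [set n | C (k (x, n))]).
  move=> mk mC; have := measurable_fun_xsection ln (measurable_preim mk mC).
  rewrite (_ : _ \o _ = fun x => ln [set n | C (k (x, n))])//.
  by apply/funext => x /=; rewrite xsectionE.
have mset dN (N : measurableType dN) (k : X * N -> D) (C : set D) x :
    measurable_fun setT k -> measurable C -> measurable [set n | C (k (x, n))].
  move=> mk mC; exact: (measurable_preim (measurable_fun_pair2 x mk) mC).
(* For each event the two conditional probabilities are functions of the starting point with equal
   integrals, so they agree [pi]-almost everywhere; stationarity carries this from [Z 0] to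
   [Z t]. *)
have fgae (C : set D) : measurable C ->
    {ae pi, forall x, la [set a | C (f (x, a))] = lb [set b | C (g (x, b))]}.
  move=> mC; have mla := msec _ _ la _ _ mf mC; have mlb := msec _ _ lb _ _ mg mC.
  have : ae_eq pi setT (fun x => la [set a | C (f (x, a))])
      (fun x => lb [set b | C (g (x, b))]).
    apply: integral_ae_eq => //.
    - apply/integrableP; split; first exact: mla.
      apply: (@le_lt_trans _ _ (\int[pi]_x 1)%E); last by rewrite integral_probability_cst ltry.
      apply: ge0_le_integral => //.
      + exact: measurableT_comp.
      + by move=> x _; rewrite gee0_abs//; exact: (probability_le1 la (mset _ _ f C x mf mC)).
    - move=> S _ mS.
      rewrite -!(integral_chain chain 0)//.
      pose F1 (z : X * D) : \bar R := (\1_(S `*` C) z)%:E.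
      have := fg F1; rewrite /F1 => /(_ _ _)/wrap[].
      + by apply/measurable_EFinP/measurable_indic; exact: measurableX.
      + by move=> z; rewrite lee_fin.
      have E dN (N : measurableType dN) (ln : probability N R) (k : X * N -> D) :
          measurable_fun setT k ->
          (\int[Pr]_w \int[ln]_n (\1_(S `*` C) (Z 0 w, k (Z 0 w, n)))%:E =
           \int[Pr]_(w in Z 0 @^-1` S) ln [set n | C (k (Z 0 w, n))])%E.
        move=> mk; rewrite (integral_noise_patch Pr ln); apply: eq_integral => w _.
        have mQ : measurable [set n | (S `*` C) (Z 0 w, k (Z 0 w, n))].
          apply: (@measurable_preim _ _ N (X * D)%type (fun n => (Z 0 w, k (Z 0 w, n)))).
            by apply: measurable_fun_pair => //; exact: (measurable_fun_pair2 _ mk).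
          exact: measurableX.
        by rewrite -[in RHS](setIT [set n | _]) -integral_indic.
      by rewrite !E.
  by apply: filterS => x /(_ I).
pose f1 (wa : O * A) := (hist Z t wa.1, f (Z t wa.1, wa.2)).
pose g1 (wb : O * B) := (hist Z t wb.1, g (Z t wb.1, wb.2)).
have mk dN (N : measurableType dN) (k : X * N -> D) : measurable_fun setT k ->
    measurable_fun setT (fun wn : O * N => (hist Z t wn.1, k (Z t wn.1, wn.2))).
  move=> mk; apply: measurable_fun_pair; first exact: (measurableT_comp (mhist t) measurable_fst).
  apply: (measurableT_comp mk); apply: measurable_fun_pair => //.
  exact: (measurableT_comp (mZ t) measurable_fst).
have mf1 : measurable_fun setT f1 by exact: mk.
have mg1 : measurable_fun setT g1 by exact: mk.
have <- : (\int[Pr \x la]_wa F (f1 wa) = \int[Pr]_w \int[la]_a F (hist Z t w, f (Z t w, a)))%E.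
  by rewrite fubini_tonelli1//; exact: (measurableT_comp mF mf1).
have K := @noisy_law_ext R _ _ _ _ (O * A)%type O B _ _ (Pr \x la)%E Pr lb _ _
  (measurable_prod_measurableType (seqspace X) D) _ _ mf1 mg1.
apply: (K _ _ _ F mF F0).
- by move=> _ _ [C mC [E mE <-]] [C' mC' [E' mE' <-]]; exists (C `&` C');
    [exact: measurableI|exists (E `&` E'); [exact: measurableI|rewrite setXI]].
- by exists setT => //; exists setT => //; rewrite setXTT.
move=> _ [C mC [E mE <-]].
have H dN (N : measurableType dN) (ln : probability N R) (k : X * N -> D) :
    (\int[Pr]_w ln [set n | (C `*` E) (hist Z t w, k (Z t w, n))] =
     \int[Pr]_(w in hist Z t @^-1` C) ln [set n | E (k (Z t w, n))])%E.
  exact: esym (integral_noise_patch Pr ln (hist Z t @^-1` C) (fun w => [set n | E (k (Z t w, n))])).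
etransitivity; last exact/esym/H.
transitivity (\int[Pr]_(w in hist Z t @^-1` C) la [set a | E (f (Z t w, a))])%E.
  rewrite -H /= /product_measure1; apply: eq_integral => w _ /=.
  by rewrite xsectionE.
apply: ge0_ae_eq_integral => //.
- exact: (measurable_preim (mhist t)).
- by apply: measurable_funTS; exact: (measurableT_comp (msec _ _ la _ _ mf mE) (mZ t)).
- by apply: measurable_funTS; exact: (measurableT_comp (msec _ _ lb _ _ mg mE) (mZ t)).
- by apply: filterS (chain_ae chain t (fgae _ mE)) => w Hw _.
Qed.

End noise_transfer.

Lemma unoise_lt (R : realType) (r : R) : 0 <= r <= 1 ->
  unoise R [set u : measurableTypeR R | (u : R) < r] = r%:E.
Proof.
move=> /andP[r0 r1].
have mI : measurable ([set u | (u : R) < r] : set (measurableTypeR R)).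
  have -> : [set u | u < r] = [set` `]-oo, r[%R] :> set R.
    by apply/seteqP; split => u /=; rewrite in_itv.
  exact: measurable_itv.
rewrite unoise_unit// -[in RHS](subr0 r) -(unoise_itv (lexx 0) r0 r1).
congr (unoise R _); apply/seteqP; split => u /=.
  by move=> [-> /andP[->]].
by move=> /andP[-> ur]; rewrite ur (lt_le_trans ur r1).
Qed.

(* The bell rings when the noise falls below h (e 0) (e L); the endpoint e L is
   then recorded, so that a second path can be steered to it. *)
Definition bell (R : realType) d (X : measurableType d) (h : X * X -> R) (L : nat)
    (ev : seqspace X * measurableTypeR R) : bool * X :=
  let b := (ev.2 : R) < h (ev.1 0%N, ev.1 L) in (b, if b then ev.1 L else point).

Section bell.
Context (R : realType) d (X : measurableType d) (h : X * X -> R) (L : nat).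
Hypothesis mh : measurable_fun setT h.

Lemma measurable_bell : measurable_fun setT (bell h L).
Proof.
have m0 k : measurable_fun setT (fun ev : seqspace X * measurableTypeR R => ev.1 k).
  exact: (measurableT_comp (measurable_coord k) measurable_fst).
have mb : measurable_fun setT (fun ev : seqspace X * measurableTypeR R =>
    (ev.2 : R) < h (ev.1 0%N, ev.1 L)).
  apply: measurable_fun_ltr; first exact: measurable_snd.
  by apply: (measurableT_comp mh); exact: measurable_fun_pair.
apply: measurable_fun_pair => //.
by apply: measurable_fun_ifT.
Qed.

Lemma bell_local (e e' : nat -> X) v : e 0%N = e' 0%N -> e L = e' L ->
  bell h L (e, v) = bell h L (e', v).
Proof. by rewrite /bell /= => -> ->. Qed.

End bell.

Section override.
Context d (X : measurableType d) (L : nat).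

(** A sampled path meets the constraints at its start and, after a ring, at its end only almost
    surely. Overwriting these entries enforces them everywhere and leaves a path with its own bell
    unchanged. *)
Definition override (x : X) (z : bool * X) (e : seqspace X) : seqspace X :=
  fun k => if k == 0%N then x else if (k == L) && z.1 then z.2 else e k.

Lemma measurable_override dT (T : measurableType dT) (x : T -> X)
    (z : T -> bool * X) (e : T -> seqspace X) :
  measurable_fun setT x -> measurable_fun setT z -> measurable_fun setT e ->
  measurable_fun setT (fun t => override (x t) (z t) (e t)).
Proof.
move=> mx mz me; apply: measurable_seq => k; rewrite /override.
case: (k == 0%N) => //; case: (k == L) => /=; last exact: measurable_comp_coord.
apply: measurable_fun_ifT.
- exact: (measurableT_comp measurable_fst mz).
- exact: (measurableT_comp measurable_snd mz).
- exact: measurable_comp_coord.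
Qed.

Lemma override_bell (R : realType) (h : X * X -> R) e v :
  override (e 0%N) (bell h L (e, v)) e = e.
Proof.
apply/funext => k; rewrite /override /bell /=.
have [->//|k0] := eqVneq k 0%N; have [->|//] := eqVneq k L.
by rewrite /=; case: (v < _).
Qed.

End override.

Lemma measurable_integral_snd (R : realType) dA dB (A : measurableType dA)
    (B : measurableType dB) (la : probability B R) (F : A * B -> \bar R) :
  measurable_fun setT F -> (forall z, 0 <= F z)%E ->
  measurable_fun setT (fun a => \int[la]_b F (a, b))%E.
Proof. by move=> mF F0; exact: (@measurable_fun_fubini_tonelli_F _ _ A B R la F). Qed.

Section block_sampler.
Context (R : realType) d (X : measurableType d) (P : R.-pker X ~> X)
  (pi : probability X R) dO (O : measurableType dO) (Pr : probability O R)
  (Z : int -> O -> X).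
Hypothesis chain : stationary_markov_chain Pr P pi Z.
Hypothesis cX : codable X.

Let mZ := measurable_chain chain.
Let mhist := measurable_hist chain.
Let mpath := measurable_path chain.

Context (L : nat) (G : set X).
Hypothesis L0 : (0 < L)%N.
Hypothesis mG : measurable G.
Hypothesis piG : (2^-1%:E <= pi G)%E.
Hypothesis minorized : forall t (E : set (X * X)), measurable E ->
  (8^-1%:E * \int[pi]_x pi (xsection E x `&` G) <=
   Pr [set w | E (Z t w, Z (t + L%:Z) w)])%E.

Let mends : measurable_fun setT (fun w => (Z 0 w, Z L%:Z w)).
Proof. exact: measurable_fun_pair. Qed.

Let beta := image_law Pr mends.

(** [h] is the density of 1/8 times the product of [pi] with its restriction to [G], relative to the
    law of the endpoints; the minorization is what allows it to be at most 1. *)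
Lemma bell_density : exists h : X * X -> R, [/\ measurable_fun setT h,
  (forall z, 0 <= h z <= 1) &
  forall S B : set X, measurable S -> measurable B ->
   (\int[Pr]_(w in Z 0 @^-1` S `&` Z L%:Z @^-1` B) (h (Z 0 w, Z L%:Z w))%:E =
    pi S * (8^-1%:E * pi (B `&` G)))%E].
Proof.
have mGG : measurable (setT `*` G : set (X * X)) by exact: measurableX.
have h0 : (0 <= 8^-1 :> R) by rewrite invr_ge0.
pose nu : measure (X * X)%type R := mscale (NngNum h0) (mrestr (pi \x pi)%E mGG).
have nuE E : measurable E -> (nu E = 8^-1%:E * \int[pi]_x pi (xsection E x `&` G))%E.
  move=> mE; rewrite /nu /= /mscale /mrestr /= /product_measure1; congr (_ * _)%E.
  apply: eq_integral => x _ /=; congr (pi _).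
  by rewrite xsectionI [xsection (setT `*` G) x]in_xsectionX ?inE.
have [|h [mh h01 hE]] := @bounded_density R _ (X * X)%type beta nu.
  move=> E mE; rewrite nuE//; have := minorized 0 mE; by rewrite add0r.
exists h; split => // S B mS mB.
have mSB : measurable (S `*` B) by exact: measurableX.
have := hE _ mSB; rewrite integral_image_law//; last 2 first.
  exact/measurable_EFinP.
  by move=> z; rewrite lee_fin; case/andP: (h01 z).
move=> <-; rewrite /nu /= /mscale /mrestr muleCA; congr (_ * _)%E.
rewrite -[LHS]/((pi \x pi)%E ((S `*` B) `&` (setT `*` G))) -setXI setIT.
apply: product_measure1E => //.
exact: measurableI.
Qed.

Section with_density.
Context (h : X * X -> R).
Hypothesis mh : measurable_fun setT h.
Hypothesis h01 : forall z, 0 <= h z <= 1.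
Hypothesis hE : forall S B : set X, measurable S -> measurable B ->
  (\int[Pr]_(w in Z 0 @^-1` S `&` Z L%:Z @^-1` B) (h (Z 0 w, Z L%:Z w))%:E =
   pi S * (8^-1%:E * pi (B `&` G)))%E.

Let zeta := bell h L.
Let mzeta : measurable_fun setT zeta := measurable_bell L mh.

Let mzetap : measurable_fun setT
  (fun wv : O * measurableTypeR R => zeta (path Z 0 wv.1, wv.2)).
Proof.
apply: (measurableT_comp mzeta); apply: measurable_fun_pair => //.
exact: (measurableT_comp (mpath 0) measurable_fst).
Qed.

Definition bell_law : probability (bool * X)%type R :=
  image_law (Pr \x unoise R)%E mzetap.

Let PU := (Pr \x unoise R)%E.

Let ring := [set wv : O * measurableTypeR R | (wv.2 : R) < h (Z 0 wv.1, Z L%:Z wv.1)].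

Let mring : measurable ring.
Proof.
have := @measurable_fun_ltr _ _ R _ _ _ (measurable_snd : measurable_fun setT
  (snd : O * measurableTypeR R -> R))
  (measurableT_comp (measurableT_comp mh mends) measurable_fst).
by move=> /(_ measurableT [set true]) /=; rewrite setTI; exact.
Qed.

Let mstart (S : set X) : measurable S ->
  measurable [set wv : O * measurableTypeR R | S (Z 0 wv.1)].
Proof.
move=> mS; exact: (measurable_preim (measurableT_comp (mZ 0) measurable_fst) mS).
Qed.

(** Given the path, the noise rings with conditional probability [h], whose integrals over
    rectangles factorise by the choice of [h]. *)
Let ring_prob (S B : set X) : measurable S -> measurable B ->
  (PU [set wv | [/\ S (Z 0 wv.1), B (Z L%:Z wv.1) & ring wv]] =
   pi S * (8^-1%:E * pi (B `&` G)))%E.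
Proof.
move=> mS mB; rewrite -hE// /PU /= /product_measure1.
transitivity (\int[Pr]_(w in Z 0 @^-1` S `&` Z L%:Z @^-1` B)
   unoise R [set v : measurableTypeR R | ((v : R) < h (Z 0 w, Z L%:Z w))%R])%E.
  rewrite (integral_noise_patch Pr (unoise R) (Z 0 @^-1` S `&` Z L%:Z @^-1` B)
    (fun w => [set v : measurableTypeR R | ((v : R) < h (Z 0 w, Z L%:Z w))%R])).
  apply: eq_integral => w _ /=.
  by congr (unoise R _); apply/seteqP; split => v; rewrite /xsection /= inE => -[] // [].
by apply: eq_integral => w _; rewrite unoise_lt.
Qed.

(** By subtraction from the total mass [pi S], so the product form passes from rings to silences. *)
Let silence_prob (S : set X) : measurable S ->
  (PU [set wv | S (Z 0 wv.1) /\ ~ ring wv] =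
   pi S * (1 - 8^-1%:E * pi G))%E.
Proof.
move=> mS.
have piSG (B : set X) : measurable B -> pi B \is a fin_num.
  by move=> mB; rewrite ge0_fin_numE// probability_lty.
have tot : PU [set wv | S (Z 0 wv.1)] = pi S.
  rewrite /PU /= /product_measure1.
  transitivity (\int[Pr]_(w in Z 0 @^-1` S) unoise R setT)%E.
    rewrite (integral_noise_patch Pr (unoise R) (Z 0 @^-1` S) (fun=> setT)).
    apply: eq_integral => w _ /=.
    by congr (unoise R _); apply/seteqP; split => v; rewrite /xsection /= inE => // -[].
  transitivity (\int[Pr]_(w in Z 0 @^-1` S) 1)%E.
    by apply: eq_integral => w _; exact: probability_setT.
  rewrite integral_cst ?mul1e//; last exact: (measurable_preim (mZ 0)).
  by case: chain => _ H _; exact: H.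
have spl : PU [set wv | S (Z 0 wv.1)] = (PU [set wv | S (Z 0 wv.1) /\ ~ ring wv] +
    PU [set wv | [/\ S (Z 0 wv.1), setT (Z L%:Z wv.1) & ring wv]])%E.
  rewrite -measureU.
  - congr (PU _); apply/seteqP; split => wv /=.
      by move=> Sw; have [r|r] := pselect (ring wv); [right|left].
    by move=> [[]|[]].
  - by apply: measurableI; [exact: mstart|exact: measurableC].
  - rewrite (_ : [set _ | _] = [set wv | S (Z 0 wv.1)] `&` ring).
      by apply: measurableI => //; exact: mstart.
    by apply/seteqP; split => wv /= [].
  - by apply/seteqP; split => wv //= [[_ nr] [_ _ r]].
move: spl; rewrite tot ring_prob// setTI => spl.
have pf : (pi S * (8^-1%:E * pi G))%E \is a fin_num by rewrite !fin_numM// piSG.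
move/(congr1 (fun x => x - (pi S * (8^-1%:E * pi G)))%E) : spl.
rewrite addeK// => <-; rewrite muleBr ?mule1// ?fin_num_adde_defr// ?fin_numM// ?piSG//.
Qed.

Lemma bell_law_true : (16^-1%:E <= bell_law [set z : bool * X | z.1])%E.
Proof.
have := ring_prob measurableT measurableT; rewrite setTI probability_setT mul1e => H.
rewrite /bell_law image_lawE.
rewrite [X in (_ <= PU X)%E](_ : _ = [set wv | [/\ setT (Z 0 wv.1), setT (Z L%:Z wv.1) & ring wv]]); last first.
  by apply/seteqP; split => wv; rewrite /zeta /bell /ring /= !path0 /path add0r; [|case].
rewrite H.
have : pi G \is a fin_num by rewrite ge0_fin_numE// probability_lty.
by move: piG => /[swap] /fineK <-; rewrite -EFinM !lee_fin; lra.
Qed.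

(** After a silence the recorded pair is always [(false, point)], so only the probability of silence
    enters. With the product form of the ringing part this makes the pair independent of the
    start. *)
Let bell_joint (S : set X) (C : set (bool * X)) : measurable S -> measurable C ->
  (PU [set wv | S (Z 0 wv.1) /\ C (zeta (path Z 0 wv.1, wv.2))] =
   pi S * (8^-1%:E * pi ([set x | C (true, x)] `&` G) +
     (if pselect (C (false, point)) then 1 - 8^-1%:E * pi G else 0)))%E.
Proof.
move=> mS mC; set B := [set x | C (true, x)].
have mB : measurable B.
  apply: (@measurable_preim _ _ X (bool * X)%type (fun x => (true, x))) => //.
  exact: measurable_fun_pair.
pose Q1 := [set wv | [/\ S (Z 0 wv.1), B (Z L%:Z wv.1) & ring wv]].
pose Q2 := [set wv | S (Z 0 wv.1) /\ ~ ring wv].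
have mQ1 : measurable Q1.
  rewrite (_ : Q1 = [set wv | S (Z 0 wv.1)] `&` ((fun wv => Z L%:Z wv.1) @^-1` B `&` ring)).
    apply: measurableI; first exact: mstart.
    apply: measurableI => //.
    exact: (measurable_preim (measurableT_comp (mZ L%:Z) measurable_fst) mB).
  by apply/seteqP; split => wv /=; [case|case=> ? []].
have mQ2 : measurable Q2 by apply: measurableI; [exact: mstart|exact: measurableC].
have zE wv : zeta (path Z 0 wv.1, wv.2) =
    if pselect (ring wv) then (true, Z L%:Z wv.1) else (false, point).
  rewrite /zeta /bell /= !path0 /path add0r.
  case: pselect => [r|/negP/negbTE r] /=.
    by rewrite (r : (wv.2 < h (Z 0 wv.1, Z L%:Z wv.1)) = true).
  by rewrite (r : (wv.2 < h (Z 0 wv.1, Z L%:Z wv.1)) = false).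
have ms : (0 <= pi S)%E by [].
have p1 : (0 <= 8^-1%:E * pi (B `&` G))%E by rewrite mule_ge0// lee_fin invr_ge0.
rewrite ge0_muleDr//; last first.
  case: ifP => // _; rewrite sube_ge0 ?fin_numM// ?ge0_fin_numE ?probability_lty//.
  have := @probability_le1 _ _ _ pi _ mG.
  have : pi G \is a fin_num by rewrite ge0_fin_numE// probability_lty.
  by move=> /fineK <-; rewrite -EFinM !lee_fin; lra.
rewrite -ring_prob//.
case: pselect => Cf.
  rewrite -(silence_prob mS) -(measureU _ mQ1 mQ2).
  - congr (PU _); apply/seteqP; split => wv /=; rewrite zE; case: pselect => r.
    + by move=> [Sw Cw]; left.
    + by move=> [Sw Cw]; right.
    + by move=> [[]|[]].
    + by move=> [[]|[]].
  - by apply/seteqP; split => wv //= [[_ _ r] [_ nr]].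
rewrite mule0 adde0; congr (PU _); apply/seteqP; split => wv /=; rewrite zE; case: pselect => r.
- by move=> [].
- by move=> [].
- by move=> [].
- by move=> [].
Qed.

Lemma bell_indep (F : X * (bool * X) -> \bar R) : measurable_fun setT F ->
  (forall z, 0 <= F z)%E ->
  (\int[Pr]_w \int[unoise R]_v F (Z 0 w, zeta (path Z 0 w, v)) =
   \int[Pr]_w \int[bell_law]_z F (Z 0 w, z))%E.
Proof.
move=> mF F0.
have mf1 : measurable_fun setT (fun wv : O * measurableTypeR R =>
    (Z 0 wv.1, zeta (path Z 0 wv.1, wv.2))).
  by apply: measurable_fun_pair => //; exact: (measurableT_comp (mZ 0) measurable_fst).
have mg1 : measurable_fun setT (fun wz : O * (bool * X) => (Z 0 wz.1, wz.2)).
  by apply: measurable_fun_pair => //; exact: (measurableT_comp (mZ 0) measurable_fst).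
have <- : (\int[PU]_wv F (Z 0 wv.1, zeta (path Z 0 wv.1, wv.2)) =
    \int[Pr]_w \int[unoise R]_v F (Z 0 w, zeta (path Z 0 w, v)))%E.
  by rewrite fubini_tonelli1//; exact: (measurableT_comp mF mf1).
have K := @noisy_law_ext R _ _ _ _ (O * measurableTypeR R)%type O (bool * X)%type _ _
  PU Pr bell_law _ _ (measurable_prod_measurableType X (bool * X)%type) _ _ mf1 mg1.
apply: (K _ _ _ F mF F0).
- by move=> _ _ [C mC [E mE <-]] [C' mC' [E' mE' <-]]; exists (C `&` C');
    [exact: measurableI|exists (E `&` E'); [exact: measurableI|rewrite setXI]].
- by exists setT => //; exists setT => //; rewrite setXTT.
move=> _ [S mS [C mC <-]].
rewrite [LHS](bell_joint mS mC).
transitivity (\int[Pr]_(w in Z 0 @^-1` S) bell_law C)%E; last first.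
  exact: (integral_noise_patch Pr bell_law (Z 0 @^-1` S) (fun=> C)).
rewrite integral_cst//; last exact: (measurable_preim (mZ 0)).
transitivity (bell_law C * pi S)%E; last first.
  have e : pi S = Pr (Z 0 @^-1` S) by case: chain => _ H _; symmetry; exact: H.
  exact: (congr1 (fun z => bell_law C * z)%E e).
rewrite muleC; congr (_ * _)%E.
transitivity (PU [set wv | setT (Z 0 wv.1) /\ C (zeta (path Z 0 wv.1, wv.2))]); last first.
  by rewrite /bell_law image_lawE; congr (PU _); apply/seteqP; split => wv //= [].
by rewrite (bell_joint measurableT mC) probability_setT mul1e.
Qed.

End with_density.

(** The order of drawing is reversed: instead of a path and then its bell, the bell pair is drawn
    from [theta] independently of the past, and [Psi] then draws the path given its start and that
    pair. This is what lets a second path reuse the bell. *)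
Lemma block_sampler : exists (zeta : seqspace X * measurableTypeR R -> bool * X)
    (theta : probability (bool * X)%type R)
    (Psi : (X * (bool * X)) * measurableTypeR R -> seqspace X),
  [/\ measurable_fun setT zeta, measurable_fun setT Psi,
    forall e e' v, e 0%N = e' 0%N -> e L = e' L -> zeta (e, v) = zeta (e', v),
    forall xz u, Psi (xz, u) 0%N = xz.1 /\ (xz.2.1 -> Psi (xz, u) L = xz.2.2) &
    (16^-1%:E <= theta [set z : bool * X | z.1])%E] /\
  forall t (F : seqspace X * ((bool * X) * seqspace X) -> \bar R),
    measurable_fun setT F -> (forall z, 0 <= F z)%E ->
    (\int[Pr]_w \int[unoise R]_v
       F (hist Z t w, (zeta (path Z t w, v), path Z t w)) =
     \int[Pr]_w \int[theta]_z \int[unoise R]_u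
       F (hist Z t w, (z, Psi ((Z t w, z), u))))%E.
Proof.
have [h [mh h01 hE]] := bell_density.
have mzeta := measurable_bell L mh.
pose zeta := bell h L.
pose theta := bell_law mh.
have [Xi [mXi XiE]] := path_sampler chain cX.
have mzp : measurable_fun setT
    (fun wv : O * measurableTypeR R => zeta (path Z 0 wv.1, wv.2)).
  apply: (measurableT_comp mzeta); apply: measurable_fun_pair => //.
  exact: (measurableT_comp (mpath 0) measurable_fst).
have mf0 : measurable_fun setT (fun wv : O * measurableTypeR R =>
    (Z 0 wv.1, zeta (path Z 0 wv.1, wv.2))).
  by apply: measurable_fun_pair => //; exact: (measurableT_comp (mZ 0) measurable_fst).
have [Phi [mPhi PhiE]] := sampler (Pr \x unoise R)%E (codable_seqspace cX) mf0
  (measurableT_comp (mpath 0) measurable_fst).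
pose Psi (a : (X * (bool * X)) * measurableTypeR R) : seqspace X :=
  override L a.1.1 a.1.2 (Phi a).
have mPsi : measurable_fun setT Psi.
  apply: measurable_override => //.
  - exact: (measurableT_comp measurable_fst measurable_fst).
  - exact: (measurableT_comp measurable_snd measurable_fst).
exists zeta, theta, Psi; split.
  split => //.
  - exact: bell_local.
  - move=> xz u; split; first by [].
    by move=> z1; rewrite /Psi /override /= z1 eqxx andbT /= (gtn_eqF L0).
  - exact: bell_law_true.
move=> t F mF F0.
(* [f] draws the path and then the bell, [g] the bell and then the path; [noise_transfer] reduces
   their comparison to time 0, given [Z 0] alone. *)
pose f (a : X * (measurableTypeR R * measurableTypeR R)) : (bool * X) * seqspace X :=
  (zeta (Xi (a.1, a.2.1), a.2.2), Xi (a.1, a.2.1)).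
pose g (a : X * ((bool * X) * measurableTypeR R)) : (bool * X) * seqspace X :=
  (a.2.1, Psi ((a.1, a.2.1), a.2.2)).
have mXi' : measurable_fun setT (fun a : X * (measurableTypeR R * measurableTypeR R) =>
    Xi (a.1, a.2.1)).
  apply: (measurableT_comp mXi); apply: measurable_fun_pair => //.
  exact: (measurableT_comp measurable_fst measurable_snd).
have mf : measurable_fun setT f.
  apply: measurable_fun_pair => //; apply: (measurableT_comp mzeta).
  apply: measurable_fun_pair => //.
  exact: (measurableT_comp measurable_snd measurable_snd).
have mg : measurable_fun setT g.
  apply: measurable_fun_pair.
    exact: (measurableT_comp measurable_fst measurable_snd).
  apply: (measurableT_comp mPsi); apply: measurable_fun_pair.
    apply: measurable_fun_pair => //.
    exact: (measurableT_comp measurable_fst measurable_snd).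
  exact: (measurableT_comp measurable_snd measurable_snd).
have flip s (F' : seqspace X * ((bool * X) * seqspace X) -> \bar R) :
    measurable_fun setT F' -> (forall z, 0 <= F' z)%E ->
    (\int[Pr]_w \int[unoise R]_v
       F' (hist Z s w, (zeta (path Z s w, v), path Z s w)) =
     \int[Pr]_w \int[(unoise R \x unoise R)%E]_a F' (hist Z s w, f (Z s w, a)))%E.
  move=> mF' F'0.
  have mk : measurable_fun setT (fun a : (seqspace X * seqspace X) * measurableTypeR R =>
      F' (a.1.1, (zeta (a.1.2, a.2), a.1.2))).
    apply: (measurableT_comp mF'); apply: measurable_fun_pair.
      exact: (measurableT_comp measurable_fst measurable_fst).
    apply: measurable_fun_pair; last exact: (measurableT_comp measurable_snd measurable_fst).
    apply: (measurableT_comp mzeta); apply: measurable_fun_pair => //.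
    exact: (measurableT_comp measurable_snd measurable_fst).
  rewrite (XiE s _ (measurable_integral_snd (unoise R) mk (fun=> F'0 _)))/=; last first.
    by move=> z; apply: integral_ge0.
  apply: eq_integral => w _.
  rewrite (fubini_tonelli1 (fun a => F' (hist Z s w, f (Z s w, a))))//.
  apply: (measurableT_comp mF'); apply: measurable_fun_pair => //.
  exact: (measurable_fun_pair2 (Z s w) mf).
rewrite flip//.
rewrite (@noise_transfer _ _ _ _ _ _ _ _ _ chain _ _ _ _ _ _
  (unoise R \x unoise R)%E (theta \x unoise R)%E f g mf mg _ t F mF F0).
  apply: eq_integral => w _.
  rewrite (fubini_tonelli1 (fun a => F (hist Z t w, g (Z t w, a))))//.
  apply: (measurableT_comp mF); apply: measurable_fun_pair => //.
  exact: (measurable_fun_pair2 (Z t w) mg).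
move=> {}F {}mF {}F0.
have mF1 : measurable_fun setT (fun a : seqspace X * ((bool * X) * seqspace X) =>
    F (a.1 0%N, a.2)).
  apply: (measurableT_comp mF); apply: measurable_fun_pair => //.
  exact: (measurableT_comp (measurable_coord 0) measurable_fst).
have := flip 0 _ mF1 (fun=> F0 _); rewrite /=.
under [X in _ = X -> _]eq_integral do under eq_integral do rewrite hist0.
move=> <-.
have mF2 : measurable_fun setT (fun a : (X * (bool * X)) * seqspace X =>
    F (a.1.1, (a.1.2, override L a.1.1 a.1.2 a.2))).
  have m1 : measurable_fun setT (fun a : (X * (bool * X)) * seqspace X => a.1.1).
    exact: (measurableT_comp measurable_fst measurable_fst).
  have m2 : measurable_fun setT (fun a : (X * (bool * X)) * seqspace X => a.1.2).
    exact: (measurableT_comp measurable_snd measurable_fst).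
  apply: (measurableT_comp mF); apply: measurable_fun_pair => //.
  by apply: measurable_fun_pair => //; exact: measurable_override.
have mF3 : measurable_fun setT (fun a : (X * (bool * X)) * measurableTypeR R =>
    F (a.1.1, (a.1.2, Psi a))).
  apply: (measurableT_comp mF); apply: measurable_fun_pair.
    exact: (measurableT_comp measurable_fst measurable_fst).
  apply: measurable_fun_pair => //.
  exact: (measurableT_comp measurable_snd measurable_fst).
transitivity (\int[Pr]_w \int[unoise R]_v \int[unoise R]_u
    F (Z 0 w, (zeta (path Z 0 w, v), Psi ((Z 0 w, zeta (path Z 0 w, v)), u))))%E.
  have mF4 : measurable_fun setT (fun wv : O * measurableTypeR R =>
      F (Z 0 wv.1, (zeta (path Z 0 wv.1, wv.2), path Z 0 wv.1))).
    apply: (measurableT_comp mF); apply: measurable_fun_pair.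
      exact: (measurableT_comp (mZ 0) measurable_fst).
    by apply: measurable_fun_pair => //; exact: (measurableT_comp (mpath 0) measurable_fst).
  under eq_integral do under eq_integral do rewrite hist0.
  rewrite -(fubini_tonelli1 (fun wv : O * measurableTypeR R =>
      F (Z 0 wv.1, (zeta (path Z 0 wv.1, wv.2), path Z 0 wv.1))))//.
  have := PhiE _ mF2 (fun=> F0 _); rewrite /=.
  (* The true path equals its overridden version, so overriding the sampled path does not alter the
     law. *)
  under eq_integral do rewrite -(path0 Z 0) override_bell.
  move=> ->.
  rewrite (fubini_tonelli1 (fun wv : O * measurableTypeR R => \int[unoise R]_u
    F (Z 0 wv.1, (zeta (path Z 0 wv.1, wv.2), Psi ((Z 0 wv.1, zeta (path Z 0 wv.1, wv.2)), u))))%E)//.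
    have := measurable_integral_snd (unoise R) mF3 (fun=> F0 _).
    by move=> /(_ _) H; exact: (measurableT_comp H mf0).
  by move=> wv; apply: integral_ge0.
have H := measurable_integral_snd (unoise R) mF3 (fun=> F0 _).
rewrite (bell_indep mh h01 hE H)/=; last by move=> z; apply: integral_ge0.
apply: eq_integral => w _.
rewrite (fubini_tonelli1 (fun a => F (Z 0 w, g (Z 0 w, a))))//.
apply: (measurableT_comp mF); apply: measurable_fun_pair => //.
exact: (measurable_fun_pair2 (Z 0 w) mg).
Qed.

End block_sampler.

(** The diagonal is cut out by countably many conditions on the digits of the codes, which separate
    points. *)
Lemma measurable_eq_codable d (X : measurableType d) : codable X ->
  measurable_fun setT (fun p : X * X => p.1 == p.2).
Proof.
move=> [s [r [ms mr sK]]].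
have mE : measurable [set p : X * X | p.1 == p.2].
  rewrite (_ : [set _ | _] = \bigcap_k \bigcup_n
      ([set p : X * X | s p.1 k = n] `&` [set p | s p.2 k = n])).
    apply: bigcap_measurableType => k _; apply: bigcupT_measurable => n.
    apply: measurableI.
      exact: (measurable_preim (measurable_comp_coord k (measurableT_comp ms measurable_fst))
        (I : measurable [set n])).
    exact: (measurable_preim (measurable_comp_coord k (measurableT_comp ms measurable_snd))
      (I : measurable [set n])).
  apply/seteqP; split => p /=.
    by move=> e k _; exists (s p.1 k) => //=; rewrite (eqP e).
  move=> H; apply/eqP; rewrite -(sK p.1) -(sK p.2); congr r.
  by apply/funext => k; have [n _ [-> ->]] := H k Logic.I.
by apply: (measurable_fun_bool true); rewrite setTI.
Qed.

(** * The coupling *)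

Section coupling_map.
Context (R : realType) d (X : measurableType d) (L : nat)
  (Xi : X * measurableTypeR R -> seqspace X)
  (tau : measurableTypeR R -> measurableTypeR R * measurableTypeR R)
  (zeta : seqspace X * measurableTypeR R -> bool * X)
  (Psi : (X * (bool * X)) * measurableTypeR R -> seqspace X).

(** Prefixes are encoded as sequences constant after [t], so that all of them live in the same
    space. *)
Definition freeze (t : nat) (e : seqspace X) : seqspace X := fun k => e (minn k t).

Definition shift (t : nat) (e : seqspace X) : seqspace X := fun k => e (t + k)%N.

(** The block is followed up to its end [L] and then frozen, so the result is constant from [t + L]
    on. *)
Definition glue (t : nat) (y b : seqspace X) : seqspace X :=
  fun k => if (k <= t)%N then y k else b (minn (k - t) L).

Definition first_step (x x1 : X) : seqspace X := fun k => if k == 0%N then x else x1.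

(** Once the paths agree at the start of a block the partner copies. Otherwise one half of the noise
    computes the bell of the first path and the other half draws the block of the partner. *)
Definition block (y : X) (e : seqspace X) (a : measurableTypeR R) : seqspace X :=
  if y == e 0%N then e else Psi ((y, zeta (e, (tau a).1)), (tau a).2).

Definition block_time (j : nat) : nat := (1 + L * j)%N.

(* The partner path up to block_time j (constant afterwards), together with the
   noise which is still unused at that time. *)
Fixpoint stage (j : nat) (ev : seqspace X * measurableTypeR R) :
    seqspace X * measurableTypeR R :=
  if j is i.+1 then
    let s := stage i ev in let t := block_time i in
    (glue t s.1 (block (s.1 t) (shift t ev.1) (tau s.2).1), (tau s.2).2)
  else (first_step (ev.1 0%N) (Xi (ev.1 0%N, (tau ev.2).1) 1%N), (tau ev.2).2).

(** The value at time [k] is read at stage [k], where it is already final because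
    [k <= block_time k]. *)
Definition partner (ev : seqspace X * measurableTypeR R) : seqspace X :=
  fun k => (stage k ev).1 k.

Lemma block_timeS j : block_time j.+1 = (block_time j + L)%N.
Proof. by rewrite /block_time; lia. Qed.

Lemma block_time_le i j : (i <= j)%N -> (block_time i <= block_time j)%N.
Proof. by rewrite /block_time; nia. Qed.

Hypothesis L0 : (0 < L)%N.

Lemma leq_block_time k : (k <= block_time k)%N.
Proof. by rewrite /block_time; nia. Qed.

Lemma stage_cst j ev k : (block_time j <= k)%N ->
  (stage j ev).1 k = (stage j ev).1 (block_time j).
Proof.
case: j => [|j] /=.
  by rewrite /block_time muln0; case: k.
rewrite block_timeS /glue => jk.
rewrite !ifN ?(minn_idPr _)//; lia.
Qed.

Lemma stage_stable i j ev k : (k <= block_time i)%N ->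
  (stage (i + j) ev).1 k = (stage i ev).1 k.
Proof.
move=> ki; elim: j => [|j IH]; first by rewrite addn0.
rewrite addnS /= {1}/glue ifT//.
by apply: leq_trans ki _; apply: block_time_le; exact: leq_addr.
Qed.

Lemma stage_partner j ev k : (k <= block_time j)%N -> (stage j ev).1 k = partner ev k.
Proof.
move=> kj; rewrite /partner -(stage_stable k ev kj).
by rewrite addnC stage_stable// leq_block_time.
Qed.

Lemma stageE j ev : (stage j ev).1 = freeze (block_time j) (partner ev).
Proof.
apply/funext => k; rewrite /freeze.
have [kj|jk] := leqP k (block_time j); first by rewrite stage_partner.
by rewrite stage_cst ?(ltnW jk)// stage_partner.
Qed.

Lemma partner1 ev : partner ev 1%N = Xi (ev.1 0%N, (tau ev.2).1) 1%N.
Proof. by rewrite /partner /= /glue /block_time muln0. Qed.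

Lemma partner_meet j ev k : partner ev (block_time j) = ev.1 (block_time j) ->
  (block_time j <= k)%N -> partner ev k = ev.1 k.
Proof.
move=> meet; have H i : forall k, (block_time j <= k <= block_time (j + i))%N ->
    partner ev k = ev.1 k.
  elim: i => [|i IH] {}k; first by rewrite addn0 -eqn_leq => /eqP <-.
  move=> /andP[jk]; rewrite addnS => kj.
  have [ki|ik] := leqP k (block_time (j + i)); first by apply: IH; rewrite jk.
  have e : partner ev (block_time (j + i)) = ev.1 (block_time (j + i)).
    by apply: IH; rewrite leqnn andbT block_time_le// leq_addr.
  rewrite -(stage_partner _ kj) /= /glue ifN -?ltnNge//.
  rewrite stage_partner// /block e /shift addn0 eqxx.
  by rewrite (minn_idPl _) ?subnKC//; move: kj; rewrite block_timeS; lia.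
move=> jk; apply: (H k); rewrite jk /=.
by apply: leq_trans (leq_block_time k) (block_time_le _); exact: leq_addl.
Qed.

Hypothesis zeta_local : forall e e' v, e 0%N = e' 0%N -> e L = e' L ->
  zeta (e, v) = zeta (e', v).

(** A block of the first path enters through its starting point, through its bell, which depends on
    its two endpoints, or by being copied; nothing beyond [block_time j] is consulted. *)
Lemma stage_ext j e e' v : (forall k, (k <= block_time j)%N -> e k = e' k) ->
  stage j (e, v) = stage j (e', v).
Proof.
elim: j => [|j IH] ee; first by rewrite /= ee.
have eej k : (k <= block_time j + L)%N -> e k = e' k.
  by move=> kj; apply: ee; rewrite block_timeS.
rewrite /= IH; last by move=> k kj; apply: eej; rewrite (leq_trans kj)// leq_addr.
congr pair; apply/funext => k; rewrite /glue; case: leqP => // _.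
rewrite /block /shift (eej (block_time j + 0)%N) ?leq_add2l//.
case: ifP => _; first by rewrite eej// leq_add2l geq_minr.
rewrite (@zeta_local _ (fun k => e' (block_time j + k)%N))// eej//.
by rewrite leq_add2l.
Qed.

Lemma stage_freeze j e v : stage j (freeze (block_time j) e, v) = stage j (e, v).
Proof. by apply: stage_ext => k kj; rewrite /freeze (minn_idPl kj). Qed.

Hypothesis mXi : measurable_fun setT Xi.
Hypothesis mtau : measurable_fun setT tau.
Hypothesis mzeta : measurable_fun setT zeta.
Hypothesis mPsi : measurable_fun setT Psi.
Hypothesis cX : codable X.

Lemma measurable_glue dT (T : measurableType dT) t (y b : T -> seqspace X) :
  measurable_fun setT y -> measurable_fun setT b ->
  measurable_fun setT (fun z => glue t (y z) (b z)).
Proof.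
move=> my mb; apply: measurable_seq => k; rewrite /glue.
by case: leqP => _; exact: measurable_comp_coord.
Qed.

Lemma measurable_freeze t : measurable_fun setT (freeze t).
Proof. exact: measurable_reindex. Qed.

Lemma measurable_shift t : measurable_fun setT (shift t).
Proof. exact: measurable_reindex. Qed.

Lemma measurable_first_step dT (T : measurableType dT) (x x1 : T -> X) :
  measurable_fun setT x -> measurable_fun setT x1 ->
  measurable_fun setT (fun z => first_step (x z) (x1 z)).
Proof. by move=> mx mx1; apply: measurable_seq => -[|k]. Qed.

Lemma measurable_if_eq dT (T : measurableType dT) (x x' : T -> X)
    dU (U : measurableType dU) (f g : T -> U) :
  measurable_fun setT x -> measurable_fun setT x' ->
  measurable_fun setT f -> measurable_fun setT g ->
  measurable_fun setT (fun z => if x z == x' z then f z else g z).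
Proof.
move=> mx mx' mf mg; apply: measurable_fun_ifT => //.
exact: (measurableT_comp (measurable_eq_codable cX) (measurable_fun_pair mx mx')).
Qed.

Lemma measurable_block dT (T : measurableType dT) (y : T -> X) (e : T -> seqspace X)
    (a : T -> measurableTypeR R) :
  measurable_fun setT y -> measurable_fun setT e -> measurable_fun setT a ->
  measurable_fun setT (fun z => block (y z) (e z) (a z)).
Proof.
move=> my me ma; have mt := measurableT_comp mtau ma.
apply: measurable_if_eq => //; first exact: measurable_comp_coord.
apply: (measurableT_comp mPsi); apply: measurable_fun_pair.
  apply: measurable_fun_pair => //; apply: (measurableT_comp mzeta).
  by apply: measurable_fun_pair => //; exact: (measurableT_comp measurable_fst mt).
exact: (measurableT_comp measurable_snd mt).
Qed.

Lemma measurable_stage j : measurable_fun setT (stage j).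
Proof.
have m1 := measurableT_comp measurable_fst mtau.
have m2 := measurableT_comp measurable_snd mtau.
elim: j => [|j IH] /=.
  apply: measurable_fun_pair; last exact: (measurableT_comp m2 measurable_snd).
  have me0 := measurable_comp_coord 0 (@measurable_fst _ _ (seqspace X) (measurableTypeR R)).
  apply: measurable_first_step => //.
  apply: (measurable_comp_coord (f := fun ev : seqspace X * measurableTypeR R =>
    Xi (ev.1 0%N, (tau ev.2).1))).
  apply: (measurableT_comp mXi); apply: measurable_fun_pair => //.
  exact: (measurableT_comp m1 measurable_snd).
have i1 := measurableT_comp measurable_fst IH.
have i2 := measurableT_comp measurable_snd IH.
apply: measurable_fun_pair; last exact: (measurableT_comp m2 i2).
apply: measurable_glue => //; apply: measurable_block.
- exact: (measurable_comp_coord (block_time j) i1).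
- exact: (measurableT_comp (measurable_shift _) measurable_fst).
- exact: (measurableT_comp m1 i2).
Qed.

Lemma measurable_partner : measurable_fun setT partner.
Proof.
apply: measurable_seq => k; apply: (measurable_comp_coord (f := fun ev => (stage k ev).1)).
exact: (measurableT_comp measurable_fst (measurable_stage k)).
Qed.

Hypothesis tauE : forall F : measurableTypeR R * measurableTypeR R -> \bar R,
  measurable_fun setT F -> (forall z, 0 <= F z)%E ->
  (\int[unoise R]_u F (tau u) = \int[unoise R]_a \int[unoise R]_b F (a, b))%E.

(** The noise left after stage [j] is again uniform and independent of the partner built so far,
    because each stage consumes the first half of a splitting and passes on the second. *)
Lemma stage_noise j e (F : seqspace X * measurableTypeR R -> \bar R) :
  measurable_fun setT F -> (forall z, 0 <= F z)%E ->
  (\int[unoise R]_v F (stage j (e, v)) =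
   \int[unoise R]_v \int[unoise R]_u F ((stage j (e, v)).1, u))%E.
Proof.
elim: j F => [|j IH] F mF F0 /=.
  pose y (a : measurableTypeR R) := first_step (e 0%N) (Xi (e 0%N, a) 1%N).
  have my : measurable_fun setT y.
    apply: measurable_first_step => //.
    exact: measurable_comp_coord (measurable_fun_pair2 (e 0%N) mXi).
  have mG : measurable_fun setT (fun ab : measurableTypeR R * measurableTypeR R =>
      F (y ab.1, ab.2)).
    apply: (measurableT_comp mF); apply: measurable_fun_pair => //.
    exact: (measurableT_comp my measurable_fst).
  rewrite (tauE mG (fun=> F0 _)).
  have mI := measurable_integral_snd (unoise R) mG (fun=> F0 _).
  rewrite [RHS](tauE (F := fun ab => \int[unoise R]_u F (y ab.1, u))%E).
  - apply: eq_integral => a _.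
    exact: esym (integral_probability_cst _ (\int[unoise R]_u F (y a, u))%E).
  - exact: (measurableT_comp mI measurable_fst).
  - by move=> z; exact: integral_ge0.
pose g (y : seqspace X) (a : measurableTypeR R) :=
  glue (block_time j) y (block (y (block_time j)) (shift (block_time j) e) a).
have mg : measurable_fun setT (fun ya : seqspace X * measurableTypeR R => g ya.1 ya.2).
  apply: measurable_glue => //; apply: measurable_block => //.
  exact: measurable_comp_coord.
pose H (s : seqspace X * measurableTypeR R) := F (g s.1 (tau s.2).1, (tau s.2).2).
have mH : measurable_fun setT H.
  have mt := measurableT_comp mtau (@measurable_snd _ _ (seqspace X) (measurableTypeR R)).
  apply: (measurableT_comp mF); apply: measurable_fun_pair.
    exact: (measurableT_comp mg (measurable_fun_pair measurable_fst
      (measurableT_comp measurable_fst mt))).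
  exact: (measurableT_comp measurable_snd mt).
rewrite (IH _ mH (fun=> F0 _)).
have mF' : measurable_fun setT (fun y : seqspace X => \int[unoise R]_u F (y, u))%E.
  exact: measurable_integral_snd.
pose H' (s : seqspace X * measurableTypeR R) := (\int[unoise R]_u F (g s.1 (tau s.2).1, u))%E.
have mH' : measurable_fun setT H'.
  have mt := measurableT_comp mtau (@measurable_snd _ _ (seqspace X) (measurableTypeR R)).
  exact: (measurableT_comp mF' (measurableT_comp mg (measurable_fun_pair measurable_fst
    (measurableT_comp measurable_fst mt)))).
rewrite [RHS](IH _ mH'); last by move=> z; exact: integral_ge0.
apply: eq_integral => v _.
set y := (stage j (e, v)).1.
have myg : measurable_fun setT (fun ab : measurableTypeR R * measurableTypeR R =>
    F (g y ab.1, ab.2)).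
  apply: (measurableT_comp mF); apply: measurable_fun_pair => //.
  exact: (measurableT_comp (measurable_fun_pair2 y mg) measurable_fst).
rewrite (tauE myg (fun=> F0 _)).
rewrite [RHS](tauE (F := fun ab => \int[unoise R]_u F (g y ab.1, u))%E).
- apply: eq_integral => a _.
  exact: esym (integral_probability_cst _ (\int[unoise R]_u F (g y a, u))%E).
- exact: (measurableT_comp (measurable_integral_snd (unoise R) myg (fun=> F0 _)) measurable_fst).
- by move=> z; exact: integral_ge0.
Qed.

End coupling_map.

Lemma ge0_integral_mono (R : realType) d (T : measurableType d)
    (mu : {measure set T -> \bar R}) (f g : T -> \bar R) :
  (forall t, 0 <= f t)%E -> (forall t, f t <= g t)%E ->
  (\int[mu]_t f t <= \int[mu]_t g t)%E.
Proof.
move=> f0 fg; have g0 t : (0 <= g t)%E by exact: le_trans (f0 t) (fg t).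
rewrite !ge0_integralTE//; apply: ereal_sup_le => _ [h hf <-].
by exists h => // t; exact: le_trans (hf t) (fg t).
Qed.

(** * Symmetry and separation of the coupled pair *)

Section coupled_law.
Context (R : realType) d (X : measurableType d) (P : R.-pker X ~> X)
  (pi : probability X R) dO (O : measurableType dO) (Pr : probability O R)
  (Z : int -> O -> X).
Hypothesis chain : stationary_markov_chain Pr P pi Z.
Hypothesis cX : codable X.
Context (L : nat)
  (Xi : X * measurableTypeR R -> seqspace X)
  (tau : measurableTypeR R -> measurableTypeR R * measurableTypeR R)
  (zeta : seqspace X * measurableTypeR R -> bool * X)
  (theta : probability (bool * X)%type R)
  (Psi : (X * (bool * X)) * measurableTypeR R -> seqspace X).
Hypothesis L0 : (0 < L)%N.
Hypothesis mXi : measurable_fun setT Xi.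
Hypothesis mtau : measurable_fun setT tau.
Hypothesis mzeta : measurable_fun setT zeta.
Hypothesis mPsi : measurable_fun setT Psi.
Hypothesis XiE : forall t (F : seqspace X * seqspace X -> \bar R),
  measurable_fun setT F -> (forall z, 0 <= F z)%E ->
  (\int[Pr]_w F (hist Z t w, path Z t w) =
   \int[Pr]_w \int[unoise R]_u F (hist Z t w, Xi (Z t w, u)))%E.
Hypothesis tauE : forall F : measurableTypeR R * measurableTypeR R -> \bar R,
  measurable_fun setT F -> (forall z, 0 <= F z)%E ->
  (\int[unoise R]_u F (tau u) = \int[unoise R]_a \int[unoise R]_b F (a, b))%E.
Hypothesis zeta_local : forall e e' v, e 0%N = e' 0%N -> e L = e' L ->
  zeta (e, v) = zeta (e', v).
Hypothesis Psi_ends : forall xz u,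
  Psi (xz, u) 0%N = xz.1 /\ (xz.2.1 -> Psi (xz, u) L = xz.2.2).
Hypothesis blockE : forall t (F : seqspace X * ((bool * X) * seqspace X) -> \bar R),
  measurable_fun setT F -> (forall z, 0 <= F z)%E ->
  (\int[Pr]_w \int[unoise R]_v
     F (hist Z t w, (zeta (path Z t w, v), path Z t w)) =
   \int[Pr]_w \int[theta]_z \int[unoise R]_u
     F (hist Z t w, (z, Psi ((Z t w, z), u))))%E.

Let mZ := measurable_chain chain.
Let mhist := measurable_hist chain.
Let mpath := measurable_path chain.

Local Notation N := (measurableTypeR R).
Local Notation S := (seqspace X).
Local Notation U := (unoise R).
Local Notation stage := (stage L Xi tau zeta Psi).
Local Notation partner := (partner L Xi tau zeta Psi).
Local Notation block_time := (block_time L).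

Let mstage j : measurable_fun setT (stage j) :=
  measurable_stage L mXi mtau mzeta mPsi cX j.

(* [steer b e z b'] is what a path at b does during a block, when the other path
   follows e, the bell outcome is z and the fresh noise is b'. *)
Definition steer (y : X) (e : S) (z : bool * X) (b : N) : S :=
  if y == e 0%N then e else Psi ((y, z), b).

Lemma measurable_steer dT (T : measurableType dT) (y : T -> X) (e : T -> S)
    (z : T -> bool * X) (b : T -> N) :
  measurable_fun setT y -> measurable_fun setT e -> measurable_fun setT z ->
  measurable_fun setT b ->
  measurable_fun setT (fun t => steer (y t) (e t) (z t) (b t)).
Proof.
move=> my me mz mb; apply: measurable_if_eq => //; first exact: (measurable_comp_coord 0 me).
apply: (measurableT_comp mPsi (measurable_fun_pair _ mb)).
exact: measurable_fun_pair.
Qed.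

Lemma block_steer (F : S -> \bar R) (y : X) (e : S) : measurable_fun setT F ->
  (forall b, 0 <= F b)%E ->
  (\int[U]_a F (block tau zeta Psi y e a) =
   \int[U]_v \int[U]_b F (steer y e (zeta (e, v)) b))%E.
Proof.
move=> mF F0.
apply: (tauE (F := fun ab => F (steer y e (zeta (e, ab.1)) ab.2))) => //.
apply: (measurableT_comp mF); apply: measurable_steer => //.
exact: (measurableT_comp (measurable_fun_pair2 e mzeta) measurable_fst).
Qed.

Lemma stage_step j (F : S -> \bar R) (e : S) : measurable_fun setT F ->
  (forall y, 0 <= F y)%E ->
  (\int[U]_v F (stage j.+1 (e, v)).1 =
   \int[U]_v \int[U]_a \int[U]_b F (glue L (block_time j) (stage j (e, v)).1
     (steer ((stage j (e, v)).1 (block_time j)) (shift (block_time j) e)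
        (zeta (shift (block_time j) e, a)) b)))%E.
Proof.
move=> mF F0; set t := block_time j.
pose g (y : S) (a : N) := glue L t y (block tau zeta Psi (y t) (shift t e) a).
have mg : measurable_fun setT (fun ya : S * N => g ya.1 ya.2).
  apply: measurable_glue => //; apply: measurable_block => //.
  exact: (measurable_comp_coord t measurable_fst).
have mt := measurableT_comp mtau (@measurable_snd _ _ S N).
have mH : measurable_fun setT (fun s : S * N => F (g s.1 (tau s.2).1)).
  exact: (measurableT_comp mF (measurableT_comp mg (measurable_fun_pair measurable_fst
    (measurableT_comp measurable_fst mt)))).
rewrite [LHS](stage_noise L mXi mtau mzeta mPsi cX tauE j e mH (fun=> F0 _)).
apply: eq_integral => v _; set y := (stage j (e, v)).1.
have mgy : measurable_fun setT (g y) by exact: (measurable_fun_pair2 y mg).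
transitivity (\int[U]_a F (g y a))%E.
  rewrite [LHS](tauE (F := fun ab => F (g y ab.1)))//.
    apply: eq_integral => a _.
    exact: (integral_probability_cst _ (F (g y a))).
  exact: (measurableT_comp mF (measurableT_comp mgy measurable_fst)).
apply: (@block_steer (fun b => F (glue L t y b))) => //.
have mgl : measurable_fun setT (glue L t y)
  by exact: (measurable_glue L t (T := S) (y := fun=> y) (b := id)).
exact: (measurableT_comp mF mgl).
Qed.

(* [block_average t F (h, (a, b))] averages F over the next block of the pair of
   paths which have followed a and b up to time t. *)
Definition block_average t (F : S * (S * S) -> \bar R) (q : S * (S * S)) : \bar R :=
  (\int[theta]_z \int[U]_u \int[U]_b
    let e := Psi ((q.2.1 t, z), u) in
    F (q.1, (glue L t q.2.1 e, glue L t q.2.2 (steer (q.2.2 t) e z b))))%E.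

Section block_average.
Variable t : nat.

Let next (r : S * (S * S)) (zub : (bool * X) * (N * N)) :=
  let e := Psi ((r.2.1 t, zub.1), zub.2.1) in
  (r.1, (glue L t r.2.1 e, glue L t r.2.2 (steer (r.2.2 t) e zub.1 zub.2.2))).

Let mnext dT (T : measurableType dT) (r : T -> S * (S * S)) (z : T -> bool * X)
    (u b : T -> N) :
  measurable_fun setT r -> measurable_fun setT z -> measurable_fun setT u ->
  measurable_fun setT b ->
  measurable_fun setT (fun x => next (r x) (z x, (u x, b x))).
Proof.
move=> mr mz mu mb.
have m1 := measurableT_comp measurable_fst mr.
have m2 := measurableT_comp measurable_snd mr.
have m21 := measurableT_comp measurable_fst m2.
have m22 := measurableT_comp measurable_snd m2.
have me : measurable_fun setT (fun x => Psi (((r x).2.1 t, z x), u x)).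
  apply: (measurableT_comp mPsi (measurable_fun_pair _ mu)).
  apply: measurable_fun_pair => //; exact: (measurable_comp_coord t m21).
apply: measurable_fun_pair => //; apply: measurable_fun_pair.
  exact: measurable_glue.
apply: measurable_glue => //; apply: measurable_steer => //.
exact: (measurable_comp_coord t m22).
Qed.

Lemma measurable_block_average F : measurable_fun setT F -> (forall q, 0 <= F q)%E ->
  measurable_fun setT (block_average t F).
Proof.
move=> mF F0.
have m3 : measurable_fun setT (fun x : ((S * (S * S)) * (bool * X)) * N * N =>
    F (next x.1.1.1 (x.1.1.2, (x.1.2, x.2)))).
  apply: (measurableT_comp mF); apply: mnext => //.
  - exact: (measurableT_comp measurable_fst (measurableT_comp measurable_fst measurable_fst)).
  - exact: (measurableT_comp measurable_snd (measurableT_comp measurable_fst measurable_fst)).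
  - exact: (measurableT_comp measurable_snd measurable_fst).
have m2 := measurable_integral_snd U m3 (fun=> F0 _).
have p2 x : (0 <= \int[U]_b F (next x.1.1 (x.1.2, (x.2, b))))%E by exact: integral_ge0.
have m1 := measurable_integral_snd U m2 p2.
apply: (measurable_integral_snd theta m1) => x.
by apply: integral_ge0 => u _; exact: p2.
Qed.

Lemma block_average_ge0 F q : (forall q, 0 <= F q)%E -> (0 <= block_average t F q)%E.
Proof. by move=> F0; do 3!apply: integral_ge0 => ? _. Qed.

(** If the paths agree, both follow the same block. Otherwise they are drawn, for the same [z], by
    the same [Psi] from the independent noises [u] and [b], and the swap is Fubini's theorem. *)
Lemma block_average_swap F h a b : measurable_fun setT F -> (forall q, 0 <= F q)%E ->
  block_average t F (h, (b, a)) =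
  block_average t (fun q => F (q.1, (q.2.2, q.2.1))) (h, (a, b)).
Proof.
move=> mF F0; apply: eq_integral => z _ /=; rewrite /steer.
(* The test inside [steer] looks at the start of the other block, which is the current position of
   the other path. *)
have P0 x u : Psi ((x, z), u) 0%N = x by case: (Psi_ends (x, z) u).
under eq_integral do under eq_integral do rewrite P0.
under [RHS]eq_integral do under eq_integral do rewrite P0.
have [->//|_] := eqVneq (a t) (b t).
apply: (@fubini_tonelli _ _ N N R U U (fun ub => F (h,
  (glue L t b (Psi ((b t, z), ub.1)), glue L t a (Psi ((a t, z), ub.2)))))) => //.
have mP x (f : N * N -> N) : measurable_fun setT f ->
    measurable_fun setT (fun ub => Psi ((x, z), f ub)).
  by move=> mf; exact: (measurableT_comp (measurable_fun_pair2 (x, z) mPsi) mf).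
apply: (measurableT_comp mF); apply: measurable_fun_pair => //.
apply: measurable_fun_pair; apply: measurable_glue => //; exact: mP.
Qed.

End block_average.

Definition stopped_pair t0 j (w : O) (v : N) : S * (S * S) :=
  (hist Z t0 w, (freeze (block_time j) (path Z t0 w), (stage j (path Z t0 w, v)).1)).

Lemma measurable_stopped_pair t0 j :
  measurable_fun setT (fun wv : O * N => stopped_pair t0 j wv.1 wv.2).
Proof.
have mp := measurableT_comp (mpath t0) (@measurable_fst _ _ O N).
apply: measurable_fun_pair; first exact: (measurableT_comp (mhist t0) measurable_fst).
apply: measurable_fun_pair; first exact: (measurableT_comp (measurable_freeze _) mp).
apply: (measurableT_comp measurable_fst); apply: (measurableT_comp (mstage j)).
exact: measurable_fun_pair.
Qed.

(* The past of the chain at time t0 + t contains its path on [t0, t0 + t]; hence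
   blockE, at that time, resamples the next block conditionally on that path. *)
Lemma step_average t0 j F : measurable_fun setT F -> (forall q, 0 <= F q)%E ->
  (\int[Pr]_w \int[U]_v F (stopped_pair t0 j.+1 w v) =
   \int[Pr]_w \int[U]_v block_average (block_time j) F (stopped_pair t0 j w v))%E.
Proof.
move=> mF F0; set t := block_time j; pose s := (t0 + t%:Z)%R.
(* Reversing the entries 0 to [t] of the history at [s] recovers the path since [t0], frozen at
   [t]. *)
pose unh (h : S) : S := fun k => h (t - k)%N.
have munh : measurable_fun setT unh by exact: measurable_reindex.
have pathE w : freeze t (path Z t0 w) = unh (hist Z s w).
  apply/funext => k; rewrite /freeze /unh /path /hist /s; congr (Z _ w).
  lia.
have histE w : hist Z t0 w = shift t (hist Z s w).
  by apply/funext => k; rewrite /shift /hist /s; congr (Z _ w); lia.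
have shiftE w : shift t (path Z t0 w) = path Z s w.
  by apply/funext => k; rewrite /shift /path /s; congr (Z _ w); lia.
have stE w v : stage j (path Z t0 w, v) = stage j (unh (hist Z s w), v).
  by rewrite -pathE; symmetry; exact: stage_freeze.
have glueE w : freeze (block_time j.+1) (path Z t0 w) =
    glue L t (unh (hist Z s w)) (path Z s w).
  rewrite -pathE -shiftE; apply/funext => k; rewrite /freeze /glue /shift block_timeS.
  by case: leqP => kt; congr (path Z t0 w _); rewrite -/t; lia.
pose K (hv : S * N) (ze : (bool * X) * S) (b : N) : \bar R :=
  let y := (stage j (unh hv.1, hv.2)).1 in
  F (shift t hv.1, (glue L t (unh hv.1) ze.2, glue L t y (steer (y t) ze.2 ze.1 b))).
have mK : measurable_fun setT (fun q : (S * N) * ((bool * X) * S) * N =>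
    K q.1.1 q.1.2 q.2).
  have mh : measurable_fun setT (fun q : (S * N) * ((bool * X) * S) * N => q.1.1.1).
    exact: (measurableT_comp measurable_fst (measurableT_comp measurable_fst measurable_fst)).
  have mv : measurable_fun setT (fun q : (S * N) * ((bool * X) * S) * N => q.1.1.2).
    exact: (measurableT_comp measurable_snd (measurableT_comp measurable_fst measurable_fst)).
  have mz : measurable_fun setT (fun q : (S * N) * ((bool * X) * S) * N => q.1.2.1).
    exact: (measurableT_comp measurable_fst (measurableT_comp measurable_snd measurable_fst)).
  have me : measurable_fun setT (fun q : (S * N) * ((bool * X) * S) * N => q.1.2.2).
    exact: (measurableT_comp measurable_snd (measurableT_comp measurable_snd measurable_fst)).
  have mu := measurableT_comp munh mh.
  have my := measurableT_comp measurable_fst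
    (measurableT_comp (mstage j) (measurable_fun_pair mu mv)).
  apply: (measurableT_comp mF); apply: measurable_fun_pair.
    exact: (measurableT_comp (measurable_shift t) mh).
  apply: measurable_fun_pair; first exact: measurable_glue.
  apply: measurable_glue => //; apply: measurable_steer => //.
  exact: (measurable_comp_coord t my).
have K0 hv ze b : (0 <= K hv ze b)%E by exact: F0.
have mK1 := measurable_integral_snd U mK (fun q => K0 q.1.1 q.1.2 q.2).
have K1 hv ze : (0 <= \int[U]_b K hv ze b)%E by exact: integral_ge0.
transitivity (\int[Pr]_w \int[U]_v \int[U]_a \int[U]_b
    K (hist Z s w, v) (zeta (path Z s w, a), path Z s w) b)%E.
  apply: eq_integral => w _.
  have mFw : measurable_fun setT (fun y => F (hist Z t0 w, (freeze (block_time j.+1) (path Z t0 w), y))).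
    by apply: (measurableT_comp mF); apply: measurable_fun_pair.
  rewrite [LHS](stage_step j (path Z t0 w) mFw (fun=> F0 _)).
  apply: eq_integral => v _; apply: eq_integral => a _; apply: eq_integral => b _.
  by rewrite /K /= stE shiftE -/t glueE histE.
have mG2 : measurable_fun setT (fun q : ((S * N) * S) * N =>
    \int[U]_b K q.1.1 (zeta (q.1.2, q.2), q.1.2) b)%E.
  have m1 : measurable_fun setT (fun q : ((S * N) * S) * N => q.1.1).
    exact: (measurableT_comp measurable_fst measurable_fst).
  have m2 : measurable_fun setT (fun q : ((S * N) * S) * N => q.1.2).
    exact: (measurableT_comp measurable_snd measurable_fst).
  have mz := measurableT_comp mzeta (measurable_fun_pair m2 (@measurable_snd _ _ _ N)).
  exact: (measurableT_comp mK1 (measurable_fun_pair m1 (measurable_fun_pair mz m2))).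
have mG2' := measurable_integral_snd U mG2 (fun q => K1 _ _).
have mhv := measurable_fun_pair (measurableT_comp (mhist s) measurable_fst)
  (@measurable_snd _ _ O N).
(* The noise [v] of the earlier stages is moved outside, because [blockE] concerns the chain alone
   and is applied with [v] fixed. *)
rewrite (@fubini_tonelli _ _ O N R Pr U (fun wv => \int[U]_a \int[U]_b
    K (hist Z s wv.1, wv.2) (zeta (path Z s wv.1, a), path Z s wv.1) b)%E); last 2 first.
- exact: (measurableT_comp mG2' (measurable_fun_pair mhv
    (measurableT_comp (mpath s) measurable_fst))).
- by move=> wv; apply: integral_ge0.
have mG3 : measurable_fun setT (fun q : ((S * N) * (bool * X)) * N =>
    \int[U]_b K q.1.1 (q.1.2, Psi ((q.1.1.1 0%N, q.1.2), q.2)) b)%E.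
  have m1 : measurable_fun setT (fun q : ((S * N) * (bool * X)) * N => q.1.1).
    exact: (measurableT_comp measurable_fst measurable_fst).
  have m2 : measurable_fun setT (fun q : ((S * N) * (bool * X)) * N => q.1.2).
    exact: (measurableT_comp measurable_snd measurable_fst).
  have m10 := measurable_comp_coord 0 (measurableT_comp measurable_fst m1).
  have mp := measurableT_comp mPsi
    (measurable_fun_pair (measurable_fun_pair m10 m2) (@measurable_snd _ _ _ N)).
  exact: (measurableT_comp mK1 (measurable_fun_pair m1 (measurable_fun_pair m2 mp))).
have mG3' := measurable_integral_snd theta
  (measurable_integral_snd U mG3 (fun q => K1 _ _))
  (fun q => integral_ge0 U (fun u _ => K1 _ _)).
transitivity (\int[U]_v \int[Pr]_w \int[theta]_z \int[U]_u \int[U]_b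
    K (hist Z s w, v) (z, Psi ((hist Z s w 0%N, z), u)) b)%E.
  apply: eq_integral => v _; under [RHS]eq_integral do rewrite hist0.
  apply: (@blockE s (fun q => \int[U]_b K (q.1, v) q.2 b)%E) => //.
  exact: (measurableT_comp mK1 (measurable_fun_pair (measurable_fun_pair
    (@measurable_fst _ _ S ((bool * X) * S)%type) (measurable_cst v)) measurable_snd)).
rewrite -(@fubini_tonelli _ _ O N R Pr U (fun wv => \int[theta]_z \int[U]_u \int[U]_b
    K (hist Z s wv.1, wv.2) (z, Psi ((hist Z s wv.1 0%N, z), u)) b)%E); last 2 first.
- exact: (measurableT_comp mG3' mhv).
- by move=> wv; do 2!apply: integral_ge0 => ? _.
apply: eq_integral => w _; apply: eq_integral => v _.
apply: eq_integral => z _; apply: eq_integral => u _; apply: eq_integral => b _.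
by rewrite /K /stopped_pair /= stE -/t pathE histE /unh subnn.
Qed.

Definition swap_pair (q : S * (S * S)) : S * (S * S) := (q.1, (q.2.2, q.2.1)).

Lemma measurable_swap_pair : measurable_fun setT swap_pair.
Proof.
apply: measurable_fun_pair => //; apply: measurable_fun_pair.
  exact: (measurableT_comp measurable_snd measurable_snd).
exact: (measurableT_comp measurable_fst measurable_snd).
Qed.

(** Given the history, the two first steps are independent draws from the same sampler [Xi]. *)
Lemma stopped_pair_sym0 t0 F : measurable_fun setT F -> (forall q, 0 <= F q)%E ->
  (\int[Pr]_w \int[U]_v F (stopped_pair t0 0 w v) =
   \int[Pr]_w \int[U]_v F (swap_pair (stopped_pair t0 0 w v)))%E.
Proof.
pose pr (h : S) (x y : X) : S * (S * S) :=
  (h, (first_step (h 0%N) x, first_step (h 0%N) y)).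
have mpr dT (T : measurableType dT) (h : T -> S) (x y : T -> X) :
    measurable_fun setT h -> measurable_fun setT x -> measurable_fun setT y ->
    measurable_fun setT (fun z => pr (h z) (x z) (y z)).
  move=> mh mx my; have mh0 := measurable_comp_coord 0 mh.
  by apply: measurable_fun_pair => //; apply: measurable_fun_pair;
    exact: measurable_first_step.
have mXi1 (T : measurableType _) (x : T -> X) (u : T -> N) : measurable_fun setT x ->
    measurable_fun setT u -> measurable_fun setT (fun z => Xi (x z, u z) 1%N).
  move=> mx mu; apply: (measurable_comp_coord (f := fun z => Xi (x z, u z))).
  exact: (measurableT_comp mXi (measurable_fun_pair mx mu)).
have H F' : measurable_fun setT F' -> (forall q, 0 <= F' q)%E ->
  (\int[Pr]_w \int[U]_v F' (stopped_pair t0 0 w v) = \int[Pr]_w \int[U]_u \int[U]_a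
    F' (pr (hist Z t0 w) (Xi (Z t0 w, u) 1%N) (Xi (Z t0 w, a) 1%N)))%E.
  clear F => mF F0; set F := F' in mF F0 *.
  have mK : measurable_fun setT (fun q : (S * S) * N =>
      F (pr q.1.1 (q.1.2 1%N) (Xi (q.1.1 0%N, q.2) 1%N))).
    have m1 : measurable_fun setT (fun q : (S * S) * N => q.1.1).
      exact: (measurableT_comp measurable_fst measurable_fst).
    have m2 : measurable_fun setT (fun q : (S * S) * N => q.1.2).
      exact: (measurableT_comp measurable_snd measurable_fst).
    apply: (measurableT_comp mF); apply: mpr => //.
      exact: (measurable_comp_coord 1 m2).
    by apply: mXi1 => //; exact: (measurable_comp_coord 0 m1).
  have mK' := measurable_integral_snd U mK (fun=> F0 _).
  have := XiE t0 mK' (fun q => integral_ge0 U (fun u _ => F0 _)).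
  rewrite /=; under eq_integral do under eq_integral do rewrite hist0.
  under [X in _ = X -> _]eq_integral do
    under eq_integral do under eq_integral do rewrite hist0.
  move=> <-; apply: eq_integral => w _.
  transitivity (\int[U]_a \int[U]_b
      F (pr (hist Z t0 w) (path Z t0 w 1%N) (Xi (Z t0 w, a) 1%N)))%E.
    rewrite -[RHS](tauE (F := fun ab =>
      F (pr (hist Z t0 w) (path Z t0 w 1%N) (Xi (Z t0 w, ab.1) 1%N)))) //.
      apply: eq_integral => v _; congr F; rewrite /stopped_pair /pr /= path0 hist0.
      congr (_, (_, _)); apply/funext => k; rewrite /freeze /first_step /block_time muln0.
      by case: k => [|k]; rewrite ?min0n ?path0// minnSS minn0.
    apply: (measurableT_comp mF); apply: mpr => //.
    by apply: mXi1 => //.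
  by apply: eq_integral => a _; exact: (integral_probability_cst _ (F (pr _ _ _))).
move=> mF F0.
have mFs := measurableT_comp mF measurable_swap_pair.
etransitivity; first exact: (H _ mF F0).
etransitivity; last exact: (esym (H _ mFs (fun q => F0 _))).
apply: eq_integral => w _.
apply: (@fubini_tonelli _ _ N N R U U (fun ua => F (pr (hist Z t0 w)
  (Xi (Z t0 w, ua.1) 1%N) (Xi (Z t0 w, ua.2) 1%N)))) => //.
by apply: (measurableT_comp mF); apply: mpr => //; exact: mXi1.
Qed.

Lemma stopped_pair_sym t0 j F : measurable_fun setT F -> (forall q, 0 <= F q)%E ->
  (\int[Pr]_w \int[U]_v F (stopped_pair t0 j w v) =
   \int[Pr]_w \int[U]_v F (swap_pair (stopped_pair t0 j w v)))%E.
Proof.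
elim: j F => [|j IH] F mF F0; first exact: stopped_pair_sym0.
have mFs := measurableT_comp mF measurable_swap_pair.
etransitivity; first exact: (step_average t0 j mF F0).
etransitivity; last exact: (esym (step_average t0 j mFs (fun q => F0 _))).
etransitivity.
  exact: (IH _ (measurable_block_average (block_time j) mF F0)
    (fun q => block_average_ge0 (block_time j) q F0)).
apply: eq_integral => w _; apply: eq_integral => v _.
exact: block_average_swap.
Qed.

Definition coupled_pair t0 (wv : O * N) : S * (S * S) :=
  (hist Z t0 wv.1, (path Z t0 wv.1, partner (path Z t0 wv.1, wv.2))).

Lemma measurable_coupled_pair t0 : measurable_fun setT (coupled_pair t0).
Proof.
have mp := measurableT_comp (mpath t0) (@measurable_fst _ _ O N).
apply: measurable_fun_pair; first exact: (measurableT_comp (mhist t0) measurable_fst).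
apply: measurable_fun_pair => //.
exact: (measurableT_comp (measurable_partner L mXi mtau mzeta mPsi cX)
  (measurable_fun_pair mp measurable_snd)).
Qed.

Let freeze_pair t (q : S * (S * S)) : S * (S * S) :=
  (q.1, (freeze t q.2.1, freeze t q.2.2)).

(** Only the two paths are frozen. The history is kept whole, so that the symmetry holds jointly
    with the past. *)
Let freeze_events : set (set (S * (S * S))) :=
  [set C | exists2 tC : nat * set (S * (S * S)),
     measurable tC.2 & C = freeze_pair tC.1 @^-1` tC.2].

Let measurable_freeze_pair t : measurable_fun setT (freeze_pair t).
Proof.
apply: measurable_fun_pair => //; apply: measurable_fun_pair.
- exact: (measurableT_comp (measurable_freeze t) (measurableT_comp measurable_fst measurable_snd)).
- exact: (measurableT_comp (measurable_freeze t) (measurableT_comp measurable_snd measurable_snd)).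
Qed.

Let measurable_freeze_events :
  (measurable : set (set (S * (S * S)))) = <<s freeze_events >>.
Proof.
apply/seteqP; split; last first.
  apply: smallest_sub; first exact: sigma_algebra_measurable.
  by move=> _ [[t C] mC ->]; exact: (measurable_preim (measurable_freeze_pair t)).
pose E := g_sigma_algebraType freeze_events.
have mq (g : S * (S * S) -> X) (t : nat) : measurable_fun setT g ->
    (forall q, g (freeze_pair t q) = g q) ->
    measurable_fun setT (g : E -> X).
  move=> mg gt _ A mA; rewrite setTI; apply: sub_sigma_algebra.
  exists (t, g @^-1` A); first exact: measurable_preim.
  by apply/seteqP; split => q /=; rewrite gt.
have m1 : measurable_fun setT (fun q : E => q.1).
  apply: measurable_seq => k; apply: (mq (fun q => q.1 k) 0%N) => //.
  exact: (measurable_comp_coord k measurable_fst).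
have m2 : measurable_fun setT (fun q : E => q.2.1).
  apply: measurable_seq => k; apply: (mq (fun q => q.2.1 k) k).
    exact: (measurable_comp_coord k (measurableT_comp measurable_fst measurable_snd)).
  by move=> q; rewrite /freeze_pair /freeze /= minnn.
have m3 : measurable_fun setT (fun q : E => q.2.2).
  apply: measurable_seq => k; apply: (mq (fun q => q.2.2 k) k).
    exact: (measurable_comp_coord k (measurableT_comp measurable_snd measurable_snd)).
  by move=> q; rewrite /freeze_pair /freeze /= minnn.
move=> C mC.
have := measurable_preim (measurable_fun_pair m1 (measurable_fun_pair m2 m3)) mC.
by rewrite (_ : _ @^-1` C = C)//; apply/seteqP; split => -[? []].
Qed.

Let freeze_events_setI : setI_closed freeze_events.
Proof.
have frz t t' q : (t <= t')%N -> freeze_pair t (freeze_pair t' q) = freeze_pair t q.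
  move=> tt; rewrite /freeze_pair /freeze /=.
  by congr (_, (_, _)); apply/funext => k; congr (_ : S); lia.
move=> _ _ [[t C] mC ->] [[t' C'] mC' ->].
exists (maxn t t', freeze_pair t @^-1` C `&` freeze_pair t' @^-1` C').
  by apply: measurableI; exact: (measurable_preim (measurable_freeze_pair _)).
by apply/seteqP; split => q /=; rewrite !frz// ?leq_maxl ?leq_maxr.
Qed.

(* Exchangeability is a statement about finitely many coordinates, so the
   symmetry of all stopped pairs suffices. *)
Lemma coupled_pair_sym t0 F : measurable_fun setT F -> (forall q, 0 <= F q)%E ->
  (\int[(Pr \x U)%E]_wv F (coupled_pair t0 wv) =
   \int[(Pr \x U)%E]_wv F (swap_pair (coupled_pair t0 wv)))%E.
Proof.
have mc := measurable_coupled_pair t0.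
have msc := measurableT_comp measurable_swap_pair mc.
apply: (@law_integral R _ _ _ _ _ _ (Pr \x U)%E (Pr \x U)%E _ _ mc msc).
have GT : freeze_events setT by exists (0%N, setT) => //; exact: measurableT.
apply: (law_ext measurable_freeze_events freeze_events_setI GT mc msc).
move=> _ [[t C] mC ->]; set C' := [set q | C (freeze_pair t q)].
have mC' : measurable C' by exact: (measurable_preim (measurable_freeze_pair t)).
have mI : measurable_fun setT (EFin \o \1_C' : S * (S * S) -> \bar R).
  by apply/measurable_EFinP; exact: measurable_indic.
have I0 q : (0 <= (EFin \o \1_C') q :> \bar R)%E by rewrite /= lee_fin.
have frz (q : S * (S * S)) j : (t <= j)%N -> freeze_pair t (freeze_pair j q) = freeze_pair t q.
  move=> tt; rewrite /freeze_pair /freeze /=.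
  by congr (_, (_, _)); apply/funext => k; congr (_ : S); lia.
have stE w v : stopped_pair t0 t w v = freeze_pair (block_time t) (coupled_pair t0 (w, v)).
  by rewrite /stopped_pair stageE.
have prE (g : O * N -> S * (S * S)) : measurable_fun setT g ->
    ((Pr \x U)%E (g @^-1` (freeze_pair t @^-1` C)) =
     \int[Pr]_w \int[U]_v (\1_C' (freeze_pair (block_time t) (g (w, v))))%:E)%E.
  move=> mg.
  rewrite -(fubini_tonelli1 (fun wv =>
    (\1_C' (freeze_pair (block_time t) (g wv)))%:E)).
  - transitivity (\int[(Pr \x U)%E]_wv (\1_(g @^-1` C') wv)%:E)%E.
      by rewrite integral_indic ?setIT//; exact: (measurable_preim mg).
    apply: eq_integral => wv _; rewrite !indicE; congr (_ _)%:R%:E.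
    by apply: asbool_equiv_eq => /=; rewrite /C' /= frz// leq_block_time.
  - exact: (measurableT_comp mI (measurableT_comp (measurable_freeze_pair _) mg)).
  - by move=> wv; rewrite lee_fin.
etransitivity; first exact: (prE _ mc).
etransitivity; last exact: (esym (prE _ msc)).
have := stopped_pair_sym t0 t mI I0.
under eq_integral do under eq_integral do rewrite stE.
move=> ->; apply: eq_integral => w _; apply: eq_integral => v _.
by rewrite stE.
Qed.

Lemma measurable_apart t (A : set S) : measurable A ->
  measurable [set q : S * (S * S) | A q.1 /\ q.2.1 t != q.2.2 t].
Proof.
move=> mA.
have m1 := measurable_comp_coord t
  (measurableT_comp measurable_fst (@measurable_snd _ _ S (S * S)%type)).
have m2 := measurable_comp_coord t
  (measurableT_comp measurable_snd (@measurable_snd _ _ S (S * S)%type)).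
have mne := measurableT_comp (measurable_eq_codable cX) (measurable_fun_pair m1 m2).
apply: measurableI; first exact: (measurable_preim measurable_fst mA).
have := measurable_preim mne (I : measurable [set false]).
rewrite (_ : _ @^-1` [set false] = [set q | q.2.1 t != q.2.2 t])//.
by apply/seteqP; split => q /=; [move=> ->|move/negbTE].
Qed.

Hypothesis theta_true : (16^-1%:E <= theta [set z : bool * X | z.1])%E.

(** To be apart at the end of a block the paths must be apart at its start and the bell silent,
    since a ring sends both to the same endpoint. Carrying along the event [A] of the past makes the
    bound conditional. *)
Lemma apart_tail t0 j (A : set S) : measurable A ->
  (\int[Pr]_w \int[U]_v (\1_[set q : S * (S * S) |
     A q.1 /\ q.2.1 (block_time j) != q.2.2 (block_time j)]
     (stopped_pair t0 j w v))%:E <=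
   ((1 - 16^-1) ^+ j)%:E * Pr (hist Z t0 @^-1` A))%E.
Proof.
move=> mA; pose apart j := [set q : S * (S * S) |
  A q.1 /\ q.2.1 (block_time j) != q.2.2 (block_time j)].
have mapart i : measurable (apart i) := measurable_apart (block_time i) mA.
have mI i : measurable_fun setT (EFin \o \1_(apart i) : S * (S * S) -> \bar R).
  by apply/measurable_EFinP; exact: measurable_indic.
have I0 i q : (0 <= (EFin \o \1_(apart i)) q :> \bar R)%E by rewrite /= lee_fin.
elim: j => [|j IH].
  rewrite expr0 mul1e; apply: (@le_trans _ _ (\int[Pr]_w \int[U]_v (\1_A (hist Z t0 w))%:E)%E).
    apply: ge0_integral_mono => w; first by apply: integral_ge0 => v _; exact: I0.
    apply: ge0_integral_mono => v; first exact: I0.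
    rewrite lee_fin !indicE ler_nat.
    case: (boolP (_ \in [set q | _])) => // /set_mem[Ah _].
    by rewrite mem_set.
  rewrite (_ : (\int[Pr]_w _)%E = \int[Pr]_w (\1_(hist Z t0 @^-1` A) w)%:E)%E.
    by rewrite integral_indic ?setIT//; exact: (measurable_preim (mhist t0)).
  by apply: eq_integral => w _; exact: (integral_probability_cst _ (\1_A (hist Z t0 w))%:E).
have st : (0 <= 1 - 16^-1 :> R) by lra.
(* [z] is drawn from [theta] whatever the positions of the paths, so silence costs the factor
   [1 - 1/16] for every [q]. *)
have avg q : (block_average (block_time j) (EFin \o \1_(apart j.+1)) q <=
    (1 - 16^-1)%:E * (\1_(apart j) q)%:E)%E.
  apply: (@le_trans _ _ (\int[theta]_z ((\1_[set z : bool * X | ~ z.1] z)%:E *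
      (\1_(apart j) q)%:E))%E).
    apply: ge0_integral_mono => z; first by do 2!apply: integral_ge0 => ? _; exact: I0.
    rewrite -[leRHS](integral_probability_cst U).
    apply: ge0_integral_mono => u; first by apply: integral_ge0 => ? _; exact: I0.
    rewrite -[leRHS](integral_probability_cst U).
    apply: ge0_integral_mono => b; first exact: I0.
    rewrite /= -EFinM lee_fin !indicE -natrM ler_nat mulnb.
    case: (boolP (_ \in apart j.+1)) => //= /set_mem[/= Aq].
    set e := Psi _; rewrite block_timeS.
    have gE y c : glue L (block_time j) y c (block_time j + L)%N = c L.
      by rewrite /glue addnC addnK minnn ifN// -ltnNge -[ltnLHS]add0n ltn_add2r.
    have eP x zz u' : Psi (x, zz, u') 0%N = x by case: (Psi_ends (x, zz) u').
    rewrite !gE /steer /e !eP; case: ifPn => [|ne]; first by rewrite eqxx.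
    move=> nL; rewrite lt0b; apply/andP; split; apply/mem_set.
      move=> z1; move: nL.
      have eL x u' : Psi (x, z, u') L = z.2 by case: (Psi_ends (x, z) u') => _; exact.
      by rewrite /e !eL eqxx.
    by split => //; rewrite eq_sym.
  have mT : measurable [set z : bool * X | z.1].
    exact: (measurable_preim measurable_fst (I : measurable [set true])).
  have mN : measurable [set z : bool * X | ~ z.1] by exact: measurableC.
  rewrite ge0_integralZr//; last first.
    by apply/measurable_EFinP; exact: measurable_indic.
  apply: lee_wpmul2r; first by rewrite lee_fin.
  rewrite integral_indic// setIT.
  apply: (@eq_ind_r _ _ (fun x => (x <= _)%E) _ _ (probability_setC theta mT)).
  by rewrite EFinB; exact: leeB.
rewrite exprS EFinM -muleA.
apply: (@le_trans _ _ ((1 - 16^-1)%:E * \int[Pr]_w \int[U]_v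
    (\1_(apart j) (stopped_pair t0 j w v))%:E)%E); last exact: lee_wpmul2l.
have msp := measurable_stopped_pair t0 j.
have mIs := measurableT_comp (mI j) msp.
etransitivity; first by rewrite (step_average t0 j (mI j.+1) (I0 j.+1)).
rewrite -(fubini_tonelli1 (fun wv : O * N => (\1_(apart j) (stopped_pair t0 j wv.1 wv.2))%:E))//.
rewrite -ge0_integralZl//.
rewrite fubini_tonelli1//; last 2 first.
- exact: (measurable_funeM _ mIs).
- by move=> wv; rewrite mule_ge0.
apply: ge0_integral_mono => w; first by apply: integral_ge0 => v _; exact: block_average_ge0.
apply: ge0_integral_mono => v; first exact: block_average_ge0.
exact: avg.
Qed.

End coupled_law.

(** * Rates and the arithmetic of blocks *)

Lemma geometric_small (R : realType) (C r eps : R) : 0 < r < 1 -> 0 < eps ->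
  exists2 m, (1 <= m)%N & C * r ^+ m <= eps.
Proof.
move=> /andP[r0 r1] e0.
have /cvgrPdist_le/(_ eps e0) [n _ H] : geometric C r x @[x --> \oo] --> (0 : R).
  by apply: cvg_geometric; rewrite gtr0_norm.
exists n.+1 => //; have := H n.+1 (leqnSn n); rewrite /= sub0r normrN.
exact: le_trans (ler_norm _).
Qed.

Lemma bernoulli_ineq (R : realDomainType) (x : R) n : 0 <= x <= 1 ->
  1 - x *+ n <= (1 - x) ^+ n.
Proof.
move=> /andP[x0 x1]; elim: n => [|n IH]; first by rewrite mulr0n subr0.
apply: (@le_trans _ _ ((1 - x) * (1 - x *+ n))).
  rewrite mulrS; have : 0 <= x * (x *+ n) by rewrite mulr_ge0 ?mulrn_wge0.
  nra.
by rewrite exprS ler_wpM2l// subr_ge0.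
Qed.

(* A geometric rate per block of length L, converted to a rate per unit time. *)
Lemma block_rate (R : realType) (L m : nat) : (0 < L)%N ->
  (1 - 16^-1 : R) ^+ (m.-1 %/ L) <= 2 * (1 - (16 * L%:R)^-1) ^+ m.
Proof.
(* [c] satisfies [c * L = 1/16], so that Bernoulli's inequality gives [(1 - c) ^+ L >= 15/16]. The
   factor 2 absorbs the passage from the power [j.+1] to [j]. *)
move=> L0; set c : R := (16 * L%:R)^-1; set j := (m.-1 %/ L)%N.
have L1 : 1 <= L%:R :> R by rewrite ler1n.
have c0 : 0 <= c by rewrite invr_ge0 mulr_ge0.
have cL : c *+ L = 16^-1 by rewrite /c -mulr_natr; field; rewrite pnatr_eq0 -lt0n.
have c1 : c <= 1.
  by rewrite (le_trans (ler_wpMn2l c0 L0 : c *+ 1 <= c *+ L))// cL; lra.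
have r1 : 1 - c <= 1 by rewrite gerBl.
have r0 : 0 <= 1 - c by rewrite subr_ge0.
have rL : 1 - 16^-1 <= (1 - c) ^+ L by rewrite -cL bernoulli_ineq// c0.
have h0 : 0 <= (1 - 16^-1 : R) by lra.
have : (1 - 16^-1 : R) ^+ j.+1 <= (1 - c) ^+ m.
  apply: le_trans (_ : (1 - c) ^+ (L * j.+1) <= _); first by rewrite exprM lerXn2r// nnegrE exprn_ge0.
  apply: ler_wiXn2l => //; have := ltn_ceil m.-1 L0; rewrite -/j; lia.
rewrite exprS; have : 0 <= (1 - 16^-1 : R) ^+ j by rewrite exprn_ge0.
set u := (_ ^+ j); set v := (_ ^+ m); lra.
Qed.

Lemma bblock_bounds L m : (0 < L)%N -> (1 <= m)%N -> (m <= bblock L m <= m + L - 1)%N.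
Proof.
case: m => // m L0 _; rewrite /bblock; have := divn_eq m L; have := ltn_pmod m L0.
by rewrite /dvdn; case: eqP => /= [->|]; set q := (m %/ L)%N; nia.
Qed.

Lemma bblock_time L m : (1 <= m)%N -> exists j, bblock L m = block_time L j.
Proof. by case: m => // m _; exists (m %/ L + ~~ (L %| m))%N. Qed.

Section block_coupling.
Context (R : realType) d (X : measurableType d) (P : R.-pker X ~> X)
  (pi : probability X R) dO (O : measurableType dO) (Pr : probability O R)
  (Z : int -> O -> X).
Hypothesis chain : stationary_markov_chain Pr P pi Z.
Hypothesis cX : codable X.
Context (m : nat).
Hypothesis m1 : (1 <= m)%N.
Hypothesis mixing : forall x B, measurable B -> (pi B <= kpow P m x B + 16^-1%:E)%E.

Local Notation N := (measurableTypeR R).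
Local Notation S := (seqspace X).
Local Notation U := (unoise R).
Local Notation L := (m + m)%N.

(** The interface of the construction: locality, agreement after meeting, symmetry and the
    separation bound are all that (i), (ii) and (iii) draw from the partner map [Y], besides its
    first two values. *)
Lemma block_coupling : exists (Xi : X * N -> S) (Y : S * N -> S),
  [/\ measurable_fun setT Xi, measurable_fun setT Y,
    forall t (F : S * S -> \bar R), measurable_fun setT F -> (forall z, 0 <= F z)%E ->
      (\int[Pr]_w F (hist Z t w, path Z t w) =
       \int[Pr]_w \int[U]_u F (hist Z t w, Xi (Z t w, u)))%E,
    forall e (F : X -> \bar R), measurable_fun setT F -> (forall x, 0 <= F x)%E ->
      (\int[U]_v F (Y (e, v) 1%N) = \int[U]_u F (Xi (e 0%N, u) 1%N))%E &
    forall ev, Y ev 0%N = ev.1 0%N] /\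
  [/\ forall j ev k, Y ev (block_time L j) = ev.1 (block_time L j) ->
        (block_time L j <= k)%N -> Y ev k = ev.1 k,
    forall j e v k, (k <= block_time L j)%N ->
      Y (freeze (block_time L j) e, v) k = Y (e, v) k,
    forall t (F : S * (S * S) -> \bar R), measurable_fun setT F ->
      (forall q, 0 <= F q)%E ->
      (\int[(Pr \x U)%E]_wv
         F (hist Z t wv.1, (path Z t wv.1, Y (path Z t wv.1, wv.2))) =
       \int[(Pr \x U)%E]_wv
         F (hist Z t wv.1, (Y (path Z t wv.1, wv.2), path Z t wv.1)))%E &
    forall t j (A : set S), measurable A ->
      ((Pr \x U)%E [set wv | A (hist Z t wv.1) /\ path Z t wv.1 (block_time L j) !=
         Y (path Z t wv.1, wv.2) (block_time L j)] <=
       ((1 - 16^-1) ^+ j)%:E * Pr (hist Z t @^-1` A))%E].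
Proof.
have L0 : (0 < L)%N by rewrite addn_gt0 m1.
have [K KE] := kpow_kernel P m.
have Ktv x B : measurable B -> (pi B <= K x B + 16^-1%:E)%E.
  by move=> mB; rewrite -KE//; exact: mixing.
have [G [mG piG minorized]] := doeblin_minorization chain KE Ktv.
have [zeta [theta [Psi [[mzeta mPsi zetaL PsiE thetaT] blockE]]]] :=
  block_sampler chain cX L0 mG piG minorized.
have [tau [mtau tauE]] := noise_splitting R.
have [Xi [mXi XiE]] := path_sampler chain cX.
pose Y := partner L Xi tau zeta Psi.
have mY : measurable_fun setT Y := measurable_partner L mXi mtau mzeta mPsi cX.
exists Xi, Y; split; split => //.
- move=> e F mF F0; under eq_integral do rewrite /Y partner1.
  have mF1 : measurable_fun setT (fun u => F (Xi (e 0%N, u) 1%N)).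
    exact: (measurableT_comp mF (measurable_comp_coord 1 (measurable_fun_pair2 (e 0%N) mXi))).
  rewrite (tauE (fun ab => F (Xi (e 0%N, ab.1) 1%N)))//.
    by apply: eq_integral => u _; exact: (integral_probability_cst _ (F (Xi (e 0%N, u) 1%N))).
  exact: (measurableT_comp mF1 measurable_fst).
- by move=> j ev k; exact: partner_meet.
- move=> j e v k kj; rewrite /Y -!(stage_partner Xi tau zeta Psi L0 _ kj).
  by rewrite (stage_freeze Xi tau Psi zetaL).
- move=> t F mF F0.
  have := coupled_pair_sym chain cX L0 mXi mtau mzeta mPsi XiE tauE zetaL PsiE blockE t mF F0.
  by rewrite /coupled_pair /swap_pair /=.
- move=> t j A mA.
  have mc := measurable_coupled_pair chain cX L mXi mtau mzeta mPsi t.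
  have := apart_tail chain cX L0 mXi mtau mzeta mPsi tauE zetaL PsiE blockE thetaT t j mA.
  apply: le_trans; rewrite le_eqVlt; apply/orP; left; apply/eqP.
  rewrite /= /product_measure1; apply: eq_integral => w _.
  transitivity (\int[U]_v (\1_(xsection [set wv : O * N | A (hist Z t wv.1) /\
      path Z t wv.1 (block_time L j) != Y (path Z t wv.1, wv.2) (block_time L j)] w) v)%:E)%E; last first.
    apply: eq_integral => v _; rewrite !indicE mem_xsection; congr (_ _)%:R%:E.
    apply/idP/idP => /set_mem/= H; apply/mem_set => /=; move: H;
      by rewrite stageE// /freeze minnn.
  rewrite integral_indic// ?setIT//; apply: measurable_xsection.
  exact: (measurable_preim mc (measurable_apart cX (block_time L j) mA)).
Qed.

End block_coupling.

(** * Conditional expectations *)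

Section sigma_gen_theory.
Context d (X : measurableType d) (I : Type).

Lemma sub_sigma_gen T (K : set I) (f : I -> T -> X) k A : K k -> measurable A ->
  sigma_gen K f (f k @^-1` A).
Proof.
move=> Kk mA; apply: sub_sigma_algebra; exists k => //.
by exists A => //; rewrite setTI.
Qed.

Lemma sigma_gen_smallest T (K : set I) (f : I -> T -> X) (G : set (set T)) :
  sigma_algebra setT G -> (forall k A, K k -> measurable A -> G (f k @^-1` A)) ->
  sigma_gen K f `<=` G.
Proof.
move=> sG H; apply: smallest_sub => // _ [k Kk [A mA <-]].
by rewrite setTI; exact: H.
Qed.

Lemma measurable_sigma_gen dT (T : measurableType dT) (K : set I) (f : I -> T -> X) :
  (forall k, K k -> measurable_fun setT (f k)) -> sigma_gen K f `<=` measurable.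
Proof.
move=> mf; apply: sigma_gen_smallest; first exact: sigma_algebra_measurable.
by move=> k A Kk mA; exact: measurable_preim (mf k Kk) mA.
Qed.

Lemma sigma_algebra_sigma_gen T (K : set I) (f : I -> T -> X) :
  sigma_algebra setT (sigma_gen K f).
Proof. exact: smallest_sigma_algebra. Qed.

End sigma_gen_theory.

Lemma submeas_measurable (T : pointedType) (G : set (set T)) d (E : measurableType d)
    (g : T -> E) : sigma_algebra setT G ->
  submeas G measurable g <-> measurable_fun setT (g : g_sigma_algebraType G -> E).
Proof.
move=> sG; have mG A : G A <-> measurable (A : set (g_sigma_algebraType G)).
  by rewrite /measurable /= (sigma_algebra_id sG).
split=> [gG _ A mA|mg A mA]; first by rewrite setTI; apply/mG; exact: gG.
by apply/mG; exact: measurable_preim.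
Qed.

Section cexp_theory.
Context (R : realType) d (T : measurableType d) (mu : probability T R)
  (G : set (set T)).
Hypothesis sG : sigma_algebra setT G.
Hypothesis mG : G `<=` measurable.

Lemma integrable_bounded (f : T -> R) : bounded_measurable f ->
  mu.-integrable setT (EFin \o f).
Proof.
move=> [mf [M fM]]; apply: measurable_bounded_integrable => //.
  by rewrite probability_lty.
exists M; split; first exact: num_real.
by move=> x Mx t _; exact: le_trans (fM t) (ltW Mx).
Qed.

Lemma is_cexp_bounded (f g : T -> R) : bounded_measurable f ->
  submeas G measurable g -> (exists M : R, forall t, `|g t| <= M) ->
  (forall A, G A -> \int[mu]_(w in A) (g w)%:E = \int[mu]_(w in A) (f w)%:E)%E ->
  is_cexp mu G f g.
Proof.
move=> bf gG bg fgA; split => //; apply: integrable_bounded => //.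
by split => // _ A mA; rewrite setTI; apply: mG; exact: gG.
Qed.

Lemma is_cexp_cst c : is_cexp mu G (fun=> c) (fun=> c).
Proof.
have bc : bounded_measurable (fun _ : T => c).
  by split; [exact: measurable_cst|exists `|c|].
split => //; try exact: integrable_bounded.
by apply/submeas_measurable => //; exact: measurable_cst.
Qed.

Lemma is_cexp_lin a (f1 g1 f2 g2 : T -> R) :
  is_cexp mu G f1 g1 -> is_cexp mu G f2 g2 ->
  is_cexp mu G (fun t => a * f1 t + f2 t) (fun t => a * g1 t + g2 t).
Proof.
move=> [f1i g1i g1G fg1] [f2i g2i g2G fg2].
have lin (h1 h2 : T -> R) : mu.-integrable setT (EFin \o h1) ->
    mu.-integrable setT (EFin \o h2) ->
    mu.-integrable setT (EFin \o (fun t => a * h1 t + h2 t)).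
  move=> i1 i2; rewrite (_ : _ \o _ = (fun t => a%:E * (EFin \o h1) t)%E \+ (EFin \o h2))%E.
    by apply: integrableD => //; exact: integrableZl.
  by apply/funext => t /=; rewrite EFinD EFinM.
split; [exact: lin|exact: lin| |].
- apply/submeas_measurable => //.
  apply: measurable_funD; last exact/submeas_measurable.
  by apply: measurable_funM; [exact: measurable_cst|exact/submeas_measurable].
move=> A GA; have mA := mG GA.
have linA (h1 h2 : T -> R) : mu.-integrable setT (EFin \o h1) ->
    mu.-integrable setT (EFin \o h2) ->
    (\int[mu]_(w in A) (a * h1 w + h2 w)%:E =
     a%:E * \int[mu]_(w in A) (h1 w)%:E + \int[mu]_(w in A) (h2 w)%:E)%E.
  move=> i1 i2.
  have iA h : mu.-integrable setT (EFin \o h) -> mu.-integrable A (EFin \o h).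
    exact: integrableS.
  under eq_integral do rewrite EFinD EFinM.
  rewrite integralD//; [|exact: integrableZl (iA _ i1)|exact: iA].
  by rewrite integralZl//; exact: iA.
by rewrite !linA// fg1// fg2.
Qed.

End cexp_theory.

(* An affine change of variable brings a bounded function into [0, 1]. *)
Lemma is_cexp_kerf (R : realType) d (T : measurableType d) (mu : probability T R)
    (G : set (set T)) dX (X : measurableType dX) (P : R.-pker X ~> X) (y x : T -> X) :
  sigma_algebra setT G -> G `<=` measurable ->
  (forall f : X -> R, measurable_fun setT f -> (forall z, 0 <= f z <= 1) ->
     is_cexp mu G (f \o y) (kerf P f \o x)) ->
  forall f : X -> R, bounded_measurable f -> is_cexp mu G (f \o y) (kerf P f \o x).
Proof.
move=> sG mG H f [mf [M fM]].
pose c := `|M| + 1; have c0 : 0 < c by rewrite ltr_wpDl.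
have fc z : `|f z| <= c by rewrite (le_trans (fM z))// (le_trans (ler_norm M))// lerDl.
pose f0 z := (2 * c)^-1 * (f z + c).
have mf0 : measurable_fun setT f0.
  by apply: measurable_funM => //; exact: measurable_funD.
have f01 z : 0 <= f0 z <= 1.
  have := fc z; rewrite ler_norml => /andP[f1 f2].
  rewrite /f0 mulr_ge0 ?invr_ge0 ?mulr_ge0 ?(ltW c0)//=; last lra.
  by rewrite ler_pdivrMl ?mulr_gt0// mulr1; lra.
have fE z : f z = 2 * c * f0 z + (- c).
  by rewrite /f0 mulrA mulfV ?mul1r ?addrK// mulf_neq0// gt_eqF.
have := is_cexp_lin sG mG (2 * c) (H _ mf0 f01) (is_cexp_cst mu sG (- c)).
congr is_cexp; apply/funext => t /=; first by rewrite -fE.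
have bf0 : bounded_measurable f0.
  by split => //; exists 1 => z; have /andP[? ?] := f01 z; rewrite ger0_norm.
have iP (g : X -> R) : bounded_measurable g -> (P (x t)).-integrable setT (EFin \o g).
  move=> [mg [B gB]]; apply: measurable_bounded_integrable => //.
    by rewrite prob_kernel ltry.
  exists B; split; first exact: num_real.
  by move=> r Br z _; exact: le_trans (gB z) (ltW Br).
have ic : (P (x t)).-integrable setT (EFin \o (fun=> - c)).
  by apply: iP; split; [exact: measurable_cst|exists `|- c|].
have i0 := iP _ bf0.
rewrite /kerf; under [RHS]eq_Rintegral do rewrite fE.
rewrite RintegralD//; last exact: (integrableZl measurableT (2 * c) i0).
rewrite (RintegralZl (2 * c) measurableT i0); congr (_ + _).
by rewrite /Rintegral integral_kernel_cst.
Qed.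

Lemma measurable_fst_sigma (R : realType) dO (O : measurableType dO) :
  forall A : set O, measurable A ->
  measurable [set wv : O * measurableTypeR R | A wv.1].
Proof. by move=> A mA; exact: (measurable_preim measurable_fst mA). Qed.

Lemma cyl_preimage d (X : measurableType d) dT (T : measurableType dT)
    (y : T -> bool -> nat -> X) :
  (forall r k, measurable_fun setT (fun t => y t r k)) ->
  forall B, @cyl _ X B -> measurable (y @^-1` B).
Proof.
move=> my B cB; rewrite -[X in measurable X]setTI.
move: B cB; apply: (@sigma_gen_smallest _ _ _ _ _ _ (image_set_system setT y measurable)).
  exact/sigma_algebra_image/sigma_algebra_measurable.
move=> [r k] A _ mA; rewrite /image_set_system /= setTI.
exact: (measurable_preim (my r k) mA).
Qed.

(** * Extension of the probability space by independent noise *)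

Section noise_extension.
Context (R : realType) dO (O : measurableType dO) (Pr : probability O R).

Local Notation N := (measurableTypeR R).
Local Notation U := (unoise R).
Local Notation PU := (Pr \x U)%E.

Lemma integral_fst_patch (A : set O) (F : O * N -> \bar R) : measurable A ->
  measurable_fun setT F -> (forall z, 0 <= F z)%E ->
  (\int[PU]_(wv in [set wv | A wv.1]) F wv = \int[Pr]_(w in A) \int[U]_v F (w, v))%E.
Proof.
move=> mA mF F0; rewrite integral_mkcond [RHS]integral_mkcond.
have mB := measurable_fst_sigma (R := R) mA.
rewrite fubini_tonelli1; last 2 first.
- exact/(measurable_restrictT _ mB)/measurable_funTS.
- exact: erestrict_ge0.
apply: eq_integral => w _; rewrite patchE /fubini_F.
case: ifPn => wA.
  by apply: eq_integral => v _; rewrite patchE ifT//; apply: mem_set; exact: set_mem wA.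
by apply: integral0_eq => v _; rewrite patchE ifN.
Qed.

Lemma prob_fst (A : set O) : measurable A -> PU [set wv | A wv.1] = Pr A.
Proof.
move=> mA; have := integral_fst_patch mA (measurable_cst 1%E) (fun=> lee01).
rewrite integral_cst ?mul1e => [->|]; last exact: measurable_fst_sigma.
transitivity (\int[Pr]_(w in A) (cst 1 w))%E.
  by apply: eq_integral => w _; exact: (integral_probability_cst U 1%E).
by rewrite integral_cst// mul1e.
Qed.

Lemma noise_extensionP : extension Pr PU fst.
Proof.
split; first exact: measurable_fst.
  by move=> w; exists (w, point).
by move=> A mA; exact: prob_fst.
Qed.

Lemma ae_fst (Q : O -> Prop) : {ae Pr, forall w, Q w} -> {ae PU, forall wv, Q wv.1}.
Proof.
move=> [B [mB B0 sB]]; exists [set wv | B wv.1]; split.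
- exact: measurable_fst_sigma.
- by rewrite -B0; exact: prob_fst.
- by move=> wv /= nQ; exact: sB.
Qed.

Lemma sigma_gen_fst d (X : measurableType d) (Z : int -> O -> X) (K : set int) A :
  sigma_gen K (fun k => Z k \o (fst : O * N -> O)) A ->
  exists2 B, sigma_gen K Z B & A = [set wv | B wv.1].
Proof.
move: A; apply: sigma_gen_smallest.
  split.
  - by exists set0 => //; case: (sigma_algebra_sigma_gen K Z).
  - move=> _ [B KB ->]; exists (~` B); last by rewrite setTD.
    by rewrite -setTD; case: (sigma_algebra_sigma_gen K Z) => _ + _; exact.
  - move=> F FK; have /choice[B HB] : forall n, exists B, sigma_gen K Z B /\ F n = [set wv | B wv.1].
      by move=> n; have [B KB ->] := FK n; exists B.
    exists (\bigcup_n B n).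
      case: (sigma_algebra_sigma_gen K Z) => _ _; apply => n; exact: (HB n).1.
    apply/seteqP; split => wv [n _ H]; exists n => //.
      by move: H; rewrite (HB n).2.
    by rewrite (HB n).2.
by move=> k A Kk mA; exists (Z k @^-1` A) => //; exact: sub_sigma_gen.
Qed.

Lemma sigma_gen_fst_preim d (X : measurableType d) (Z : int -> O -> X) (K : set int)
    (B : set O) : sigma_gen K Z B ->
  sigma_gen K (fun k => Z k \o (fst : O * N -> O)) [set wv | B wv.1].
Proof.
move: B; apply: (@sigma_gen_smallest _ _ _ _ _ _
  [set B | sigma_gen K (fun k => Z k \o (fst : O * N -> O)) [set wv | B wv.1]]).
  have [h0 hC hU] := sigma_algebra_sigma_gen K (fun k => Z k \o (fst : O * N -> O)).
  split => //=.
  - by move=> B KB; exact: hC KB.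
  - by move=> F FK; have := hU _ FK; rewrite -preimage_bigcup.
move=> k A Kk mA /=.
exact: (@sub_sigma_gen _ _ _ _ K (fun k => Z k \o (fst : O * N -> O)) _ _ Kk mA).
Qed.

End noise_extension.

(** * Exchangeability, Markov property, refreshment and meeting time *)

Section coupled_chain.
Context (R : realType) d (X : measurableType d) (P : R.-pker X ~> X)
  (pi : probability X R) dO (O : measurableType dO) (Pr : probability O R)
  (Z : int -> O -> X).
Hypothesis chain : stationary_markov_chain Pr P pi Z.
Hypothesis cX : codable X.

Local Notation N := (measurableTypeR R).
Local Notation S := (seqspace X).
Local Notation U := (unoise R).
Local Notation PU := (Pr \x U)%E.

Context (L : nat) (Xi : X * N -> S) (Y : S * N -> S).
Hypothesis mXi : measurable_fun setT Xi.
Hypothesis mY : measurable_fun setT Y.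
Hypothesis XiE : forall t (F : S * S -> \bar R),
  measurable_fun setT F -> (forall z, 0 <= F z)%E ->
  (\int[Pr]_w F (hist Z t w, path Z t w) =
   \int[Pr]_w \int[U]_u F (hist Z t w, Xi (Z t w, u)))%E.
Hypothesis Y1E : forall e (F : X -> \bar R), measurable_fun setT F ->
  (forall x, 0 <= F x)%E ->
  (\int[U]_v F (Y (e, v) 1%N) = \int[U]_u F (Xi (e 0%N, u) 1%N))%E.
Hypothesis Y0 : forall ev, Y ev 0%N = ev.1 0%N.
Hypothesis symm : forall t (F : S * (S * S) -> \bar R), measurable_fun setT F ->
  (forall q, 0 <= F q)%E ->
  (\int[PU]_wv F (hist Z t wv.1, (path Z t wv.1, Y (path Z t wv.1, wv.2))) =
   \int[PU]_wv F (hist Z t wv.1, (Y (path Z t wv.1, wv.2), path Z t wv.1)))%E.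

Context (t0 : int).

Let mZ := measurable_chain chain.
Let mhist := measurable_hist chain.
Let mpath := measurable_path chain.

Definition coupled (r : bool) (wv : O * N) : S :=
  if r then Y (path Z t0 wv.1, wv.2) else path Z t0 wv.1.

Lemma measurable_coupled r : measurable_fun setT (coupled r).
Proof.
have mp := measurableT_comp (mpath t0) (@measurable_fst _ _ O N).
by case: r => //; exact: (measurableT_comp mY (measurable_fun_pair mp measurable_snd)).
Qed.

Let Z' (k : int) (wv : O * N) : X := Z k wv.1.
Let past := sigma_gen [set j : int | j <= t0] Z'.

Let mZ' k : measurable_fun setT (Z' k).
Proof. exact: (measurableT_comp (mZ k) measurable_fst). Qed.

Let past_measurable : past `<=` measurable.
Proof. by apply: measurable_sigma_gen => k _. Qed.

Let pastE A : past A <->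
  exists2 B : set S, measurable B & A = [set wv | (hist Z t0 @^-1` B) wv.1].
Proof.
apply: (sigma_gen_preimage (h := fun wv : O * N => hist Z t0 wv.1)
  (i := fun k : nat => t0 - k%:Z)) => //.
  by move=> k /=; lia.
by move=> j /= jt; exists `|t0 - j|%N; lia.
Qed.

Lemma past_cexp (E : set (O * N)) (g : X -> R) : measurable E ->
  measurable_fun setT g -> (forall x, 0 <= g x <= 1) ->
  (forall A : set S, measurable A ->
     (PU ([set wv | (hist Z t0 @^-1` A) wv.1] `&` E) =
      \int[Pr]_(w in hist Z t0 @^-1` A) (g (Z t0 w))%:E)%E) ->
  is_cexp PU past \1_E (g \o Z' t0).
Proof.
move=> mE mg g01 H.
apply: is_cexp_bounded.
- exact: past_measurable.
- split; first exact: measurable_indic.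
  by exists 1 => w; rewrite ger0_norm// indicE; case: (_ \in _).
- move=> A mA.
  exact: (@sub_sigma_gen _ _ _ _ [set j : int | j <= t0] Z' t0 _ (lexx t0) (measurable_preim mg mA)).
- by exists 1 => w; have /andP[? ?] := g01 (Z' t0 w); rewrite ger0_norm.
move=> A pA; have /pastE[B mB ->] := pA.
have mhB := measurable_preim (mhist t0) mB.
have mfB := measurable_fst_sigma (R := R) mhB.
transitivity (\int[Pr]_(w in hist Z t0 @^-1` B) (g (Z t0 w))%:E)%E.
  rewrite (integral_fst_patch Pr (F := fun wv => (g (Z' t0 wv))%:E) mhB).
  - by apply: eq_integral => w _; exact: (integral_probability_cst U (g (Z t0 w))%:E).
  - by apply/measurable_EFinP; exact: (measurableT_comp mg (mZ' t0)).
  - by move=> wv; rewrite lee_fin; case/andP: (g01 (Z' t0 wv)).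
by rewrite -H// setIC; symmetry; exact: integral_indic.
Qed.

(** The path after [t0] may be redrawn from [Z t0] and fresh noise; averaging over this noise and
    over that of the partner gives [g]. Hence the conditional law of the pair depends on the past
    through [Z t0] only. *)
Lemma pair_cexp (B : set (S * S)) : measurable B ->
  exists g : X -> R, [/\ measurable_fun setT g, forall x, 0 <= g x <= 1 &
    forall A : set S, measurable A ->
     (PU ([set wv | (hist Z t0 @^-1` A) wv.1] `&`
        [set wv | B (coupled false wv, coupled true wv)]) =
      \int[Pr]_(w in hist Z t0 @^-1` A) (g (Z t0 w))%:E)%E].
Proof.
move=> mB.
have mI : measurable_fun setT (fun q : S * N => (\1_B (q.1, Y q))%:E : \bar R).
  by apply/measurable_EFinP; apply: measurableT_comp; [exact: measurable_indic|exact: measurable_fun_pair].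
have I0 q : (0 <= (\1_B (q.1, Y q))%:E :> \bar R)%E by rewrite lee_fin.
have mI2 := measurable_integral_snd U mI I0.
have I2 e : (0 <= \int[U]_v (\1_B (e, Y (e, v)))%:E)%E by exact: integral_ge0.
have mI3 := measurable_integral_snd U (measurableT_comp mI2 mXi) (fun=> I2 _).
pose G x := (\int[U]_u \int[U]_v (\1_B (Xi (x, u), Y (Xi (x, u), v)))%:E)%E.
have G0 x : (0 <= G x)%E by exact: integral_ge0.
have G1 x : (G x <= 1)%E.
  rewrite -[leRHS](integral_probability_cst U); apply: ge0_integral_mono => // u.
  rewrite -[leRHS](integral_probability_cst U); apply: ge0_integral_mono => // v.
  by rewrite lee_fin indicE; case: (_ \in _).
have Gf x : G x \is a fin_num by rewrite ge0_fin_numE// (le_lt_trans (G1 x)) ?ltry.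
exists (fine \o G); split.
- exact: (measurableT_comp (fine_measurable measurableT) mI3).
- by move=> x; rewrite -!lee_fin /= fineK// G0 G1.
move=> A mA; under eq_integral do rewrite /= fineK//.
have mhA := measurable_preim (mhist t0) mA.
have mE : measurable [set wv | B (coupled false wv, coupled true wv)].
  by apply: (measurable_preim (measurable_fun_pair (measurable_coupled false) (measurable_coupled true)) mB).
transitivity (\int[PU]_(wv in [set wv | (hist Z t0 @^-1` A) wv.1])
    (\1_[set wv | B (coupled false wv, coupled true wv)] wv)%:E)%E.
  by rewrite integral_indic 1?setIC//; exact: measurable_fst_sigma.
rewrite (integral_fst_patch Pr mhA); last 2 first.
- exact/measurable_EFinP/measurable_indic.
- by move=> wv; rewrite lee_fin.
rewrite [LHS]integral_mkcond [RHS]integral_mkcond.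
have mA' : measurable [set he : S * S | A he.1] by exact: (measurable_preim measurable_fst mA).
pose F := (fun he : S * S => \int[U]_v (\1_B (he.2, Y (he.2, v)))%:E)%E \_ [set he | A he.1].
have F0 he : (0 <= F he)%E by exact: erestrict_ge0.
have mF : measurable_fun setT F.
  apply/(measurable_restrictT _ mA')/measurable_funTS.
  exact: (measurableT_comp mI2 measurable_snd).
have memE w (e : S) : ((hist Z t0 w, e) \in [set he : S * S | A he.1]) =
    (w \in hist Z t0 @^-1` A).
  by apply/idP/idP => /set_mem Aw; exact: mem_set.
transitivity (\int[Pr]_w F (hist Z t0 w, path Z t0 w))%E.
  by apply: eq_integral => w _; rewrite /F !patchE memE.
rewrite XiE//; apply: eq_integral => w _; rewrite patchE /F.
case: ifPn => Aw; first by apply: eq_integral => u _; rewrite patchE memE ifT.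
by apply: integral0_eq => u _; rewrite patchE memE ifN.
Qed.

Lemma symm_prob (C : set (S * (S * S))) : measurable C ->
  PU [set wv | C (hist Z t0 wv.1, (coupled true wv, coupled false wv))] =
  PU [set wv | C (hist Z t0 wv.1, (coupled false wv, coupled true wv))].
Proof.
move=> mC.
have mh := measurableT_comp (mhist t0) (@measurable_fst _ _ O N).
have m1 := measurable_fun_pair mh
  (measurable_fun_pair (measurable_coupled true) (measurable_coupled false)).
have m2 := measurable_fun_pair mh
  (measurable_fun_pair (measurable_coupled false) (measurable_coupled true)).
have mI : measurable_fun setT (EFin \o \1_C : S * (S * S) -> \bar R).
  exact/measurable_EFinP/measurable_indic.
have I0 q : (0 <= (EFin \o \1_C) q :> \bar R)%E by rewrite lee_fin.
have H := symm t0 mI I0.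
have e1 := integral_indic PU measurableT (measurable_preim m1 mC).
have e2 := integral_indic PU measurableT (measurable_preim m2 mC).
rewrite setIT in e1; rewrite setIT in e2.
by etransitivity; first exact: esym e1; etransitivity; last exact: e2.
Qed.

Lemma coupled_exchangeable :
  cond_exchangeable PU past (fun r k wv => coupled r wv k).
Proof.
move=> B cB.
pose pp (q : S * S) : bool -> nat -> X := fun r k => (if r then q.2 else q.1) k.
have mB : measurable (pp @^-1` B).
  apply: cyl_preimage cB => -[] k.
    exact: (measurable_comp_coord k measurable_snd).
  exact: (measurable_comp_coord k measurable_fst).
have [g [mg g01 gE]] := pair_cexp mB.
have ppE wv : pp (coupled false wv, coupled true wv) =
    pair_path (fun r k wv => coupled r wv k) wv by apply/funext => -[].
have ppE' wv : pp (coupled true wv, coupled false wv) =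
    swap_path (fun r k wv => coupled r wv k) wv by apply/funext => -[].
have m1 := measurable_preim (measurable_fun_pair (measurable_coupled false)
  (measurable_coupled true)) mB.
have m2 := measurable_preim (measurable_fun_pair (measurable_coupled true)
  (measurable_coupled false)) mB.
exists (g \o Z' t0); split.
  rewrite (_ : _ @^-1` B = [set wv | (pp @^-1` B) (coupled false wv, coupled true wv)]).
    exact: past_cexp.
  by apply/seteqP; split => wv /=; rewrite ppE.
rewrite (_ : _ @^-1` B = [set wv | (pp @^-1` B) (coupled true wv, coupled false wv)]).
  (* The same [g] serves both orders, by the symmetry of the pair jointly with the history. *)
  apply: (past_cexp m2 mg g01) => A mA; etransitivity; last exact: (gE A mA).
  have mC : measurable [set q : S * (S * S) | A q.1 /\ (pp @^-1` B) q.2].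
    by apply: measurableI; [exact: (measurable_preim measurable_fst mA)|
      exact: (measurable_preim measurable_snd mB)].
  exact: symm_prob mC.
by apply/seteqP; split => wv /=; rewrite ppE'.
Qed.

(** A marginal of the symmetry: jointly with the history, the partner has the law of the original
    path and so inherits its Markov property. *)
Lemma symm_integral r (F : S * S -> \bar R) : measurable_fun setT F ->
  (forall q, 0 <= F q)%E ->
  (\int[PU]_wv F (hist Z t0 wv.1, coupled r wv) =
   \int[Pr]_w F (hist Z t0 w, path Z t0 w))%E.
Proof.
move=> mF F0.
have mh := measurableT_comp (mhist t0) (@measurable_fst _ _ O N).
have -> : (\int[Pr]_w F (hist Z t0 w, path Z t0 w) =
    \int[PU]_wv F (hist Z t0 wv.1, coupled false wv))%E.
  rewrite (fubini_tonelli1 (fun wv => F (hist Z t0 wv.1, coupled false wv)))//; last first.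
    exact: (measurableT_comp mF (measurable_fun_pair mh (measurable_coupled false))).
  apply: eq_integral => w _.
  exact: esym (integral_probability_cst U (F (hist Z t0 w, path Z t0 w))).
case: r => //; symmetry.
have mF' : measurable_fun setT (fun q : S * (S * S) => F (q.1, q.2.1)).
  apply: (measurableT_comp mF); apply: measurable_fun_pair => //.
  exact: (measurableT_comp measurable_fst measurable_snd).
exact: (symm t0 mF' (fun=> F0 _)).
Qed.

Lemma coupled_markov r :
  cond_markov_from PU past P (Z' t0) (fun k wv => coupled r wv k).
Proof.
split; first by move=> w; rewrite /coupled; case: r; rewrite ?Y0 /= path0.
move=> k; set G := <<s _>>.
have mk j : measurable_fun setT (fun wv => coupled r wv j).
  exact: (measurable_comp_coord j (measurable_coupled r)).
pose hc (wv : O * N) : S * S := (hist Z t0 wv.1, freeze k (coupled r wv)).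
have mG : G `<=` measurable.
  apply: smallest_sub; first exact: sigma_algebra_measurable.
  move=> A [/past_measurable//|]; apply: measurable_sigma_gen => j _; exact: mk.
pose hcG := [set A | exists2 A' : set (S * S), measurable A' & A = hc @^-1` A'].
have shc : sigma_algebra setT hcG.
  have := sigma_algebra_preimage setT hc (@sigma_algebra_measurable _ (S * S)%type).
  rewrite (_ : preimage_set_system _ _ _ = hcG)//.
  by apply/seteqP; split => A [A' mA' e]; exists A' => //; move: e; rewrite setTI.
have GE A : G A -> hcG A.
  move: A; apply: smallest_sub => // A [/pastE[B mB ->]|].
    by exists (fst @^-1` B) => //; exact: (measurable_preim measurable_fst mB).
  move: A; apply: sigma_gen_smallest => // j A /= jk mA.
  exists [set q | A (q.2 j)].
    exact: (measurable_preim (measurable_comp_coord j measurable_snd) mA).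
  by apply/seteqP; split => wv /=; rewrite /freeze (minn_idPl jk).
apply: is_cexp_kerf => //; first exact: smallest_sigma_algebra.
move=> f mf f01; have mkf := measurable_kerf P mf f01.
apply: is_cexp_bounded => //.
- split; first exact: (measurableT_comp mf (mk k.+1)).
  by exists 1 => w /=; have /andP[? ?] := f01 (coupled r w k.+1); rewrite ger0_norm.
- move=> A mA; apply: sub_sigma_algebra; right.
  exact: (@sub_sigma_gen _ _ _ _ [set j : nat | (j <= k)%N]
    (fun k wv => coupled r wv k) k _ (leqnn k) (measurable_preim mkf mA)).
- exists 1 => w /=; have /andP[? ?] := kerf_bounds P mf f01 (coupled r w k).
  by rewrite ger0_norm.
move=> A GA; have [A' mA' AE] := GE _ GA.
pose s := (t0 + k%:Z)%R.
(* For the original path the conditioning event concerns the history at [s = t0 + k]: its entries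
   from index [k] on are the history at [t0], and its first entries, reversed, are the path up to
   [k]. *)
pose A'' := [set h : S | A' ((fun i => h (k + i)%N), (fun i => h (k - i)%N))].
have mA'' : measurable A''.
  have m1 := @measurable_reindex _ X (fun i => (k + i)%N).
  have m2 := @measurable_reindex _ X (fun i => (k - i)%N).
  exact: (measurable_preim (measurable_fun_pair m1 m2) mA').
have AsE w : A'' (hist Z s w) <-> A' (hist Z t0 w, freeze k (path Z t0 w)).
  rewrite /A'' /=; have -> : (fun i => hist Z s w (k + i)%N) = hist Z t0 w.
    by apply/funext => i; rewrite /hist /s; congr (Z _ w); lia.
  have -> // : (fun i => hist Z s w (k - i)%N) = freeze k (path Z t0 w).
  by apply/funext => i; rewrite /hist /freeze /path /s; congr (Z _ w); lia.
have mcut : measurable [set q : S * S | A' (q.1, freeze k q.2)].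
  apply: (measurable_preim _ mA'); apply: measurable_fun_pair => //.
  exact: (measurableT_comp (measurable_freeze k) measurable_snd).
have red (phi : X -> R) i : measurable_fun setT phi -> (forall x, 0 <= phi x <= 1) ->
    (\int[PU]_(wv in A) (phi (coupled r wv i))%:E =
     \int[Pr]_(w in hist Z s @^-1` A'') (phi (Z (t0 + i%:Z) w))%:E)%E.
  move=> mphi phi01.
  rewrite [LHS]integral_mkcond [RHS]integral_mkcond.
  pose F := (fun q : S * S => (phi (q.2 i))%:E) \_ [set q | A' (q.1, freeze k q.2)].
  have F0 q : (0 <= F q)%E.
    by apply: erestrict_ge0 => z _; rewrite lee_fin; case/andP: (phi01 (z.2 i)).
  have mF : measurable_fun setT F.
    apply/(measurable_restrictT _ mcut)/measurable_funTS/measurable_EFinP.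
    exact: (measurableT_comp mphi (measurable_comp_coord i measurable_snd)).
  transitivity (\int[PU]_wv F (hist Z t0 wv.1, coupled r wv))%E.
    by apply: eq_integral => wv _; rewrite /F !patchE AE.
  rewrite symm_integral//; apply: eq_integral => w _; rewrite /F !patchE /=.
  have -> : ((hist Z t0 w, path Z t0 w) \in [set q : S * S | A' (q.1, freeze k q.2)]) =
      (w \in hist Z s @^-1` A'').
    by apply/idP/idP => /set_mem H; apply/mem_set; apply/AsE.
  by [].
rewrite (red (kerf P f) k mkf (kerf_bounds P mf f01)).
etransitivity; last exact: (esym (red f k.+1 mf f01)).
have := markov_step chain s mA'' mf f01.
rewrite (_ : s + 1 = t0 + k.+1%:Z)%R; last by rewrite /s; lia.
by move=> ->.
Qed.

Let calX := sigma_gen setT Z'.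

(** Integrals over sets of starting points agree by [XiE] and the Markov property, and comparing
    them in both directions gives equality [pi]-almost everywhere. *)
Lemma sampled_transition (f : X -> R) : measurable_fun setT f -> (forall x, 0 <= f x <= 1) ->
  {ae pi, forall x, (\int[U]_u (f (Xi (x, u) 1%N))%:E)%E = (kerf P f x)%:E}.
Proof.
move=> mf f01.
have f0 x : (0 <= (f x)%:E)%E by rewrite lee_fin; case/andP: (f01 x).
have f1 x : ((f x)%:E <= 1)%E by rewrite lee_fin; case/andP: (f01 x).
have k01 := kerf_bounds P mf f01.
have k0 x : (0 <= (kerf P f x)%:E)%E by rewrite lee_fin; case/andP: (k01 x).
have mk : measurable_fun setT (fun x => (kerf P f x)%:E).
  by apply/measurable_EFinP; exact: measurable_kerf.
pose phi x := (\int[U]_u (f (Xi (x, u) 1%N))%:E)%E.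
have phi0 x : (0 <= phi x)%E by exact: integral_ge0.
have mfX : measurable_fun setT (fun xu => (f (Xi xu 1%N))%:E).
  by apply/measurable_EFinP; exact: (measurableT_comp mf (measurable_comp_coord 1 mXi)).
have mphi : measurable_fun setT phi.
  exact: (measurable_integral_snd U mfX (fun=> f0 _)).
have eqS B : measurable B ->
    (\int[pi]_(x in B) phi x = \int[pi]_(x in B) (kerf P f x)%:E)%E.
  move=> mB; pose A := [set h : S | B (h 0%N)].
  have mA : measurable A by exact: (measurable_preim (measurable_coord 0) mB).
  have AE : hist Z t0 @^-1` A = Z t0 @^-1` B.
    by apply/seteqP; split => w; rewrite /A /= hist0.
  rewrite -(integral_chain chain t0 mB mphi phi0) -(integral_chain chain t0 mB mk k0).
  rewrite -AE -(markov_step chain t0 mA mf f01) integral_mkcond [RHS]integral_mkcond.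
  pose F := (fun q : S * S => (f (q.2 1%N))%:E) \_ [set q | A q.1].
  have F0 q : (0 <= F q)%E by exact: erestrict_ge0.
  have mF : measurable_fun setT F.
    apply/(measurable_restrictT _ (measurable_preim measurable_fst mA))/measurable_funTS.
    apply/measurable_EFinP.
    exact: (measurableT_comp mf (measurable_comp_coord 1 measurable_snd)).
  have memE w (e : S) : ((hist Z t0 w, e) \in [set q : S * S | A q.1]) =
      (w \in hist Z t0 @^-1` A).
    by apply/idP/idP => /set_mem Aw; exact: mem_set.
  transitivity (\int[Pr]_w F (hist Z t0 w, path Z t0 w))%E.
    rewrite XiE//; apply: eq_integral => w _; rewrite patchE /F.
    case: ifPn => Aw; first by apply: eq_integral => u _; rewrite patchE memE ifT.
    by symmetry; apply: integral0_eq => u _; rewrite patchE memE ifN.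
  by apply: eq_integral => w _; rewrite /F !patchE memE.
have ltoo (g : X -> \bar R) : (forall x, 0 <= g x)%E -> (forall x, g x <= 1)%E ->
    (\int[pi]_x g x < +oo)%E.
  move=> g0 g1; apply: (@le_lt_trans _ _ (\int[pi]_x 1)%E).
    exact: ge0_integral_mono.
  by rewrite integral_probability_cst ltry.
have phi1 x : (phi x <= 1)%E.
  by rewrite -[leRHS](integral_probability_cst U); exact: ge0_integral_mono.
have k1 x : ((kerf P f x)%:E <= 1)%E by rewrite lee_fin; case/andP: (k01 x).
have le1 : {ae pi, forall x, (phi x <= (kerf P f x)%:E)%E}.
  by apply: ae_le_integral => //; [exact: ltoo|move=> A mA; rewrite eqS].
have le2 : {ae pi, forall x, ((kerf P f x)%:E <= phi x)%E}.
  by apply: ae_le_integral => //; [exact: ltoo|move=> A mA; rewrite eqS].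
by apply: filterS2 le1 le2 => x a b; apply/eqP; rewrite eq_le a b.
Qed.

(** The first step of the partner uses noise independent of the whole chain, so given [calX] it
    depends on [Z t0] only. *)
Lemma coupled_refresh (f : X -> R) : bounded_measurable f ->
  is_cexp PU calX (f \o (fun wv => coupled true wv 1%N)) (kerf P f \o Z' t0).
Proof.
have mcX : calX `<=` measurable by apply: measurable_sigma_gen => k _.
apply: is_cexp_kerf => //; first exact: sigma_algebra_sigma_gen.
move=> {}f mf f01; have mkf := measurable_kerf P mf f01.
have f0 x : (0 <= (f x)%:E)%E by rewrite lee_fin; case/andP: (f01 x).
have k0 x : (0 <= (kerf P f x)%:E)%E by rewrite lee_fin; case/andP: (kerf_bounds P mf f01 x).
have mc1 := measurable_comp_coord 1 (measurable_coupled true).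
apply: is_cexp_bounded => //.
- split; first exact: (measurableT_comp mf mc1).
  by exists 1 => w /=; have /andP[? ?] := f01 (coupled true w 1%N); rewrite ger0_norm.
- move=> A mA; exact: (@sub_sigma_gen _ _ _ _ setT Z' t0 _ I (measurable_preim mkf mA)).
- exists 1 => w /=; have /andP[? ?] := kerf_bounds P mf f01 (Z' t0 w).
  by rewrite ger0_norm.
move=> A /sigma_gen_fst[B BX ->].
have mB : measurable B.
  by apply: measurable_sigma_gen BX => k _; exact: mZ.
have m1 : measurable_fun setT (fun wv => (f (coupled true wv 1%N))%:E).
  by apply/measurable_EFinP; exact: (measurableT_comp mf mc1).
have m2 : measurable_fun setT (fun wv => (kerf P f (Z' t0 wv))%:E).
  by apply/measurable_EFinP; exact: (measurableT_comp mkf (mZ' t0)).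
rewrite (integral_fst_patch Pr mB m1)// (integral_fst_patch Pr mB m2)//.
have mfE : measurable_fun setT (EFin \o f) by exact/measurable_EFinP.
have mfX : measurable_fun setT (fun xu => (f (Xi xu 1%N))%:E).
  by apply/measurable_EFinP; exact: (measurableT_comp mf (measurable_comp_coord 1 mXi)).
transitivity (\int[Pr]_(w in B) (kerf P f (Z t0 w))%:E)%E.
  by apply: eq_integral => w _; exact: (integral_probability_cst U (kerf P f (Z t0 w))%:E).
transitivity (\int[Pr]_(w in B) \int[U]_u (f (Xi (Z t0 w, u) 1%N))%:E)%E; last first.
  apply: eq_integral => w _; have := Y1E (path Z t0 w) mfE f0.
  by rewrite path0 => ->.
apply: ae_eq_integral => //.
- by apply: measurable_funTS; apply/measurable_EFinP; exact: (measurableT_comp mkf (mZ t0)).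
- apply: measurable_funTS.
  exact: (measurableT_comp (measurable_integral_snd U mfX (fun=> f0 _)) (mZ t0)).
- have := chain_ae chain t0 (sampled_transition mf f01).
  by apply: filterS => w /= -> _.
Qed.

Hypothesis meet : forall j ev k, Y ev (block_time L j) = ev.1 (block_time L j) ->
  (block_time L j <= k)%N -> Y ev k = ev.1 k.
Hypothesis tail : forall t j (A : set S), measurable A ->
  (PU [set wv | A (hist Z t wv.1) /\ path Z t wv.1 (block_time L j) !=
     Y (path Z t wv.1, wv.2) (block_time L j)] <=
   ((1 - 16^-1) ^+ j)%:E * Pr (hist Z t @^-1` A))%E.

(** Agreement is tested at block times only: at other times it may be accidental and need not
    last. *)
Definition meeting_time (wv : O * N) : option nat :=
  if pselect (exists j, coupled false wv (block_time L j) ==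
                        coupled true wv (block_time L j)) is left h
  then Some (block_time L (ex_minn h)) else None.

Lemma meeting_timeP wv m : time_le (meeting_time wv) m <->
  exists2 j, (block_time L j <= m)%N &
    coupled false wv (block_time L j) = coupled true wv (block_time L j).
Proof.
rewrite /meeting_time; case: pselect => [h|nh] /=; last first.
  by split=> // -[j _ e]; case: nh; exists j; apply/eqP.
case: ex_minnP => j /eqP ej jmin; split; first by move=> jm; exists j.
by move=> [i im /eqP/jmin ij]; apply: leq_trans im; exact: block_time_le.
Qed.

Lemma meeting_time_stopping :
  stopping_time (prefix_sigma (fun r k wv => coupled r wv k)) meeting_time.
Proof.
move=> m.
pose E := g_sigma_algebraType (\bigcup_(rk in [set rk : bool * nat | (rk.2 <= m)%N])
  preimage_set_system setT (fun wv : O * N => coupled rk.1 wv rk.2) measurable).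
have mE r k : (k <= m)%N -> measurable_fun setT (fun wv : E => coupled r wv k).
  move=> km _ A mA; rewrite setTI.
  exact: (@sub_sigma_gen _ _ _ _ [set rk : bool * nat | (rk.2 <= m)%N]
    (fun rk (wv : O * N) => coupled rk.1 wv rk.2) (r, k) A km mA).
have -> : [set wv | time_le (meeting_time wv) m] =
    \bigcup_(j in [set j | (block_time L j <= m)%N])
    [set wv | coupled false wv (block_time L j) == coupled true wv (block_time L j)].
  apply/seteqP; split => wv /=.
    by move=> /meeting_timeP[j jm e]; exists j => //=; apply/eqP.
  by move=> [j /= jm /eqP e]; apply/meeting_timeP; exists j.
apply: (@bigcup_measurable _ E) => j /= jm.
have := measurable_preim (measurableT_comp (measurable_eq_codable cX)
  (measurable_fun_pair (mE false _ jm) (mE true _ jm))) (I : measurable [set true]).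
by congr (measurable _).
Qed.

Lemma meeting_time_meet wv k : time_le (meeting_time wv) k ->
  coupled false wv k = coupled true wv k.
Proof. by move=> /meeting_timeP[j jk e]; symmetry; apply: (meet (j := j)). Qed.

(** The conditional probability is a function [g] of [Z t0], so the bound on it can be tested on the
    events where [Z t0] lies in a set [C]; these belong to the past and the separation bound
    applies. *)
Lemma meeting_time_tail (m : nat) (c : R) : (1 - 16^-1) ^+ (m.-1 %/ L) <= c ->
  exists g : O * N -> R,
    is_cexp PU past \1_[set w | ~~ time_le (meeting_time w) m] g /\
    {ae PU, forall w, g w <= c}.
Proof.
move=> rc.
pose B := [set q : S * S | forall j, (block_time L j <= m)%N ->
  q.1 (block_time L j) != q.2 (block_time L j)].
have mB : measurable B.
  have -> : B = \bigcap_(j in [set j | (block_time L j <= m)%N])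
      ~` [set q : S * S | q.1 (block_time L j) == q.2 (block_time L j)].
    by apply/seteqP; split => q H j jm; have := H j jm; move/negP.
  apply: bigcap_measurableType => j _; apply: measurableC.
  have := measurable_preim (measurableT_comp (measurable_eq_codable cX)
    (measurable_fun_pair (measurable_comp_coord (block_time L j) measurable_fst)
      (measurable_comp_coord (block_time L j) measurable_snd))) (I : measurable [set true]).
  by congr (measurable _).
have EB : [set w | ~~ time_le (meeting_time w) m] =
    [set wv | B (coupled false wv, coupled true wv)].
  apply/seteqP; split => wv /=.
    move=> /negP nt j jm; apply/eqP => e; apply: nt.
    by apply/meeting_timeP; exists j.
  by move=> H; apply/negP => /meeting_timeP[j jm e]; have : coupled false wv (block_time L j) !=
    coupled true wv (block_time L j) := H j jm; rewrite e eqxx.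
have mE : measurable [set wv | B (coupled false wv, coupled true wv)].
  exact: (measurable_preim (measurable_fun_pair (measurable_coupled false)
    (measurable_coupled true)) mB).
have [g [mg g01 gE]] := pair_cexp mB.
exists (g \o Z' t0); split; first by rewrite EB; exact: past_cexp.
apply: (ae_fst (Q := fun w => g (Z t0 w) <= c)).
apply: (chain_ae chain t0 (Q := fun x => g x <= c)).
have mgE : measurable_fun setT (EFin \o g) by exact/measurable_EFinP.
have c0 : 0 <= c by apply: le_trans rc; rewrite exprn_ge0//; lra.
have : {ae pi, forall x, ((g x)%:E <= c%:E)%E}; last first.
  by apply: filterS => x; rewrite lee_fin.
apply: ae_le_integral => //.
- by move=> x; rewrite lee_fin; case/andP: (g01 x).
- by rewrite integral_probability_cst ltry.
move=> C mC; rewrite integral_cst//.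
pose A := [set h : S | C (h 0%N)].
have mA : measurable A by exact: (measurable_preim (measurable_coord 0) mC).
have AE : hist Z t0 @^-1` A = Z t0 @^-1` C.
  by apply/seteqP; split => w; rewrite /A /= hist0.
have g0 x : (0 <= (EFin \o g) x)%E by rewrite lee_fin; case/andP: (g01 x).
rewrite -(integral_chain chain t0 mC mgE g0) -AE.
rewrite -(gE A mA).
have PA : Pr (hist Z t0 @^-1` A) = pi C by rewrite AE; case: chain => _ + _; exact.
apply: (@le_trans _ _ (((1 - 16^-1) ^+ (m.-1 %/ L))%:E * Pr (hist Z t0 @^-1` A))%E); last first.
  rewrite -[X in (_ <= _ * X)%E]PA; apply: lee_wpmul2r => //.
have mhA := measurable_preim (mhist t0) mA.
(* At time 0 no block time has passed and the bound is 1. By time [m.+1] the block time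
   [1 + L * (m %/ L)] has passed, and the paths must still be apart there. *)
case: m => [|m] in rc B mB EB mE gE *.
  rewrite div0n expr0 mul1e -(prob_fst Pr mhA).
  by apply: le_measure; rewrite ?inE;
    [apply: measurableI => //|exact: measurable_fst_sigma|exact: subIsetl];
    exact: measurable_fst_sigma.
apply: le_trans (tail t0 (m %/ L) mA).
apply: le_measure; rewrite ?inE.
- by apply: measurableI => //; exact: measurable_fst_sigma.
- exact: (measurable_preim (measurable_fun_pair
    (measurableT_comp (mhist t0) (@measurable_fst _ _ O N))
    (measurable_fun_pair (measurable_coupled false) (measurable_coupled true)))
    (measurable_apart cX (block_time L (m %/ L)) mA)).
move=> wv /= [Aw H]; split => //; apply: H.
by rewrite /block_time add1n ltnS mulnC leq_divM.
Qed.

End coupled_chain.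

(** * Finite-dimensional Hilbert spaces *)

Section hilbert.
Context (R : realType) (V : normedModType R) (ip : V -> V -> R).
Hypothesis hip : findim_hilbert ip.

Lemma ipC u v : ip u v = ip v u.
Proof. by case: hip. Qed.

Lemma ip_lin a u v w : ip w (a *: u + v) = a * ip w u + ip w v.
Proof. by case: hip => C Lin _ _; rewrite C Lin !(C _ w). Qed.

Lemma ip0 w : ip w 0 = 0.
Proof.
have := ip_lin 1 0 0 w; rewrite scale1r addr0 mul1r => /eqP.
by rewrite -subr_eq subrr eq_sym => /eqP.
Qed.

Lemma ipZ a u w : ip w (a *: u) = a * ip w u.
Proof. by rewrite -[a *: u]addr0 ip_lin ip0 addr0. Qed.

Lemma ipD u v w : ip w (u + v) = ip w u + ip w v.
Proof. by rewrite -[u]scale1r ip_lin mul1r scale1r. Qed.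

Lemma ipB u v w : ip w (u - v) = ip w u - ip w v.
Proof. by rewrite -scaleN1r ipD ipZ mulN1r. Qed.

Lemma ip_sum (I : Type) (s : seq I) (F : I -> V) w :
  ip w (\sum_(i <- s) F i) = \sum_(i <- s) ip w (F i).
Proof. exact: (big_morph (ip w) (fun u v => ipD u v w) (ip0 w)). Qed.

Lemma ip_norm v : ip v v = `|v| ^+ 2.
Proof. by case: hip => _ _ ->. Qed.

(** The squared norm of [v - ip x v *: x] is nonnegative. *)
Lemma ip_unit_le x v : ip x x = 1 -> `|ip x v| <= `|v|.
Proof.
move=> x1; rewrite -(@ler_pXn2r _ 2)// ?nnegrE// -ip_norm.
have : 0 <= ip (v - ip x v *: x) (v - ip x v *: x) by rewrite ip_norm sqr_ge0.
rewrite ipB ipZ ![ip (v - _) _]ipC !ipB !ipZ x1 (ipC v x).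
rewrite -normrX ger0_norm ?sqr_ge0//; lra.
Qed.

(** The orthogonal projection onto the span of [b] when [b] is orthonormal. *)
Definition ip_span_proj (b : seq V) v : V := \sum_(x <- b) ip x v *: x.

Let proj_lin b a u v :
  ip_span_proj b (a *: u + v) = a *: ip_span_proj b u + ip_span_proj b v.
Proof.
rewrite /ip_span_proj scaler_sumr -big_split; apply: eq_bigr => x _ /=.
by rewrite ip_lin scalerDl scalerA.
Qed.

Let proj0 b : ip_span_proj b 0 = 0.
Proof. by rewrite /ip_span_proj big1// => x _; rewrite ip0 scale0r. Qed.

Let proj_fix_sum b (c : V -> R) (s : seq V) : (forall x, x \in s -> ip_span_proj b x = x) ->
  ip_span_proj b (\sum_(x <- s) c x *: x) = \sum_(x <- s) c x *: x.
Proof.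
elim: s => [|x s IH] H; first by rewrite big_nil proj0.
rewrite big_cons proj_lin IH; first by rewrite H ?mem_head.
by move=> y ys; apply: H; rewrite inE ys orbT.
Qed.

Let proj_sym b u v : ip (ip_span_proj b u) v = ip u (ip_span_proj b v).
Proof.
rewrite ipC /ip_span_proj !ip_sum; apply: eq_bigr => x _.
by rewrite !ipZ mulrC (ipC v x) (ipC u x).
Qed.

(** Orthogonality is encoded by one invariant: the projection fixes the vectors of [s] and of [b].
    The residual [r] is orthogonal to every fixed vector; it is normalised and added unless it
    vanishes. *)
Lemma gram_schmidt (s : seq V) : exists2 b : seq V,
  (forall x, x \in b -> ip x x = 1) &
  forall x, x \in s ++ b -> ip_span_proj b x = x.
Proof.
elim: s => [|v s [b b1 bP]]; first by exists [::].
pose p := ip_span_proj b v; pose r := v - p.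
have fixp : ip_span_proj b p = p.
  by apply: proj_fix_sum => x xb; apply: bP; rewrite mem_cat xb orbT.
have [r0|rn0] := eqVneq r 0.
  exists b => // x; rewrite inE => /predU1P[->|]; last exact: bP.
  by rewrite -/p; apply/eqP; rewrite eq_sym -subr_eq0 -/r r0.
have orth x : ip_span_proj b x = x -> ip r x = 0.
  by move=> xE; rewrite ipC ipB -xE proj_sym -/p xE subrr.
pose e := `|r|^-1 *: r.
have nr : `|r| != 0 by rewrite normr_eq0.
have e1 : ip e e = 1.
  by rewrite /e ipZ ipC ipZ ip_norm; field.
have eorth x : ip_span_proj b x = x -> ip e x = 0.
  by move=> xE; rewrite ipC /e ipZ ipC orth// mulr0.
have projE x : ip_span_proj (e :: b) x = ip e x *: e + ip_span_proj b x.
  by rewrite /ip_span_proj big_cons.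
have projb x : ip_span_proj b x = x -> ip_span_proj (e :: b) x = x.
  by move=> xE; rewrite projE eorth// scale0r add0r.
have proje : ip_span_proj (e :: b) e = e.
  rewrite projE e1 scale1r /ip_span_proj big_seq big1 ?addr0// => x xb.
  by rewrite ipC eorth ?scale0r// bP// mem_cat xb orbT.
exists (e :: b) => [x|x]; first by rewrite inE => /predU1P[->//|/b1].
rewrite mem_cat !inE => /orP[/orP[/eqP->|xs]|/orP[/eqP->//|xb]]; last 2 first.
- by apply: projb; apply: bP; rewrite mem_cat xs.
- by apply: projb; apply: bP; rewrite mem_cat xb orbT.
have -> : v = `|r| *: e + p by rewrite /e scalerA mulfV// scale1r /r subrK.
by rewrite proj_lin proje projb.
Qed.

Lemma orthonormal_basis : exists2 b : seq V,
  (forall x, x \in b -> ip x x = 1) & forall v, v = \sum_(x <- b) ip x v *: x.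
Proof.
case: hip => _ _ _ [q [e span]].
have [b b1 bP] := gram_schmidt (codom e).
exists b => // v; have [c ->] := span v.
have fix_e (J : seq 'I_q) :
    ip_span_proj b (\sum_(j <- J) c j *: e j) = \sum_(j <- J) c j *: e j.
  elim: J => [|j J IH]; first by rewrite big_nil proj0.
  by rewrite big_cons proj_lin IH bP// mem_cat codom_f.
exact: esym (fix_e _).
Qed.

(** By polarization the inner product is a continuous expression in norms. *)
Lemma ip_continuous w : continuous (ip w).
Proof.
have polar v : ip w v = 2^-1 * (`|w + v| ^+ 2 - `|w| ^+ 2 - `|v| ^+ 2).
  rewrite -!ip_norm ipD ![ip (w + v) _]ipC !ipD (ipC v w); lra.
move=> v; rewrite (_ : ip w = fun v => 2^-1 * (`|w + v| ^+ 2 - `|w| ^+ 2 - `|v| ^+ 2)); last first.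
  by apply/funext => u; exact: polar.
have sq (f : V -> R) : {for v, continuous f} -> {for v, continuous (fun v => f v ^+ 2)}.
  by move=> cf; apply: cvgM.
apply: cvgM; first exact: cvg_cst.
apply: cvgB; last by apply: sq; exact: norm_continuous.
apply: cvgB; last exact: cvg_cst.
apply: sq; apply: cvg_norm; apply: cvgD; [exact: cvg_cst|exact: cvg_id].
Qed.

Lemma submeas_ip (T : pointedType) (G : set (set T)) (H : T -> V) w : sigma_algebra setT G ->
  submeas G (@borel V) H -> submeas G measurable (fun t => ip w (H t)).
Proof.
move=> sG HG; apply/submeas_measurable => //.
apply: (measurability _ (RGenOInfty.measurableE R)) => _ [_ [x ->] <-].
rewrite setTI /measurable /= (sigma_algebra_id sG).
apply: (HG (ip w @^-1` `]x, +oo[%classic)); apply: sub_sigma_algebra.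
apply: open_comp; [by move=> v _; exact: ip_continuous|exact: interval_open].
Qed.

(** Rational coefficients suffice. This is the separability that reduces open sets to countably many
    balls. *)
Lemma dense_combinations (b : seq V) : exists f : nat -> V,
  forall (a : V -> R) (eps : R), 0 < eps ->
    exists n, `|\sum_(x <- b) a x *: x - f n| < eps.
Proof.
elim: b => [|x b [f IH]].
  by exists (fun=> 0) => a eps e0; exists 0%N; rewrite big_nil subrr normr0.
exists (fun n => if unpickle n is Some (q, m) then ratr (q : rat) *: x + f (m : nat) else 0).
move=> a eps e0; have e2 : 0 < eps / 2 by rewrite divr_gt0.
have [m fm] := IH a _ e2.
have c0 : 0 < eps / 2 / (`|x| + 1) by rewrite divr_gt0// ltr_wpDl.
set c := eps / 2 / (`|x| + 1) in c0.
have [q] : exists q : rat, ratr q \in `]a x - c, a x + c[.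
  by apply: rat_in_itvoo; lra.
rewrite in_itv /= => /andP[q1 q2].
exists (pickle (q, m)); rewrite pickleK big_cons opprD addrACA -scalerBl.
rewrite (splitr eps) (le_lt_trans (ler_normD _ _))// ler_ltD// normrZ.
have qc : `|a x - ratr q| <= c by rewrite ler_norml; lra.
have x1 : 0 < `|x| + 1 by rewrite ltr_wpDl.
have -> : eps / 2 = c * (`|x| + 1) by rewrite /c divfK// gt_eqF.
by rewrite ler_pM// lerDl.
Qed.

(** The squared distance to a fixed vector is polynomial in the coefficients, hence measurable, and
    the preimage of an open set is a countable union of preimages of balls. *)
Lemma submeas_combination (T : pointedType) (G : set (set T)) (b : seq V)
    (a : V -> T -> R) : sigma_algebra setT G ->
  (forall x, x \in b -> submeas G measurable (a x)) ->
  submeas G (@borel V) (fun t => \sum_(x <- b) a x t *: x).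
Proof.
move=> sG Ga; set g := fun t => _.
pose E := g_sigma_algebraType G.
have GE A : G A <-> measurable (A : set E) by rewrite /measurable /= (sigma_algebra_id sG).
have ma x : x \in b -> measurable_fun setT (a x : E -> R).
  by move=> xb; apply/submeas_measurable => //; exact: Ga.
have msum (c : V -> E -> R) : (forall x, x \in b -> measurable_fun setT (c x)) ->
    measurable_fun setT (fun t => \sum_(x <- b) c x t).
  elim: (b) => [|x s IH] mc.
    by rewrite (_ : (fun t => _) = cst 0)//; apply/funext => t; rewrite big_nil.
  rewrite (_ : (fun t => _) = fun t => c x t + \sum_(y <- s) c y t); last first.
    by apply/funext => t; rewrite big_cons.
  apply: measurable_funD; first by apply: mc; rewrite mem_head.
  by apply: IH => y ys; apply: mc; rewrite inE ys orbT.
have mip w : measurable_fun setT (fun t : E => ip w (g t)).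
  rewrite (_ : (fun t => _) = fun t : E => \sum_(x <- b) (ip w x * a x t)); last first.
    by apply/funext => t; rewrite /g ip_sum; apply: eq_bigr => x _; rewrite ipZ mulrC.
  apply: msum => x xb; apply: measurable_funM; [exact: measurable_cst|exact: ma].
have mdist v : measurable_fun setT (fun t : E => `|g t - v| ^+ 2).
  rewrite (_ : (fun t => _) = fun t : E =>
    \sum_(x <- b) (a x t * ip x (g t)) - 2 * ip v (g t) + ip v v); last first.
    apply/funext => t; rewrite -ip_norm ipB ![ip (g t - v) _]ipC !ipB (ipC v (g t)).
    rewrite [in ip (g t) (g t)]/g ip_sum; under eq_bigr do rewrite ipZ (ipC (\sum_(_ <- _) _)).
    rewrite -/(g t); lra.
  apply: measurable_funD; last exact: measurable_cst.
  apply: measurable_funB; last by apply: measurable_funM; [exact: measurable_cst|exact: mip].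
  by apply: msum => x xb; apply: measurable_funM; [exact: ma|exact: mip].
have [f fb] := dense_combinations b.
have mball n r : 0 < r -> G [set t | `|g t - f n| < r].
  move=> r0; apply/GE.
  have := measurable_preim (mdist (f n)) (measurable_itv `]-oo, (r ^+ 2)[).
  congr (measurable _); apply/seteqP; split => t /=; rewrite in_itv /=.
    by rewrite ltr_pXn2r ?nnegrE// ltW.
  by move=> gr; rewrite ltr_pXn2r ?nnegrE// ltW.
have open_g U : open U -> G (g @^-1` U).
  move=> oU.
  rewrite (_ : g @^-1` U = \bigcup_n \bigcup_(k in [set k : nat | ball (f n) k.+1%:R^-1 `<=` U])
      [set t | `|g t - f n| < k.+1%:R^-1]).
    apply/GE; apply: bigcupT_measurable => n; apply: bigcup_measurable => k _.
    by apply/GE; apply: mball; rewrite invr_gt0.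
  apply/seteqP; split => t /=.
    move=> Ugt; have /nbhs_ballP[e /= e0 eU] : nbhs (g t) U by exact: open_nbhs_nbhs.
    have e2 : 0 < e / 2 by rewrite divr_gt0.
    have [k _ /(_ _ (leqnn k)) /= ke] := near_infty_natSinv_lt (PosNum e2).
    have k0 : 0 < k.+1%:R^-1 :> R by rewrite invr_gt0.
    have [n gn] := fb (fun x => a x t) _ k0.
    exists n => //; exists k => //= v; rewrite -ball_normE /= => fv.
    apply: eU; rewrite -ball_normE /= -(subrK (f n) (g t)) -addrA.
    by rewrite (le_lt_trans (ler_normD _ _))// (splitr e) ltrD// (lt_trans _ ke).
  move=> [n _ [k kU gk]]; apply: kU; rewrite -ball_normE /= distrC.
  exact: gk.
move=> A; move: A; apply: smallest_sub; last exact: open_g.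
have := sigma_algebra_image g sG.
rewrite (_ : image_set_system setT g G = [set A | G (g @^-1` A)])//.
by apply/seteqP; split => A; rewrite /image_set_system /= setTI.
Qed.

End hilbert.

Lemma is_cexp_sum (R : realType) d (T : measurableType d) (mu : probability T R)
    (G : set (set T)) (I : eqType) (s : seq I) (c : I -> R) (F E : I -> T -> R) :
  sigma_algebra setT G -> G `<=` measurable ->
  (forall i, i \in s -> is_cexp mu G (F i) (E i)) ->
  is_cexp mu G (fun t => \sum_(i <- s) c i * F i t) (fun t => \sum_(i <- s) c i * E i t).
Proof.
move=> sG mG; elim: s => [|i s IH] H.
  have := is_cexp_cst mu sG 0.
  by congr is_cexp; apply/funext => t; rewrite big_nil.
have Hs j : j \in s -> is_cexp mu G (F j) (E j) by move=> js; apply: H; rewrite inE js orbT.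
have := is_cexp_lin sG mG (c i) (H i (mem_head _ _)) (IH Hs).
by congr is_cexp; apply/funext => t; rewrite big_cons.
Qed.

Lemma sigma_gen_mono d (X : measurableType d) (I T : Type) (K K' : set I)
    (f : I -> T -> X) : K `<=` K' -> sigma_gen K f `<=` sigma_gen K' f.
Proof.
move=> KK; apply: sigma_gen_smallest; first exact: sigma_algebra_sigma_gen.
by move=> k A /KK Kk mA; exact: sub_sigma_gen.
Qed.

(** * Averaging out the noise *)

Section noise_average.
Context (R : realType) d (X : measurableType d) dO (O : measurableType dO)
  (Pr : probability O R) (Z : int -> O -> X) (K : set int).
Hypothesis mZ : forall k, measurable_fun setT (Z k).

Local Notation N := (measurableTypeR R).
Local Notation U := (unoise R).
Local Notation PU := (Pr \x U)%E.

(* O with the sigma-algebra of the observed coordinates only: Fubini's theorem on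
   OK x N is what gives measurability with respect to that sigma-algebra. *)
Let OK := g_sigma_algebraType (\bigcup_(k in K) preimage_set_system setT (Z k) measurable).
Let calX := sigma_gen setT (fun k => Z k \o (fst : O * N -> O)).

Let calX_measurable : calX `<=` measurable.
Proof.
by apply: measurable_sigma_gen => k _; exact: (measurableT_comp (mZ k) measurable_fst).
Qed.

Let coarsen dT (T : measurableType dT) (f : OK * N -> T) :
  measurable_fun setT f -> measurable_fun setT (f : O * N -> T).
Proof.
move=> mf; have m1 : measurable_fun setT (fun wv : O * N => wv.1 : OK).
  move=> _ A mA; rewrite setTI; apply: measurable_fst_sigma.
  exact: (@measurable_sigma_gen _ X _ _ O K Z (fun k _ => mZ k) A mA).
have := measurableT_comp mf (measurable_fun_pair m1 measurable_snd).
by rewrite (_ : _ \o _ = f)//; apply/funext => -[].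
Qed.

Lemma noise_average (f : O * N -> R) :
  measurable_fun setT (f : OK * N -> R) -> PU.-integrable setT (EFin \o f) ->
  exists2 g : O -> R, submeas (sigma_gen K Z) measurable g &
    is_cexp PU calX f (g \o fst).
Proof.
move=> mf fi.
pose F w := (\int[U]_v (f (w, v))%:E)%E.
have mfE : measurable_fun setT (EFin \o f : OK * N -> \bar R) by exact/measurable_EFinP.
have mF : measurable_fun setT (F : OK -> \bar R).
  (* Tonelli's theorem gives measurability for the positive and the negative parts separately. *)
  rewrite (_ : F = (fun w => \int[U]_v (EFin \o f)^\+%E (w, v)) \-
      (fun w => \int[U]_v (EFin \o f)^\-%E (w, v)))%E; last first.
    apply/funext => w; rewrite /F integralE.
    by congr (_ - _)%E; apply: eq_integral => v _; rewrite ?funeposE ?funenegE.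
  apply: emeasurable_funB.
    apply: measurable_integral_snd; [exact: measurable_funepos|by move=> z; exact: funepos_ge0].
  apply: measurable_integral_snd; [exact: measurable_funeneg|by move=> z; exact: funeneg_ge0].
(* By integrability the average is finite almost surely; [fine] puts the default 0 elsewhere. *)
pose g := fine \o F.
have mg : measurable_fun setT (g : OK -> R).
  exact: (measurableT_comp (fine_measurable measurableT) mF).
have gK : submeas (sigma_gen K Z) measurable g.
  by move=> A mA; have := measurable_preim mg mA.
have sK : sigma_gen K Z `<=` measurable by apply: measurable_sigma_gen => k _; exact: mZ.
have mgO : measurable_fun setT (g : O -> R).
  by move=> _ A mA; rewrite setTI; apply: sK; exact: gK.
have Fi : Pr.-integrable setT F by exact: (integrable_fubini_F fi).
have gi : Pr.-integrable setT (EFin \o g).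
  apply: (le_integrable measurableT _ _ Fi); first exact/measurable_EFinP.
  by move=> w _; rewrite /g /=; case: (F w) => [r| |] //=; rewrite normr0 leey.
have fst_int (h : O -> R) : Pr.-integrable setT (EFin \o h) ->
    PU.-integrable setT (EFin \o (h \o fst)).
  move=> /integrableP[mh hoo]; apply/integrableP; split.
    exact: (measurableT_comp mh measurable_fst).
  rewrite (fubini_tonelli1 (fun wv => `|(EFin \o (h \o fst)) wv|%E))//; last first.
    by apply: measurableT_comp => //; exact: (measurableT_comp mh measurable_fst).
  apply: le_lt_trans hoo; apply: ge0_integral_mono => w; first exact: integral_ge0.
  by rewrite /fubini_F /= integral_probability_cst.
exists g => //; split => //; first exact: fst_int.
  move=> A mA; apply: (sigma_gen_mono (subsetT K)).
  exact: (@sigma_gen_fst_preim R _ _ _ _ Z K _ (gK A mA)).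
move=> A /sigma_gen_fst[B BX ->].
have mB : measurable B by move: B BX; apply: measurable_sigma_gen => k _; exact: mZ.
have mB' := measurable_fst_sigma (R := R) mB.
have red (h : O * N -> R) : PU.-integrable setT (EFin \o h) ->
    (\int[PU]_(wv in [set wv | B wv.1]) (h wv)%:E =
     \int[Pr]_(w in B) \int[U]_v (h (w, v))%:E)%E.
  move=> hi; rewrite [LHS]integral_mkcond [RHS]integral_mkcond.
  have hBi : PU.-integrable setT ((EFin \o h) \_ [set wv | B wv.1]).
    by apply/(integrable_mkcond _ mB'); exact: integrableS hi.
  rewrite -(integral12_prod_meas1 hBi); apply: eq_integral => w _.
  rewrite patchE /fubini_F; case: ifPn => wB.
    by apply: eq_integral => v _; rewrite patchE ifT//; apply: mem_set; exact: set_mem wB.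
  by apply: integral0_eq => v _; rewrite patchE ifN.
rewrite (red _ (fst_int _ gi)) (red _ fi).
transitivity (\int[Pr]_(w in B) (EFin \o g) w)%E.
  by apply: eq_integral => w _; exact: (integral_probability_cst U (g w)%:E).
have mFO : measurable_fun setT F by case/integrableP: Fi.
apply: ae_eq_integral => //.
- by apply: measurable_funTS; apply/measurable_EFinP.
- exact: measurable_funTS.
have := integrable_ae measurableT Fi; apply: filterS => w /= Ff _.
by rewrite fineK//; exact: Ff.
Qed.

(** The coordinates in an orthonormal basis are averaged one at a time, and every [ip u] of [H] is a
    fixed linear combination of them. *)
Lemma noise_average_vec (V : normedModType R) (ip : V -> V -> R) (H : O * N -> V) :
  findim_hilbert ip ->
  (forall A, borel A -> measurable (H @^-1` A : set (OK * N))) ->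
  PU.-integrable setT (fun w => `|H w|%:E) ->
  exists g : O * N -> V,
    submeas (sigma_gen K (fun k => Z k \o (fst : O * N -> O))) (@borel V) g /\
    is_cexp_vec PU calX ip H g.
Proof.
move=> hip mH Hi; have [b b1 bE] := orthonormal_basis hip.
have mip x : measurable_fun setT (fun wv : OK * N => ip x (H wv)).
  move=> _ A mA; rewrite setTI; move: A mA.
  exact: (submeas_ip hip x (@sigma_algebra_measurable _ (OK * N)%type) mH).
have iip x : x \in b -> PU.-integrable setT (EFin \o (fun wv => ip x (H wv))).
  move=> xb; apply: (le_integrable measurableT _ _ Hi).
    by apply/measurable_EFinP; exact: coarsen.
  by move=> wv _ /=; rewrite lee_fin [leRHS]ger0_norm//; apply: ip_unit_le => //; exact: b1.
have /choice[g gP] : forall x, exists gx : O -> R, x \in b ->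
    submeas (sigma_gen K Z) measurable gx /\
    is_cexp PU calX (fun wv => ip x (H wv)) (gx \o fst).
  move=> x; have [xb|] := boolP (x \in b); last by exists (fun=> 0).
  by have [gx gK gc] := noise_average (mip x) (iip x xb); exists gx.
have sX := sigma_algebra_sigma_gen setT (fun k => Z k \o (fst : O * N -> O)).
have gsub : submeas (sigma_gen K (fun k => Z k \o (fst : O * N -> O))) (@borel V)
    (fun wv => \sum_(x <- b) g x wv.1 *: x).
  apply: (submeas_combination hip (a := fun x wv => g x wv.1)).
    exact: sigma_algebra_sigma_gen.
  move=> x xb A mA.
  have := @sigma_gen_fst_preim R _ _ _ _ Z K _ ((gP x xb).1 A mA).
  exact.
exists (fun wv => \sum_(x <- b) g x wv.1 *: x); split=> //; split.
  by move=> A bA; apply: (sigma_gen_mono (subsetT K)); exact: gsub.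
move=> u.
have := is_cexp_sum (ip u) sX calX_measurable (fun x xb => (gP x xb).2).
congr is_cexp; apply/funext => wv.
  by rewrite {2}(bE (H wv)) (ip_sum hip); apply: eq_bigr => x _; rewrite (ipZ hip) mulrC.
by rewrite (ip_sum hip); apply: eq_bigr => x _; rewrite (ipZ hip) mulrC.
Qed.

End noise_average.

Lemma tv_mixing (R : realType) d (X : measurableType d) (P : R.-pker X ~> X)
    (pi : probability X R) (m : nat) (c : R) :
  (ereal_sup [set tv_dist (kpow P m x) pi | x in [set: X]] <= c%:E)%E ->
  forall x B, measurable B -> (pi B <= kpow P m x B + c%:E)%E.
Proof.
move=> H x B mB; have [K KE] := kpow_kernel P m.
have : (`|kpow P m x B - pi B| <= c%:E)%E.
  apply: le_trans H; apply: (@le_trans _ _ (tv_dist (kpow P m x) pi)).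
    by apply: ereal_sup_ubound; exists B.
  by apply: ereal_sup_ubound; exists x.
rewrite KE//; have Kf : K x B \is a fin_num.
  rewrite ge0_fin_numE// (@le_lt_trans _ _ (K x setT))//; last by rewrite prob_kernel ltry.
  by apply: le_measure; rewrite ?inE.
have pf : pi B \is a fin_num by rewrite ge0_fin_numE// probability_lty.
move: Kf pf => /fineK <- /fineK <-; rewrite -EFinB abse_EFin -EFinD !lee_fin.
by rewrite ler_norml => /andP[]; lra.
Qed.

Section observed.
Context (R : realType) d (X : measurableType d) dO (O : measurableType dO)
  (Z : int -> O -> X) (K : set int).

Let OK := g_sigma_algebraType (\bigcup_(k in K) preimage_set_system setT (Z k) measurable).

(** When [e] reads only coordinates in [K], both paths computed from it are measurable for the
    observed coordinates and the noise, which is the form that [noise_average_vec] asks for. *)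
Lemma measurable_observed (Y : seqspace X * measurableTypeR R -> seqspace X)
    (e : O -> seqspace X) (r : bool) (k : nat) :
  measurable_fun setT Y -> (forall i, exists2 l, K l & forall w, e w i = Z l w) ->
  measurable_fun setT (fun wv : OK * measurableTypeR R =>
    (if r then Y (e wv.1, wv.2) else e wv.1) k).
Proof.
move=> mY eZ.
have me : measurable_fun setT (e : OK -> seqspace X).
  apply: measurable_seq => i; have [l Kl el] := eZ i.
  rewrite (_ : (fun t => _) = (Z l : OK -> X)); last exact/funext.
  by move=> _ A mA; rewrite setTI; exact: sub_sigma_gen.
have me1 := measurableT_comp me (@measurable_fst _ _ OK (measurableTypeR R)).
case: r; last exact: (measurable_comp_coord k me1).
exact: (measurable_comp_coord k (measurableT_comp mY (measurable_fun_pair me1 measurable_snd))).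
Qed.

End observed.

Theorem lemma3 (R : realType) (C0 rho0 : R) (hrho0 : 0 < rho0 < 1) :
  exists (L : nat) (Cc rhoc : R),
    [/\ (2 <= L)%N, 0 < rhoc < 1,
        forall m, (1 <= m)%N -> (m <= bblock L m <= m + L - 1)%N &
  forall (d : measure_display) (X : measurableType d)
    (P : R.-pker X ~> X) (pi : probability X R)
    (dO : measure_display) (O : measurableType dO) (Pr : probability O R)
    (Z : int -> O -> X),
  standard_borel R X ->
  stationary_distribution P pi ->
  (forall m : nat,
     (ereal_sup [set tv_dist (kpow P m x) pi | x in [set: X]]
        <= (C0 * rho0 ^+ m)%:E)%E) ->
  stationary_markov_chain Pr P pi Z ->
  forall n : nat, (1 <= n)%N -> forall i : nat, (1 <= i <= n)%N ->
  exists (dO' : measure_display) (O' : measurableType dO')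
    (Pr' : probability O' R) (p : O' -> O) (Y : bool -> nat -> O' -> X),
  let Z' := fun k : int => Z k \o p in
  let t0 := i%:Z - 1 in
  let calX := sigma_gen setT Z' in
  let past := sigma_gen [set j : int | j <= t0] Z' in
  let J := prefix_sigma Y in
  extension Pr Pr' p /\
  (forall r k, measurable_fun setT (Y r k)) /\
  (* (i) *)
  [/\ forall (k : nat) w, Y false k w = Z' (t0 + k%:Z) w,
      cond_exchangeable Pr' past Y,
      forall r, cond_markov_from Pr' past P (Z' t0) (Y r) &
      forall f : X -> R, bounded_measurable f ->
        is_cexp Pr' calX (f \o Y true 1%N) (kerf P f \o Z' t0)] /\
  (* (ii) *)
  (exists kappa : O' -> option nat,
     [/\ stopping_time J kappa,
         forall w k, time_le (kappa w) k -> Y false k w = Y true k w &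
         forall m : nat, exists g : O' -> R,
           is_cexp Pr' past \1_[set w | ~~ time_le (kappa w) m] g /\
           {ae Pr', forall w, g w <= Cc * rhoc ^+ m}]) /\
  (* (iii) *)
  (forall (V : normedModType R) (ip : V -> V -> R)
     (h : (bool -> nat -> X) -> V),
     findim_hilbert ip ->
     submeas (@cyl _ X) (@borel V) h ->
     let H := h \o pair_path Y in
     Pr'.-integrable setT (fun w => `|H w|%:E) ->
     (exists g : O' -> V,
        submeas (sigma_gen [set r : int | t0 <= r] Z') (@borel V) g /\
        is_cexp_vec Pr' calX ip H g) /\
     (forall m : nat, submeas (J (bblock L m)) (@borel V) H ->
        exists g : O' -> V,
          submeas (sigma_gen
            [set r : int | t0 <= r <= t0 + (bblock L m)%:Z] Z')
            (@borel V) g /\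
          is_cexp_vec Pr' calX ip H g))].

Proof.
(* [m] makes [C0 * rho0 ^+ m] at most 1/16. It is chosen before the chain, so all constants depend
   on [C0] and [rho0] only. *)
have [m m1 mC] := geometric_small C0 hrho0 (ltac:(by rewrite invr_gt0) : 0 < 16^-1).
have L0 : (0 < m + m)%N by rewrite addn_gt0 m1.
have L1 : 1 <= (m + m)%:R :> R by rewrite ler1n.
(* The factor and the rate are those of [block_rate], which converts the loss of 15/16 per block. *)
exists (m + m)%N, 2, (1 - (16 * (m + m)%:R)^-1); split.
- by lia.
- have c0 : 0 < (16 * (m + m)%:R : R)^-1 by rewrite invr_gt0 mulr_gt0// ltr0n.
  rewrite subr_gt0 invf_lt1 ?mulr_gt0 ?ltr0n//.
  by apply/andP; split; lra.
- by move=> k; exact: bblock_bounds.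
move=> d X P pi dO O Pr Z sbX _ mix chain n _ i _.
have cX : codable X := standard_borel_codable point sbX.
have mixing x B : measurable B -> (pi B <= kpow P m x B + 16^-1%:E)%E.
  by apply: tv_mixing; apply: le_trans (mix m) _; rewrite lee_fin.
have [Xi [Y [[mXi mY XiE Y1E Y0] [meet local symm tail]]]] :=
  block_coupling chain cX m1 mixing.
set L := (m + m)%N in L0 L1 meet local tail *.
pose t0 := i%:Z - 1.
exists _, (O * measurableTypeR R)%type, (Pr \x unoise R)%E, fst,
  (fun r k wv => coupled Z Y t0 r wv k).
move=> Z' t0' calX past J.
have mc r k : measurable_fun setT (fun wv => coupled Z Y t0 r wv k).
  exact: (measurable_comp_coord k (measurable_coupled chain mY t0 r)).
split; first exact: noise_extensionP.
split; first exact: mc.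
split.
  split => //.
  - exact: (coupled_exchangeable chain mXi mY XiE symm).
  - by move=> r; exact: (coupled_markov chain mY Y0 symm).
  - by move=> f; exact: (coupled_refresh chain mXi mY XiE Y1E).
split.
  exists (meeting_time Z L Y t0); split.
  - exact: meeting_time_stopping.
  - by move=> w k; exact: meeting_time_meet.
  - move=> k; exact: (meeting_time_tail chain cX mXi mY XiE t0 tail (block_rate R k L0)).
move=> V ip h hip hcyl H Hi.
have mZ := measurable_chain chain.
pose OK (K : set int) := g_sigma_algebraType
  (\bigcup_(k in K) preimage_set_system setT (Z k) measurable).
have obs K (e : O -> seqspace X) r k :
    (forall i, exists2 l, K l & forall w, e w i = Z l w) ->
    (forall wv, coupled Z Y t0 r wv k = (if r then Y (e wv.1, wv.2) else e wv.1) k) ->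
    measurable_fun setT (fun wv : OK K * measurableTypeR R => coupled Z Y t0 r wv k).
  move=> eK eE; have := measurable_observed r k mY eK.
  by congr measurable_fun; apply/funext => wv; rewrite eE.
split.
  apply: (noise_average_vec (K := [set r : int | t0 <= r]) mZ hip _ Hi) => A bA.
  apply: cyl_preimage (hcyl A bA) => r k; apply: (obs _ (path Z t0)) => //.
  by move=> l; exists (t0 + l%:Z) => //=; lia.
move=> k HJ.
apply: (noise_average_vec (K := [set r : int | t0 <= r <= t0 + (bblock L k)%:Z]) mZ hip _ Hi).
move=> A bA; apply: (@measurable_sigma_gen _ X _ _ (OK _ * measurableTypeR R)%type _
  (fun rk wv => coupled Z Y t0 rk.1 wv rk.2) _ _ (HJ A bA)) => -[r l] /= lk.
apply: (obs _ (fun w => freeze (bblock L k) (path Z t0 w))).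
  move=> j; exists (t0 + (minn j (bblock L k))%:Z) => //=; lia.
move=> wv; rewrite /coupled; case: r; last by rewrite /freeze (minn_idPl lk).
(* [b(0) = 0] is not a block time, but there only the common starting point is involved; the other
   values of [b] are block times. *)
case: k lk {HJ} => [|k] lk.
  by move: lk; rewrite leqn0 => /eqP ->; rewrite !Y0.
by have [j bj] := bblock_time L (ltn0Sn k); rewrite bj local// -bj.
Qed.
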